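(* The zero locus in $OG(2,14)$ of a general global section of the spinor bundle $\mathcal{S}_+$ is the disjoint union of two copies of $G_2/P_2$.
   Context: Over $\mathbb{C}$. $OG(2,14)$ is the orthogonal Grassmannian of isotropic planes $U$ in $V=\mathbb{C}^{14}$ with a non-degenerate quadratic form. Write $V=E\oplus F$ with $E,F$ maximal isotropic, $F\simeq E^\vee$. The half-spin representations of $Spin_{14}$ are $\Delta_+=\wedge^{even}E$, $\Delta_-=\wedge^{odd}E$ (of dimension $64$), with Clifford action $V\otimes\Delta_\pm\to\Delta_\mp$ ($E$ acts by wedge product, $F$ by contraction). The spinor bundle $\mathcal{S}_+$ on $OG(2,14)$ is the homogeneous bundle of rank $16$ whose fiber at $[U]$ is the cokernel of $U\otimes\Delta_-\to\Delta_+$; $H^0(\mathcal{S}_+)=\Delta_+$. $P_2\subset G_2$ is the maximal parabolic subgroup associated to the long simple root, so that $G_2/P_2$ is the adjoint variety of $G_2$, i.e. the closed orbit in $\mathbb{P}(\mathfrak{g}_2)$. *)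

(* Defs.v *)
From mathcomp Require Import all_boot all_order all_algebra.
From mathcomp Require Export reals complex mpoly.

Set Implicit Arguments.
Unset Strict Implicit.
Unset Printing Implicit Defensive.

Import GRing.Theory.
Local Open Scope ring_scope.

(* Spinors.  Everything is defined over a commutative ring A, because the     *)
(* scheme structure of the zero locus is described through its A-points.      *)

Section Spinors.
Variable A : comNzRingType.

(* A row of width 7 + 7 is a vector of V = E (+) F, with F = E^\vee in the    *)
(* dual basis: the quadratic form is the evaluation pairing.                  *)
Definition quad (w : 'rV[A]_(7 + 7)) : A :=
  \sum_(i < 7) lsubmx w 0 i * rsubmx w 0 i.

(* Elements of /\E; chi I is the coefficient of e_I = e_i1 /\ ... /\ e_ik,    *)
(* where I = {i1 < ... < ik}.                                                 *)
Definition spinor := {ffun {set 'I_7} -> A}.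

Definition even_spinor (chi : spinor) : Prop :=
  forall I : {set 'I_7}, odd #|I| -> chi I = 0.

Definition odd_spinor (chi : spinor) : Prop :=
  forall I : {set 'I_7}, ~~ odd #|I| -> chi I = 0.

Definition sgn_below (i : 'I_7) (I : {set 'I_7}) : A :=
  (-1) ^+ #|[set j in I | (j < i)%N]|.

(* (x + f) . chi = x /\ chi + f _| chi for x in E and f in F; it satisfies    *)
(* w . (w . chi) = quad w *: chi.                                             *)
Definition clifford (w : 'rV[A]_(7 + 7)) (chi : spinor) : spinor :=
  [ffun I : {set 'I_7} =>
     \sum_(i in I) lsubmx w 0 i * sgn_below i I * chi (I :\ i)
   + \sum_(i in ~: I) rsubmx w 0 i * sgn_below i I * chi (i |: I)].

(* A frame is the pair of rows of M; the right inverse expresses that         *)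
(* A^2 -> V_A is a split monomorphism, i.e. that the rows are a basis of a    *)
(* rank 2 direct summand U of V_A (linear independence if A is a field).      *)
Definition isotropic_frame (M : 'M[A]_(2, 7 + 7)) : Prop :=
  (exists N : 'M[A]_(7 + 7, 2), M *m N = 1%:M)
  /\ (forall a : 'rV[A]_2, quad (a *m M) = 0).

(* psi vanishes in the cokernel of U (x) Delta_- -> Delta_+.  Cokernels       *)
(* commute with base change, so this is the vanishing at the A-point U of the *)
(* section of the spinor bundle defined by psi.                               *)
Definition spinor_section_vanishes (psi : spinor) (M : 'M[A]_(2, 7 + 7)) :
    Prop :=
  exists chi : 'I_2 -> spinor,
    (forall k, odd_spinor (chi k)) /\
    psi = \sum_k clifford (row k M) (chi k).

Definition zero_frame (psi : spinor) (M : 'M[A]_(2, 7 + 7)) : Prop :=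
  isotropic_frame M /\ spinor_section_vanishes psi M.

(* u /\ v as the antisymmetric tensor u (x) v - v (x) u, u and v being the    *)
(* rows of M.                                                                 *)
Definition plucker (M : 'M[A]_(2, 7 + 7)) : 'rV[A]_((7 + 7) * (7 + 7)) :=
  mxvec (\matrix_(i, j) (M 0 i * M 1 j - M 1 i * M 0 j)).

End Spinors.

(* Subsets of the projective space P(K^n) are given by the predicate on       *)
(* nonzero vectors that holds on all representatives of their points.         *)

Section ProjectiveVarieties.
Variable K : fieldType.

Definition peval n (P : {mpoly K[n]}) (x : 'rV[K]_n) : K :=
  P.@[fun i => x 0 i].

Definition zariski_closed n (X : 'rV[K]_n -> Prop) : Prop :=
  exists S : {mpoly K[n]} -> Prop,
    (forall P, S P -> exists d : nat, P \is d.-homog) /\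
    (forall x, X x <-> x != 0 /\ forall P, S P -> peval P x = 0).

Definition same_point n (x y : 'rV[K]_n) : Prop :=
  exists c : K, c != 0 /\ y = c *: x.

(* f acts on representatives; as the Q k are homogeneous of the same degree,  *)
(* the last condition forces f to be well defined on points.                  *)
Definition regular_map m n (X : 'rV[K]_m -> Prop) (Y : 'rV[K]_n -> Prop)
    (f : 'rV[K]_m -> 'rV[K]_n) : Prop :=
  (forall x, X x -> Y (f x)) /\
  (forall x, X x ->
     exists (d : nat) (Q : 'I_n -> {mpoly K[m]}),
       [/\ forall k, Q k \is d.-homog,
           \row_k peval (Q k) x != 0
         & forall y, X y -> \row_k peval (Q k) y != 0 ->
             same_point (f y) (\row_k peval (Q k) y)]).

Definition isomorphic m n (X : 'rV[K]_m -> Prop) (Y : 'rV[K]_n -> Prop) :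
    Prop :=
  exists (f : 'rV[K]_m -> 'rV[K]_n) (g : 'rV[K]_n -> 'rV[K]_m),
    [/\ regular_map X Y f, regular_map Y X g,
        forall x, X x -> same_point (g (f x)) x
      & forall y, Y y -> same_point (f (g y)) y].

Definition disjoint_union_of_two_copies m n (Z : 'rV[K]_m -> Prop)
    (Y : 'rV[K]_n -> Prop) : Prop :=
  exists Z1 Z2 : 'rV[K]_m -> Prop,
    [/\ zariski_closed Z1 /\ zariski_closed Z2,
        forall x, Z x <-> Z1 x \/ Z2 x,
        forall x, ~ (Z1 x /\ Z2 x)
      & isomorphic Z1 Y /\ isomorphic Z2 Y].

End ProjectiveVarieties.

Section ZeroLocus.
Variable K : fieldType.

(* The closed points, in the Plucker embedding of OG(2, V); all               *)
(* representatives are obtained since M runs over all frames of U.            *)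
Definition zero_locus (psi : spinor K) (p : 'rV[K]_((7 + 7) * (7 + 7))) :
    Prop :=
  exists M, zero_frame psi M /\ p = plucker M.

(* The zero scheme of the section is reduced: its A-points (it is enough to   *)
(* consider those with U free, as every A-point is locally of this form) lie  *)
(* on the closed subscheme of projective space defined by the homogeneous     *)
(* ideal of its set of closed points.                                         *)
Definition zero_scheme_reduced (psi : spinor K) : Prop :=
  forall (A : comAlgType K) (M : 'M[A]_(2, 7 + 7)),
    zero_frame [ffun I => (psi I)%:A] M ->
    forall (d : nat) (P : {mpoly K[(7 + 7) * (7 + 7)]}), P \is d.-homog ->
      (forall p, zero_locus psi p -> peval P p = 0) ->
      (map_mpoly (in_alg A) P).@[fun i => plucker M 0 i] = 0.

(* Q holds on a nonempty Zariski open subset of Delta_+. *)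
Definition for_general_even_spinor (Q : spinor K -> Prop) : Prop :=
  exists P : {mpoly K[#|{: {set 'I_7}}|]},
    (exists psi, even_spinor psi /\ P.@[fun i => psi (enum_val i)] != 0) /\
    (forall psi, even_spinor psi -> P.@[fun i => psi (enum_val i)] != 0 ->
       Q psi).

End ZeroLocus.

Section G2.
Variable K : fieldType.

(* The value of x_i /\ x_j /\ x_k on (x, y, z). *)
Definition wedge3 (i j k : 'I_7) (x y z : 'rV[K]_7) : K :=
  \det (\matrix_(r < 3, c < 3) [:: x; y; z]`_r 0 [:: i; j; k]`_c).

(* A 3-form in the open GL_7-orbit, written along 7 = 1 + 3 + 3^\vee for the  *)
(* subgroup SL_3 of G_2.                                                      *)
Definition g2_form (x y z : 'rV[K]_7) : K :=
    wedge3 0 1 4 x y z + wedge3 0 2 5 x y z + wedge3 0 3 6 x y z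
  + wedge3 1 2 3 x y z + wedge3 4 5 6 x y z.

(* The stabilizer of the form in GL_7 is G_2 x mu_3, in SL_7 it is G_2. *)
Definition G2_group (g : 'M[K]_7) : Prop :=
  \det g = 1 /\
  forall x y z, g2_form (x *m g) (y *m g) (z *m g) = g2_form x y z.

Definition g2_algebra (X : 'M[K]_7) : Prop :=
  forall x y z,
    g2_form (x *m X) y z + g2_form x (y *m X) z + g2_form x y (z *m X) = 0.

(* The orbit in P(g_2) of the point defined by X, g_2 being embedded in gl_7. *)
Definition adjoint_orbit (X : 'M[K]_7) (p : 'rV[K]_(7 * 7)) : Prop :=
  exists (g : 'M[K]_7) (c : K),
    [/\ G2_group g, c != 0 & p = mxvec (c *: (g *m X *m invmx g))].

(* Y is the closed orbit of G_2 in P(g_2), i.e. Y = G_2 / P_2.  The closed    *)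
(* orbit is unique because g_2 is an irreducible representation.              *)
Definition G2_adjoint_variety (Y : 'rV[K]_(7 * 7) -> Prop) : Prop :=
  exists X : 'M[K]_7,
    [/\ X != 0, g2_algebra X, forall p, Y p <-> adjoint_orbit X p
      & zariski_closed Y].

End G2.

(* Main.v *)
(* For an isotropic plane U with basis (u, v), psi vanishes in the cokernel of
   U (x) Delta_- -> Delta_+ if and only if u . v . psi = 0.

   By Gaussian elimination with root elements of Spin_14, a general psi can be moved to
   psi0 = 1 + vol + x p_0 p_1 p_2 + x q_0 q_1 q_2, where E has basis p_0, q_0, p_1, q_1, p_2, q_2, x
   and vol is the product of all p_k and q_k; its stabilizer contains G_2 x G_2, acting on
   V = V_7 (+) V_7'.  Writing u and v in V_7 (+) V_7', the equation u . v . psi0 = 0 says that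
   both components are pairs of imaginary octonions with zero cross product, that the mixed
   tensors u_i v'_j - v_i u'_j vanish, and isotropy equates the quadratic forms of the
   components.  Over a field one component must vanish, so U is a special null plane of V_7 or of
   V_7'.

   Over an algebra A, a Plucker coordinate c of the component in V_7 kills the one in V_7', and
   c times the former is special.  The special planes with nonzero coordinate 15 form an affine
   cell, so a polynomial P that vanishes on all special planes has a value z = P(X) killed by a
   power of that coordinate for every special pair X over A.  The elements a with a^N z = 0 for
   some N form an ideal; using the translates by G_2, it contains all Plucker coordinates.  As
   those of U generate the unit ideal, z = 0, which is the reducedness.

   Finally, for B the Gram matrix of the quadratic form, x /\ y |-> B (x^T y - y^T x) maps the cone
   over special planes onto the G_2-orbit of a nilpotent matrix of rank 2: the elimination in the
   cell by root elements gives transitivity, and conversely matrices of rank 2 in g_2 with square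
   zero come from special planes. *)
Require Import Defs.
From mathcomp Require Import all_boot all_order all_algebra.
From mathcomp Require Import perm ring.

Set Implicit Arguments.
Unset Strict Implicit.
Unset Printing Implicit Defensive.

Import GRing.Theory Num.Theory.
Local Open Scope ring_scope.

(** * Clifford algebra *)

(** Two obstacles shape the proof. The normal form is reached only after solving a quadratic
    equation, so the intermediate coordinates live on a double cover of the space of spinors. The
    genericity condition is a function on that cover; it is pushed down by its norm, and must be
    nonzero at both points above an explicit spinor. Rescaling by each pivot instead of dividing
    keeps all coordinates polynomial.

    Hence equivalence of spinors is stated for frames over all algebras at once, relations are
    transported by explicit linear combinations, and vanishing on the cell is tested at a universal
    point with polynomial coordinates. Inverting a Plücker coordinate is replaced by recording that
    a power of it kills a value. From the translates of one extremal coordinate, comparison of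
    coefficients in the parameters of root elements then reaches the coordinates at all other
    weights of the adjoint representation. *)

Definition tog (i : 'I_7) (I : {set 'I_7}) : {set 'I_7} :=
  [set k | (k == i) (+) (k \in I)].

Lemma in_tog i k I : (k \in tog i I) = (k == i) (+) (k \in I).
Proof. by rewrite inE. Qed.

Lemma togK i : involutive (tog i).
Proof. by move=> I; apply/setP=> k; rewrite !in_tog addKb. Qed.

Lemma togC i j I : tog i (tog j I) = tog j (tog i I).
Proof. by apply/setP=> k; rewrite !in_tog addbCA. Qed.

Lemma odd_tog i I : odd #|tog i I| = ~~ odd #|I|.
Proof.
have [iI|iI] := boolP (i \in I).
  have -> : tog i I = I :\ i.
    by apply/setP=> k; rewrite in_tog !inE; case: eqP => // ->; rewrite iI.
  by rewrite (cardsD1 i I) iI /= negbK.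
have -> : tog i I = i |: I.
  by apply/setP=> k; rewrite in_tog !inE; case: eqP => // ->; rewrite (negbTE iI).
by rewrite cardsU1 iI.
Qed.

Section Clifford.
Variable A : comNzRingType.
Implicit Types (u v w : 'rV[A]_(7 + 7)) (chi psi : spinor A).

(** With [b := i \in I], the wedge and contraction parts of the action merge into one sum over
    [i]. *)
Definition cf w (i : 'I_7) (b : bool) : A :=
  if b then lsubmx w 0 i else rsubmx w 0 i.

Arguments cf : simpl never.

Lemma sgn_tog (i j : 'I_7) (I : {set 'I_7}) :
  sgn_below A j (tog i I) = (-1) ^+ (i < j)%N * sgn_below A j I.
Proof.
have E (J : {set 'I_7}) : sgn_below A j J = \prod_k (-1) ^+ ((k \in J) && (k < j)%N).
  rewrite /sgn_below -sum1_card (big_morph _ (exprD (-1 : A)) (expr0 _)) big_mkcond.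
  by apply: eq_bigr => k _; rewrite inE; case: (_ && _).
rewrite !E (bigD1 i) //= [in RHS](bigD1 i) //= mulrA in_tog eqxx /=; congr (_ * _).
  by case: (i \in I); case: (i < j)%N; rewrite /= ?expr0 ?mulr1 ?mul1r ?mulrNN ?mulr1.
by apply: eq_bigr => k /negbTE ki; rewrite in_tog ki.
Qed.

Lemma sgn_sq (j : 'I_7) (I : {set 'I_7}) : sgn_below A j I * sgn_below A j I = 1.
Proof. by rewrite /sgn_below -expr2 sqrr_sign. Qed.

Lemma cliffordE w chi I :
  clifford w chi I = \sum_i cf w i (i \in I) * sgn_below A i I * chi (tog i I).
Proof.
rewrite ffunE [RHS](bigID (mem I)) /=; congr (_ + _).
  apply: eq_bigr => i iI; rewrite /cf iI; congr (_ * chi _).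
  by apply/setP=> k; rewrite in_tog !inE; case: eqP => // ->; rewrite iI.
apply: eq_big => [i|i]; rewrite inE // => iI; rewrite /cf (negbTE iI); congr (_ * chi _).
by apply/setP=> k; rewrite in_tog !inE; case: eqP => // ->; rewrite (negbTE iI).
Qed.

Definition bil u v : A := \sum_i (cf u i true * cf v i false + cf u i false * cf v i true).

Lemma bilC u v : bil u v = bil v u.
Proof. by apply: eq_bigr => i _; rewrite addrC; congr (_ + _); rewrite mulrC. Qed.

Lemma cfD u v i b : cf (u + v) i b = cf u i b + cf v i b.
Proof. by rewrite /cf; case: b; rewrite raddfD !mxE. Qed.

Lemma cfZ (a : A) u i b : cf (a *: u) i b = a * cf u i b.
Proof. by rewrite /cf; case: b; rewrite linearZ !mxE. Qed.

Lemma quadE u : quad u = \sum_i cf u i true * cf u i false.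
Proof. by []. Qed.

Lemma quadD u v : quad (u + v) = quad u + quad v + bil u v.
Proof.
rewrite !quadE /bil -!big_split; apply: eq_bigr => i _ /=; rewrite !cfD; ring.
Qed.

Lemma quadZ (a : A) u : quad (a *: u) = a ^+ 2 * quad u.
Proof. by rewrite !quadE mulr_sumr; apply: eq_bigr => i _; rewrite !cfZ; ring. Qed.

Lemma bilDr u v w : bil u (v + w) = bil u v + bil u w.
Proof. by rewrite /bil -big_split; apply: eq_bigr => i _ /=; rewrite !cfD; ring. Qed.

Lemma bilZr (a : A) u v : bil u (a *: v) = a * bil u v.
Proof. by rewrite /bil mulr_sumr; apply: eq_bigr => i _; rewrite !cfZ; ring. Qed.

Lemma bilDl u v w : bil (u + v) w = bil u w + bil v w.
Proof. by rewrite bilC bilDr !(bilC w). Qed.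

Lemma bilZl (a : A) u v : bil (a *: u) v = a * bil u v.
Proof. by rewrite bilC bilZr bilC. Qed.

Lemma bilxx u : bil u u = 2 * quad u.
Proof. by rewrite quadE /bil mulr_sumr; apply: eq_bigr => i _; ring. Qed.

Definition sc (a : A) chi : spinor A := [ffun I => a * chi I].

Lemma scE a chi I : sc a chi I = a * chi I.
Proof. by rewrite ffunE. Qed.

Lemma spinorD chi chi' I : (chi + chi') I = chi I + chi' I.
Proof. by rewrite ffunE. Qed.

Lemma spinorN chi I : (- chi) I = - chi I.
Proof. by rewrite ffunE. Qed.

Lemma spinor0 I : (0 : spinor A) I = 0.
Proof. by rewrite ffunE. Qed.

Definition spinorE := (scE, spinorD, spinorN, spinor0).

Lemma cliffordDr w chi chi' :
  clifford w (chi + chi') = clifford w chi + clifford w chi'.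
Proof.
apply/ffunP=> I; rewrite [RHS]ffunE !cliffordE -big_split.
by apply: eq_bigr => i _; rewrite /= ffunE mulrDr.
Qed.

Lemma cliffordNr w chi : clifford w (- chi) = - clifford w chi.
Proof.
apply/ffunP=> I; rewrite [RHS]ffunE !cliffordE -sumrN.
by apply: eq_bigr => i _; rewrite ffunE mulrN.
Qed.

Lemma clifford0r w : clifford w 0 = 0.
Proof.
by apply/ffunP=> I; rewrite cliffordE ffunE big1 // => i _; rewrite ffunE mulr0.
Qed.

Lemma cliffordZr w a chi : clifford w (sc a chi) = sc a (clifford w chi).
Proof.
apply/ffunP=> I; rewrite [RHS]ffunE !cliffordE mulr_sumr.
by apply: eq_bigr => i _; rewrite ffunE; ring.
Qed.

Lemma cliffordDl u v chi : clifford (u + v) chi = clifford u chi + clifford v chi.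
Proof.
apply/ffunP=> I; rewrite [RHS]ffunE !cliffordE -big_split.
by apply: eq_bigr => i _; rewrite /= cfD; ring.
Qed.

Lemma cliffordZl a u chi : clifford (a *: u) chi = sc a (clifford u chi).
Proof.
apply/ffunP=> I; rewrite [RHS]ffunE !cliffordE mulr_sumr.
by apply: eq_bigr => i _; rewrite /= cfZ; ring.
Qed.

Lemma clifford_anticomm u v chi :
  clifford u (clifford v chi) + clifford v (clifford u chi) = sc (bil u v) chi.
Proof.
pose T u v (I : {set 'I_7}) (i j : 'I_7) := cf u i (i \in I) * sgn_below A i I *
  (cf v j (j \in tog i I) * sgn_below A j (tog i I) * chi (tog j (tog i I))).
have E u' v' I : clifford u' (clifford v' chi) I = \sum_i \sum_j T u' v' I i j.
  by rewrite cliffordE; apply: eq_bigr => i _; rewrite cliffordE mulr_sumr.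
apply/ffunP=> I; rewrite [LHS]ffunE [RHS]ffunE !E [X in _ + X]exchange_big -big_split mulr_suml.
apply: eq_bigr => i _; rewrite -big_split (bigD1 i) //= big1 ?addr0 => [|j ji].
  rewrite /T !in_tog eqxx togK !sgn_tog ltnn expr0 mul1r.
  transitivity ((cf u i (i \in I) * cf v i (~~ (i \in I)) +
    cf v i (i \in I) * cf u i (~~ (i \in I))) * (sgn_below A i I * sgn_below A i I) * chi I).
    by ring.
  by rewrite sgn_sq; case: (i \in I) => /=; ring.
rewrite /T !in_tog (togC j i) !sgn_tog (negbTE ji) eq_sym (negbTE ji) /=.
case: ltngtP => [ij|ij|/val_inj ij]; last by rewrite ij eqxx in ji.
all: rewrite expr0 expr1; ring.
Qed.

Lemma sc0 chi : sc 0 chi = 0.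
Proof. by apply/ffunP=> I; rewrite !ffunE mul0r. Qed.

Lemma sc1 chi : sc 1 chi = chi.
Proof. by apply/ffunP=> I; rewrite !ffunE mul1r. Qed.

Lemma clifford_swap u v chi : bil u v = 0 ->
  clifford u (clifford v chi) = - clifford v (clifford u chi).
Proof. by move=> uv; apply/eqP; rewrite -addr_eq0 clifford_anticomm uv sc0. Qed.

(** The anticommutator at [v := u] gives only twice this identity, and 2 may be a zero divisor in
    [A]; the off-diagonal terms are therefore cancelled in pairs directly. *)
Lemma clifford_sq u chi : clifford u (clifford u chi) = sc (quad u) chi.
Proof.
pose T (I : {set 'I_7}) (i j : 'I_7) := cf u i (i \in I) * sgn_below A i I *
  (cf u j (j \in tog i I) * sgn_below A j (tog i I) * chi (tog j (tog i I))).
have anti I i j : i != j -> T I i j = - T I j i.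
  move=> ij; rewrite /T !in_tog (togC j i) !sgn_tog (negbTE ij) eq_sym (negbTE ij) /=.
  case: ltngtP => [lt|lt|/val_inj eq]; last by rewrite eq eqxx in ij.
  1,2: rewrite expr0 expr1; ring.
apply/ffunP=> I; rewrite cliffordE [RHS]ffunE quadE mulr_suml.
transitivity (\sum_i \sum_j T I i j).
  by apply: eq_bigr => i _; rewrite cliffordE mulr_sumr.
transitivity (\sum_i T I i i + (\sum_(i < 7) \sum_(j < 7 | (j < i)%N) T I i j +
   \sum_(i < 7) \sum_(j < 7 | (i < j)%N) T I i j)).
  rewrite -!big_split; apply: eq_bigr => i _ /=; rewrite (bigD1 i) //=; congr (_ + _).
  rewrite (bigID (fun j : 'I_7 => (j < i)%N)) /=; congr (_ + _).
    by apply: eq_bigl => j; case: (ltngtP j i) => [||/val_inj ->]; rewrite ?andbF ?eqxx // -val_eqE /= => /ltn_eqF ->.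
  by apply: eq_bigl => j; case: (ltngtP i j) => [||/val_inj ->]; rewrite ?andbF ?eqxx // -val_eqE /= => /gtn_eqF ->.
rewrite (exchange_big_dep xpredT) //= -big_split [X in _ + X]big1 ?addr0 => [|i _].
  apply: eq_bigr => i _; rewrite /T in_tog eqxx togK sgn_tog ltnn expr0 mul1r.
  transitivity ((cf u i (i \in I) * cf u i (~~ (i \in I))) *
    (sgn_below A i I * sgn_below A i I) * chi I); first by ring.
  by rewrite sgn_sq; case: (i \in I) => /=; ring.
rewrite -big_split /= big1 // => j ij.
by rewrite (anti I i j) ?subrr ?addNr ?addrN // -val_eqE /= ltn_eqF.
Qed.

Lemma clifford_odd w chi : even_spinor chi -> odd_spinor (clifford w chi).
Proof.
move=> ev I oI; rewrite cliffordE big1 // => i _.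
by rewrite ev ?mulr0 // odd_tog.
Qed.

(** Polarization without division: the three conditions are read off at the two basis vectors and at
    their sum. *)
Lemma isotropic_rows (M : 'M[A]_(2, 7 + 7)) :
  (forall a : 'rV[A]_2, quad (a *m M) = 0) <->
  [/\ quad (row 0 M) = 0, quad (row 1 M) = 0 & bil (row 0 M) (row 1 M) = 0].
Proof.
have E (a : 'rV[A]_2) : a *m M = a 0 0 *: row 0 M + a 0 1 *: row 1 M.
  rewrite mulmx_sum_row !big_ord_recl big_ord0 addr0.
  by have -> : lift ord0 ord0 = 1 :> 'I_2 by apply/val_inj.
have Q (a : 'rV[A]_2) : quad (a *m M) = a 0 0 ^+ 2 * quad (row 0 M) +
    a 0 1 ^+ 2 * quad (row 1 M) + a 0 0 * a 0 1 * bil (row 0 M) (row 1 M).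
  by rewrite E quadD !quadZ bilZl bilZr; ring.
split=> [H|[H0 H1 H01] a]; last by rewrite Q H0 H1 H01; ring.
have H0 : quad (row 0 M) = 0 by rewrite -(H (\row_j (j == 0)%:R)) Q !mxE /=; ring.
have H1 : quad (row 1 M) = 0 by rewrite -(H (\row_j (j == 1)%:R)) Q !mxE /=; ring.
split=> //.
by rewrite -(H (const_mx 1)) Q !mxE H0 H1; ring.
Qed.

(** Exchanging E and F turns [bil] into the standard dot product, so that a matrix inverse supplies
    dual vectors. *)
Definition flip w : 'rV[A]_(7 + 7) := row_mx (rsubmx w) (lsubmx w).

Lemma bil_flip u v : bil u (flip v) = (u *m v^T) 0 0.
Proof.
rewrite /bil mxE big_split_ord /= -big_split; apply: eq_bigr => i _.
by rewrite /cf /flip row_mxKl row_mxKr !mxE.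
Qed.

(* With N a right inverse of M, the vectors u', v' dual to the rows u, v satisfy
   u . u' + u' . u = 1 and v . v' + v' . v = 1, which turns u . v . psi = 0 into a
   preimage of psi under U (x) Delta_- -> Delta_+. *)
Lemma section_vanishes_iff (M : 'M[A]_(2, 7 + 7)) psi : isotropic_frame M -> even_spinor psi ->
  spinor_section_vanishes psi M <->
  clifford (row 0 M) (clifford (row 1 M) psi) = 0.
Proof.
move=> [[N MN] /isotropic_rows [u0 v0 uv]] ev; split.
  move=> [chi [_ ->]]; rewrite !big_ord_recl big_ord0 addr0.
  have -> : lift ord0 ord0 = 1 :> 'I_2 by apply/val_inj.
  rewrite !cliffordDr clifford_sq v0 sc0 clifford0r addr0.
  by rewrite (clifford_swap _ (etrans (bilC _ _) uv)) cliffordNr clifford_sq u0 sc0 oppr0.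
set u := row 0 M; set v := row 1 M => uvpsi.
pose u' := flip (col 0 N)^T; pose v' := flip (col 1 N)^T.
have D i j : bil (row i M) (flip (col j N)^T) = (i == j)%:R.
  by rewrite bil_flip trmxK -row_mul colE mulmxA MN mul1mx !mxE andbT.
have uu' : bil u u' = 1 by rewrite D.
have vu' : bil v u' = 0 by rewrite D.
have vv' : bil v v' = 1 by rewrite D.
have uE : clifford u psi = clifford v (clifford v' (clifford u psi)).
  rewrite -[LHS]sc1 -vv' -clifford_anticomm.
  by rewrite (clifford_swap (u := v) (v := u)) 1?bilC // uvpsi oppr0 clifford0r addr0.
exists (fun k => if k == 0 then clifford u' psi
                 else - clifford u' (clifford v' (clifford u psi))); split.
  have ou : odd_spinor (clifford u' psi) by apply: clifford_odd.
  have ev' : even_spinor (clifford v' (clifford u psi)).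
    move=> I oI; rewrite cliffordE big1 // => i _.
    by rewrite clifford_odd ?mulr0 // odd_tog oI.
  move=> k; case: ifP => // _ I oI; rewrite ffunE clifford_odd // oppr0 //.
rewrite !big_ord_recl big_ord0 addr0 /=.
have -> : lift ord0 ord0 = 1 :> 'I_2 by apply/val_inj.
rewrite cliffordNr -(clifford_swap (u := u')) 1?bilC // -uE.
by rewrite clifford_anticomm uu' sc1.
Qed.

End Clifford.
#[global] Arguments cf : simpl never.

Section BasisVectors.
Variable A : comNzRingType.

Definition bv (i : 'I_7) (e : bool) : 'rV[A]_(7 + 7) :=
  row_mx (if e then delta_mx 0 i else 0) (if e then 0 else delta_mx 0 i).

Lemma cf_bv i e k b : cf (bv i e) k b = ((k == i) && (b == e))%:R.
Proof.
by rewrite /cf /bv row_mxKl row_mxKr; case: b; case: e; rewrite !mxE ?andbT ?andbF ?andbT.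
Qed.

Lemma clifford_bv i e (chi : spinor A) I :
  clifford (bv i e) chi I = if (i \in I) == e then sgn_below A i I * chi (tog i I) else 0.
Proof.
rewrite cliffordE (bigD1 i) //= big1 ?addr0 => [|k /negbTE ki].
  by rewrite cf_bv eqxx; case: eqP; rewrite ?mul1r ?mul0r.
by rewrite cf_bv ki !mul0r.
Qed.

Lemma bil_bv w i e : bil w (bv i e) = cf w i (~~ e).
Proof.
rewrite /bil (bigD1 i) //= big1 ?addr0 => [|k /negbTE ki].
  by rewrite !cf_bv eqxx; case: e; rewrite /= ?mulr0 ?mulr1 ?addr0 ?add0r.
by rewrite !cf_bv ki !mulr0 addr0.
Qed.

Lemma quad_bv i e : quad (bv i e) = 0.
Proof.
rewrite quadE big1 // => k _; rewrite !cf_bv.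
by case: e; rewrite ?andbF ?mulr0 ?mul0r.
Qed.

Lemma flipK (w : 'rV[A]_(7 + 7)) : flip (flip w) = w.
Proof. by rewrite /flip row_mxKl row_mxKr hsubmxK. Qed.

(* The nilpotent element a /\ b of the Lie algebra so(V). *)
Definition siegel (a b : 'rV[A]_(7 + 7)) : 'M[A]_(7 + 7) :=
  (flip b)^T *m a - (flip a)^T *m b.

Lemma mul_siegel w a b : w *m siegel a b = bil w b *: a - bil w a *: b.
Proof.
have E u v : w *m ((flip u)^T *m v) = bil w u *: v.
  by rewrite mulmxA [w *m _]mx11_scalar -bil_flip flipK mul_scalar_mx.
by rewrite mulmxBr !E.
Qed.

Lemma siegel_sq a b : quad a = 0 -> quad b = 0 -> bil a b = 0 ->
  siegel a b *m siegel a b = 0.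
Proof.
move=> qa qb ab; apply/row_matrixP => i; rewrite row_mul row0 mul_siegel.
rewrite [row i _]rowE mul_siegel.
rewrite !(bilDl, bilZl) -!scaleNr !bilZl (bilC b a) !bilxx qa qb ab.
by rewrite !mulr0 addr0 !scale0r oppr0 scale0r addr0.
Qed.

End BasisVectors.

(** * Equivalence of spinors over all algebras *)

Definition bc (K : fieldType) (A : comAlgType K) (psi : spinor K) : spinor A :=
  [ffun I => (psi I)%:A].

Lemma bcE (K : fieldType) (A : comAlgType K) (psi : spinor K) I :
  bc A psi I = (psi I)%:A.
Proof. by rewrite ffunE. Qed.

Section Equivalence.
Variable K : fieldType.
Implicit Types psi : spinor K.

(** Implied by lying in one orbit of Spin_14 and the scalars, and enough to transport both the
    closed points and the scheme structure: the change of frame [g] is defined over [K] and serves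
    all [A] at once. *)
Definition spin_equiv psi psi' : Prop :=
  exists g g' : 'M[K]_(7 + 7), g *m g' = 1%:M /\
    forall (A : comAlgType K) (M : 'M[A]_(2, 7 + 7)),
      zero_frame (bc A psi) M <->
      zero_frame (bc A psi') (M *m map_mx (in_alg A) g).

Lemma spin_equiv_refl psi : spin_equiv psi psi.
Proof.
by exists 1%:M, 1%:M; split=> [|A M]; rewrite ?mulmx1 // map_mx1 mulmx1.
Qed.

Lemma spin_equiv_trans psi2 psi1 psi3 :
  spin_equiv psi1 psi2 -> spin_equiv psi2 psi3 -> spin_equiv psi1 psi3.
Proof.
move=> [g [g' [gg' E]]] [h [h' [hh' F]]]; exists (g *m h), (h' *m g'); split.
  by rewrite mulmxA -(mulmxA g) hh' mulmx1.
by move=> A M; rewrite E F map_mxM mulmxA.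
Qed.

Lemma even_bc (A : comAlgType K) psi : even_spinor psi -> even_spinor (bc A psi).
Proof. by move=> ev I oI; rewrite ffunE ev // scale0r. Qed.

(** [G] intertwines the Clifford actions along the isometry [g] and vanishes only at 0, so u . v .
    psi = 0 is carried to the same equation for [psi'] and the image frame. *)
Lemma spin_equiv_of psi psi' (g g' : 'M[K]_(7 + 7))
    (G : forall A : comAlgType K, spinor A -> spinor A) :
  even_spinor psi -> even_spinor psi' -> g *m g' = 1%:M ->
  (forall (A : comAlgType K) w, quad (w *m map_mx (in_alg A) g) = quad w) ->
  (forall A w chi, G A (clifford w chi) = clifford (w *m map_mx (in_alg A) g) (G A chi)) ->
  (forall A chi, G A chi = 0 <-> chi = 0) ->
  (forall A, G A (bc A psi) = bc A psi') ->
  spin_equiv psi psi'.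
Proof.
move=> ev ev' gg' gq gG G0 Gpsi; exists g, g'; split=> // A M.
have g'g : g' *m g = 1%:M by apply: mulmx1C.
have iso : isotropic_frame M <-> isotropic_frame (M *m map_mx (in_alg A) g).
  split=> [[[N MN] Q]|[[N MN] Q]]; (split; last by move=> a; move: (Q a); rewrite mulmxA gq).
    exists (map_mx (in_alg A) g' *m N).
    by rewrite mulmxA -(mulmxA M) -map_mxM gg' map_mx1 mulmx1.
  by exists (map_mx (in_alg A) g *m N); rewrite mulmxA.
suff van : isotropic_frame M -> spinor_section_vanishes (bc A psi) M <->
    spinor_section_vanishes (bc A psi') (M *m map_mx (in_alg A) g).
  split=> [[h v]|[h' v]]; first by split; [apply/iso|apply/(van h)].
  by have h := iffRL iso h'; split=> //; apply/(van h).
move=> h; rewrite section_vanishes_iff //; last exact: even_bc.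
rewrite section_vanishes_iff //; [|exact/iso|exact: even_bc].
by rewrite !row_mul -Gpsi -!gG G0.
Qed.

Lemma scale_equiv psi (c : K) : even_spinor psi -> c != 0 -> spin_equiv psi (sc c psi).
Proof.
move=> ev c0; apply: (@spin_equiv_of _ _ 1%:M 1%:M (fun A => sc (c%:A))) => //.
- by move=> I oI; rewrite ffunE ev ?mulr0.
- by rewrite mulmx1.
- by move=> A w; rewrite map_mx1 mulmx1.
- by move=> A w chi; rewrite map_mx1 mulmx1 cliffordZr.
- move=> A chi; split=> [/ffunP E|->]; last by apply/ffunP=> I; rewrite !ffunE mulr0.
  apply/ffunP=> I; move: (E I); rewrite !ffunE => /(congr1 ( *:%R c^-1)).
  by rewrite scalerAl scalerA mulVf // scale1r mul1r scaler0.
- by move=> A; apply/ffunP=> I; rewrite !ffunE -scalerAl mul1r scalerA.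
Qed.

Section RootElement.
Variables (i j : 'I_7) (e e' : bool).
Hypothesis ij : i != j.

Definition root_act (A : comNzRingType) (chi : spinor A) : spinor A :=
  clifford (bv A i e) (clifford (bv A j e') chi).

Lemma root_actE (A : comNzRingType) (chi : spinor A) I :
  root_act chi I = if ((i \in I) == e) && ((j \in I) == e') then
    sgn_below A i I * sgn_below A j (tog i I) * chi (tog j (tog i I)) else 0.
Proof.
rewrite /root_act clifford_bv; case: eqP => //= _; rewrite clifford_bv in_tog.
rewrite [j == i]eq_sym (negbTE ij) /=; case: eqP; rewrite ?mulr0 // => _.
by rewrite mulrA.
Qed.

(* For t = n / d, the action of the element 1 + t a . b of the Spin group, a and b being basis
   vectors, multiplied by d to make it polynomial in n and d. *)
Definition root_elt (n d : K) psi : spinor K := sc d psi + sc n (root_act psi).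

Lemma even_root_elt n d psi : even_spinor psi -> even_spinor (root_elt n d psi).
Proof.
move=> ev I oI; rewrite !spinorE ev // root_actE ev ?mulr0 ?if_same ?mulr0 ?addr0 //.
by rewrite !odd_tog negbK.
Qed.

(** As [a] and [b] span an isotropic plane, [siegel a b] has square zero, and [1 + t *: siegel a b]
    is its exponential, the rotation covered by 1 + t a . b. *)
Lemma root_elt_equiv (n d : K) psi : d != 0 -> even_spinor psi ->
  spin_equiv psi (root_elt n d psi).
Proof.
move=> d0 ev; set t := n / d; have nE : n = t * d by rewrite /t divfK.
pose s A := siegel (bv A i e) (bv A j e').
have abil (A : comNzRingType) : bil (bv A i e) (bv A j e') = 0.
  by rewrite bil_bv cf_bv [j == i]eq_sym (negbTE ij).
have bvmap (A : comAlgType K) k b : map_mx (in_alg A) (bv K k b) = bv A k b.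
  by rewrite /bv map_row_mx; case: b; rewrite map_delta_mx map_mx0.
have smap (A : comAlgType K) : map_mx (in_alg A) (s K) = s A.
  have fl w : map_mx (in_alg A) (flip w) = flip (map_mx (in_alg A) w).
    by rewrite /flip map_row_mx map_lsubmx map_rsubmx.
  by rewrite /s /siegel map_mxB !map_mxM -!map_trmx !fl !bvmap.
have s2 : s K *m s K = 0 by apply: siegel_sq; rewrite ?quad_bv.
pose g (t : K) : 'M[K]_(7 + 7) := 1%:M + t *: s K.
have wg (A : comAlgType K) (w : 'rV[A]_(7 + 7)) : w *m map_mx (in_alg A) (g t) =
    w + t%:A *: (cf w j (~~ e') *: bv A i e - cf w i (~~ e) *: bv A j e').
  by rewrite /g map_mxD map_mx1 map_mxZ smap mulmxDr mulmx1 -scalemxAr mul_siegel !bil_bv.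
pose G (A : comAlgType K) (chi : spinor A) := sc (d%:A) (chi + sc (t%:A) (root_act chi)).
apply: (@spin_equiv_of _ _ (g t) (g (- t)) G) => //.
- exact: even_root_elt.
- rewrite /g mulmxDl mul1mx -scalemxAl mulmxDr mulmx1 -scalemxAr s2 !scaler0 addr0.
  by rewrite scaleNr addrNK.
- move=> A w; rewrite wg quadD quadZ quadD -!scaleNr !quadZ !quad_bv !(bilZr, bilZl, bilDr).
  by rewrite abil !bil_bv; ring.
- move=> A w chi; rewrite /G cliffordZr; congr sc; rewrite wg cliffordDl cliffordZl cliffordDr.
  set a := bv A i e; set b := bv A j e'; rewrite -/a -/b.
  have ca : cf w i (~~ e) = bil w a by rewrite bil_bv.
  have cb : cf w j (~~ e') = bil w b by rewrite bil_bv.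
  rewrite ca cb.
  set x := bil w a; set y := bil w b.
  have abn c : clifford a (clifford a c) = 0 by rewrite clifford_sq quad_bv sc0.
  have bbn c : clifford b (clifford b c) = 0 by rewrite clifford_sq quad_bv sc0.
  have abs c : clifford a (clifford b c) = - clifford b (clifford a c).
    by apply: clifford_swap; apply: abil.
  have wa c : clifford a (clifford w c) = sc x c - clifford w (clifford a c).
    by rewrite -clifford_anticomm addrAC subrr add0r.
  have wb c : clifford b (clifford w c) = sc y c - clifford w (clifford b c).
    by rewrite -clifford_anticomm addrAC subrr add0r.
  have E : root_act (clifford w chi) =
      sc y (clifford a chi) - sc x (clifford b chi) + clifford w (root_act chi).
    rewrite /root_act -/a -/b wb cliffordDr cliffordNr cliffordZr wa.
    by rewrite opprD opprK addrA.
  (* This is the term of second order in [t]; it vanishes because it contains [a] or [b] twice. *)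
  have Z : clifford (y *: a - x *: b) (root_act chi) = 0.
    rewrite /root_act -/a -/b -scaleNr cliffordDl !cliffordZl abn abs cliffordNr bbn.
    by apply/ffunP=> I; rewrite !spinorE; ring.
  rewrite E cliffordDr cliffordZr cliffordZr Z cliffordDl -[- (x *: b)]scaleNr !cliffordZl.
  by apply/ffunP=> I; rewrite !spinorE; ring.
- move=> A chi; split=> [/ffunP E|->]; last first.
    by apply/ffunP=> I; rewrite /G /root_act !clifford0r !spinorE; ring.
  have {}E : chi = - sc t%:A (root_act chi).
    apply/eqP; rewrite -addr_eq0; apply/eqP/ffunP=> I.
    move: (E I); rewrite [LHS]scE [RHS]spinor0 => /(congr1 ( *:%R d^-1)).
    by rewrite scalerAl scalerA mulVf // scale1r mul1r scaler0 spinor0.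
  (* Applying a . b once more to chi = - t a . b . chi then gives a . b . chi = 0. *)
  have R2 : root_act (root_act chi) = 0.
    rewrite /root_act (clifford_swap (u := bv A j e')) ?cliffordNr; last first.
      by rewrite bilC abil.
    by rewrite clifford_sq quad_bv sc0 oppr0.
  suff R0 : root_act chi = 0 by rewrite E R0; apply/ffunP=> I; rewrite !spinorE mulr0 oppr0.
  rewrite [in LHS]E /root_act !(cliffordNr, cliffordZr) -/(root_act _) R2.
  by apply/ffunP=> I; rewrite !spinorE mulr0 oppr0.
- move=> A; apply/ffunP=> I; rewrite /G /root_elt; move: t nE {wg G} => t nE; rewrite bcE !spinorE !root_actE !bcE.
  have sA J k : sgn_below A k J = (sgn_below K k J)%:A.
    by rewrite /sgn_below -in_algE rmorphXn rmorphN rmorph1.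
  have aM x y : (x * y)%:A = x%:A * y%:A :> A by rewrite -!in_algE rmorphM.
  have aD x y : (x + y)%:A = x%:A + y%:A :> A by rewrite scalerDl.
  by case: ifP => _; rewrite ?sA !(aM, aD) ?scale0r; [rewrite nE aM|]; ring.
Qed.

End RootElement.

(** The torus element of Spin scales by a square root of c or its inverse, according to [i \in I].
    Multiplied by that root it leaves Spin, but takes this form, which requires no root of c. *)
Lemma torus_equiv (i : 'I_7) (c : K) psi : c != 0 -> even_spinor psi ->
  spin_equiv psi [ffun I : {set 'I_7} => (if i \in I then c else 1) * psi I].
Proof.
move=> c0 ev.
pose m (c : K) : 'rV[K]_(7 + 7) :=
  row_mx (\row_k if k == i then c else 1) (\row_k if k == i then c^-1 else 1).
pose G (A : comAlgType K) (chi : spinor A) : spinor A :=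
  [ffun I : {set 'I_7} => (if i \in I then c%:A else 1) * chi I].
have cV (A : comAlgType K) : c%:A * c^-1%:A = 1 :> A.
  by rewrite -!in_algE -rmorphM divff // rmorph1.
have cfg (A : comAlgType K) (w : 'rV[A]_(7 + 7)) k b : cf (w *m map_mx (in_alg A) (diag_mx (m c))) k b =
    cf w k b * (if k == i then if b then c%:A else c^-1%:A else 1).
  rewrite map_diag_mx /cf; case: b; rewrite mxE mul_mx_diag mxE [in RHS]mxE mxE.
    by rewrite row_mxEl mxE; case: eqP => //; rewrite rmorph1.
  by rewrite row_mxEr mxE; case: eqP => //; rewrite rmorph1.
apply: (@spin_equiv_of _ _ (diag_mx (m c)) (diag_mx (m c^-1)) G) => //.
- by move=> I oI; rewrite ffunE ev ?mulr0.
- rewrite mulmx_diag; apply/matrixP => k l; rewrite !mxE; case: eqP => // _.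
  rewrite !mulr1n; case: splitP => k' _; rewrite !mxE; case: eqP => // _; rewrite ?mulr1 ?invrK ?divff ?mulVf //.
- move=> A w; rewrite !quadE; apply: eq_bigr => k _; rewrite !cfg; case: eqP => _; last by rewrite !mulr1.
  by rewrite mulrACA cV mulr1.
- move=> A w chi; apply/ffunP=> I; rewrite ffunE !cliffordE mulr_sumr.
  apply: eq_bigr => k _; rewrite cfg ffunE in_tog; have [->|ki] := eqVneq k i.
    case: (i \in I) => /=; first by ring.
    by transitivity (cf w i false * sgn_below A i I * chi (tog i I) * (c%:A * c^-1%:A)); [rewrite cV|]; ring.
  by rewrite addFb; case: (i \in I); ring.
- move=> A chi; split=> [/ffunP E|->]; last by apply/ffunP=> I; rewrite !ffunE mulr0.
  apply/ffunP=> I; move: (E I); rewrite !ffunE; case: ifP => _; last by rewrite mul1r.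
  move/(congr1 ( *%R (c^-1%:A))); rewrite mulr0 mulrA [X in X * _]mulrC cV mul1r //.
- by move=> A; apply/ffunP=> I; rewrite !ffunE -!in_algE rmorphM; case: ifP; rewrite ?rmorph1.
Qed.

End Equivalence.

(** * Elimination *)

(* Subsets of {0, .., 6} are also encoded as sequences of 7 booleans, on which the bookkeeping of the
   elimination is evaluated.  The indices are grouped into the pairs {2k, 2k+1} and the single
   index 6. *)
Definition mask := seq bool.

Definition mk (s : seq nat) : mask := mkseq (fun k => k \in s) 7.

Definition tgm (i : nat) (m : mask) : mask := mkseq (fun k => (k == i) (+) nth false m k) 7.

Definition setm (m : mask) : {set 'I_7} := [set k : 'I_7 | nth false m k].

Definition o (i : nat) : 'I_7 := inord i.

Definition msgn (i : nat) (m : mask) : bool :=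
  foldr (fun k b => nth false m k (+) b) false (iota 0 i).

Lemma in_setm m i : (i < 7)%N -> (o i \in setm m) = nth false m i.
Proof. by move=> i7; rewrite inE /o inordK. Qed.

Lemma tog_setm i m : (i < 7)%N -> tog (o i) (setm m) = setm (tgm i m).
Proof.
move=> i7; apply/setP=> k; rewrite in_tog !inE nth_mkseq //.
by rewrite -val_eqE /= inordK.
Qed.

Lemma setm_mkseq (I : {set 'I_7}) : setm (mkseq (fun k => o k \in I) 7) = I.
Proof. by apply/setP=> k; rewrite inE nth_mkseq // /o inord_val. Qed.

Lemma sgn_belowE (A : comNzRingType) (j : 'I_7) (J : {set 'I_7}) :
  sgn_below A j J = \prod_(k < 7) (-1) ^+ ((k \in J) && (k < j)%N).
Proof.
rewrite /sgn_below -sum1_card (big_morph _ (exprD (-1 : A)) (expr0 _)) big_mkcond.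
by apply: eq_bigr => k _; rewrite inE; case: (_ && _).
Qed.

Lemma sgn_setm (A : comNzRingType) i m : (i < 7)%N ->
  sgn_below A (o i) (setm m) = (-1) ^+ msgn i m.
Proof.
move=> i7; rewrite sgn_belowE.
under eq_bigr do rewrite inE /o inordK //.
rewrite !big_ord_recl big_ord0 mulr1 -!signr_addb; congr (_ ^+ nat_of_bool _).
rewrite /bump /=.
by do 7![case: i i7 => [_|i i7]; first by rewrite /msgn /= ?andbF ?andbT ?addbF].
Qed.

Lemma root_act_mask (A : comNzRingType) i j e e' (chi : spinor A) m :
  (i < 7)%N -> (j < 7)%N -> i != j ->
  root_act (o i) (o j) e e' chi (setm m) =
  if (nth false m i == e) && (nth false m j == e') then
    (-1) ^+ (msgn i m (+) msgn j (tgm i m)) * chi (setm (tgm j (tgm i m))) else 0.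
Proof.
move=> i7 j7 ij; rewrite root_actE; last by rewrite -val_eqE /= !inordK.
rewrite !in_setm //; case: ifP => // _.
by rewrite !tog_setm // !sgn_setm // signr_addb.
Qed.

(* A step kills the coordinate [starget], by a root element that adds to it a multiple of the
   coordinate [source], the pivot. *)
Record step := Step {si : nat; se : bool; sj : nat; se' : bool; starget : mask}.

Definition wf_step s := [&& (si s < 7)%N, (sj s < 7)%N, si s != sj s,
  nth false (starget s) (si s) == se s & nth false (starget s) (sj s) == se' s].

Definition source i j m := tgm j (tgm i m).

(* The coordinates of Z that still vanish after the root element e_i e_j. *)
Definition keep i (e : bool) j (e' : bool) (Z : seq mask) : seq mask :=
  [seq m <- Z | ((nth false m i == e) && (nth false m j == e')) ==> (source i j m \in Z)].

Definition zstep Z s := starget s :: keep (si s) (se s) (sj s) (se' s) Z.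

Section Steps.
Variable K : fieldType.
Implicit Types chi : spinor K.

Definition relt i e j e' (n d : K) chi := root_elt (o i) (o j) e e' n d chi.

Definition vanishes chi (Z : seq mask) := forall m, m \in Z -> chi (setm m) = 0.

Lemma relt_mask i e j e' n d chi m : (i < 7)%N -> (j < 7)%N -> i != j ->
  relt i e j e' n d chi (setm m) = d * chi (setm m) +
  if (nth false m i == e) && (nth false m j == e') then
    n * ((-1) ^+ (msgn i m (+) msgn j (tgm i m)) * chi (setm (source i j m))) else 0.
Proof.
move=> i7 j7 ij; rewrite /relt /root_elt !spinorE root_act_mask //.
by case: ifP; rewrite ?mulr0.
Qed.

Lemma keep_vanishes i e j e' n d chi Z : (i < 7)%N -> (j < 7)%N -> i != j ->
  vanishes chi Z -> vanishes (relt i e j e' n d chi) (keep i e j e' Z).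
Proof.
move=> i7 j7 ij v m; rewrite mem_filter => /andP[+ mZ].
rewrite relt_mask // (v m mZ) mulr0 add0r; case: ifP => //= _ sZ.
by rewrite (v _ sZ) !mulr0.
Qed.

Lemma o_neq i j : (i < 7)%N -> (j < 7)%N -> i != j -> o i != o j.
Proof. by move=> i7 j7; rewrite -val_eqE /= !inordK. Qed.

Lemma relt_equiv i e j e' (n d : K) chi : (i < 7)%N -> (j < 7)%N -> i != j ->
  d != 0 -> even_spinor chi ->
  spin_equiv chi (relt i e j e' n d chi) /\ even_spinor (relt i e j e' n d chi).
Proof.
move=> i7 j7 ij d0 ev; have oij := o_neq i7 j7 ij.
by split; [apply: root_elt_equiv|apply: even_root_elt].
Qed.

Definition pivot s chi := chi (setm (source (si s) (sj s) (starget s))).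

(** Cross-multiplication: the new coordinate at the target is the pivot times the old one minus the
    old one times the pivot. *)
Definition kill chi s :=
  relt (si s) (se s) (sj s) (se' s)
    (- ((-1) ^+ (msgn (si s) (starget s) (+) msgn (sj s) (tgm (si s) (starget s))) *
        chi (setm (starget s))))
    (pivot s chi) chi.

Definition run p chi := foldl kill chi p.

Fixpoint pivots (p : seq step) chi : K :=
  if p is s :: p' then pivot s chi * pivots p' (kill chi s) else 1.

Lemma run_equiv p chi : all wf_step p -> even_spinor chi -> pivots p chi != 0 ->
  spin_equiv chi (run p chi) /\ even_spinor (run p chi).
Proof.
elim: p chi => [|s p IH] chi /=; first by split=> //; apply: spin_equiv_refl.
move=> /andP[/and5P[i7 j7 ij _ _] wf] ev; rewrite mulf_eq0 negb_or => /andP[p0 ps].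
have [E ev'] := relt_equiv (se s) (se' s) (- ((-1) ^+ (msgn (si s) (starget s) (+)
   msgn (sj s) (tgm (si s) (starget s))) * chi (setm (starget s)))) i7 j7 ij p0 ev.
have [E' ev''] := IH _ wf ev' ps.
by split=> //; apply: spin_equiv_trans E E'.
Qed.

Lemma run_vanishes p chi Z : all wf_step p -> vanishes chi Z ->
  vanishes (run p chi) (foldl zstep Z p).
Proof.
elim: p chi Z => [|s p IH] chi Z //= /andP[/and5P[i7 j7 ij ei ej] wf] v; apply: IH => // m.
rewrite inE => /orP[/eqP ->|mZ]; last exact: (keep_vanishes _ _ i7 j7 ij v mZ).
rewrite /kill relt_mask // ei ej /= -/(pivot s chi).
set sg := (-1) ^+ _; have ss : sg * sg = 1 by rewrite -expr2 sqrr_sign.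
transitivity (pivot s chi * chi (setm (starget s)) * (1 - sg * sg)); first by ring.
by rewrite ss subrr mulr0.
Qed.

Fixpoint trivial_on (p : seq step) chi : Prop :=
  if p is s :: p' then [/\ chi (setm (starget s)) = 0, pivot s chi != 0 & trivial_on p' chi]
  else True.

Lemma kill_sc (c : K) chi s : kill (sc c chi) s = sc (c * c) (kill chi s).
Proof.
apply/ffunP=> I; rewrite /kill /relt /root_elt /pivot !spinorE /root_act.
by rewrite !cliffordZr !spinorE; ring.
Qed.

(** When every target already vanishes, [kill] only rescales. As it is quadratic in the spinor, the
    induction runs over all nonzero multiples of [chi]. *)
Lemma run_trivial p chi : trivial_on p chi ->
  pivots p chi != 0 /\ exists2 c, c != 0 & run p chi = sc c chi.
Proof.
suff H : forall c0, c0 != 0 -> trivial_on p chi ->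
    pivots p (sc c0 chi) != 0 /\ exists2 c, c != 0 & run p (sc c0 chi) = sc c chi.
  by move=> tr; have := H 1 (oner_neq0 _) tr; rewrite sc1.
elim: p => [|s p IH] c0 c00 /=; first by move=> _; split; [apply: oner_neq0|exists c0].
move=> [t0 p0 tr].
have -> : kill (sc c0 chi) s = sc (c0 * c0 * pivot s chi) chi.
  rewrite kill_sc; apply/ffunP=> I; rewrite /kill t0 /relt /root_elt !spinorE; ring.
have nz : c0 * c0 * pivot s chi != 0 by rewrite !mulf_neq0.
have [P [c cc E]] := IH _ nz tr.
by split; [rewrite mulf_neq0 // /pivot scE mulf_neq0|exists c].
Qed.

End Steps.

Section FunctionClass.
Variables (K : fieldType) (T : Type) (R : (T -> K) -> Prop).

(* Sets of functions closed under the operations of the elimination: the coordinates of the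
   reduced spinor stay in any such set containing those of the initial one. *)
Definition fun_class :=
  [/\ forall f g, R f -> f =1 g -> R g, forall c, R (fun=> c),
      forall f g, R f -> R g -> R (fun t => f t + g t)
    & forall f g, R f -> R g -> R (fun t => f t * g t)].

Hypothesis HR : fun_class.

Definition spinor_class (S : T -> spinor K) := forall I, R (fun t => S t I).

Lemma class_ext f g : R f -> f =1 g -> R g. Proof. by case: HR => + _ _ _; apply. Qed.
Lemma class_cst c : R (fun=> c). Proof. by case: HR. Qed.
Lemma classD f g : R f -> R g -> R (fun t => f t + g t).
Proof. by case: HR => _ _ + _; apply. Qed.
Lemma classM f g : R f -> R g -> R (fun t => f t * g t).
Proof. by case: HR => _ _ _; apply. Qed.
Lemma classN f : R f -> R (fun t => - f t).
Proof.
move=> Rf; apply: class_ext (classM (class_cst (-1)) Rf) _ => t.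
by rewrite mulN1r.
Qed.

Lemma relt_class i e j e' n d S : (i < 7)%N -> (j < 7)%N -> i != j ->
  R n -> R d -> spinor_class S ->
  spinor_class (fun t => relt i e j e' (n t) (d t) (S t)).
Proof.
move=> i7 j7 ij Rn Rd RS I.
pose m := mkseq (fun k => o k \in I) 7.
have mI : setm m = I by apply: setm_mkseq.
have dS := classM Rd (RS I).
have E n0 d0 chi : relt i e j e' n0 d0 chi I = d0 * chi I +
    if (nth false m i == e) && (nth false m j == e') then
    n0 * ((-1) ^+ (msgn i m (+) msgn j (tgm i m)) * chi (setm (source i j m))) else 0.
  by have := relt_mask e e' n0 d0 chi m i7 j7 ij; rewrite mI.
move: E; case: ((nth false m i == e) && (nth false m j == e')) => E; last by apply: class_ext dS _ => t; rewrite E addr0.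
have nS := classM Rn (classM (class_cst ((-1) ^+ (msgn i m (+) msgn j (tgm i m))))
  (RS (setm (source i j m)))).
by apply: class_ext (classD dS nS) _ => t; rewrite E.
Qed.

Lemma kill_class s S : wf_step s -> spinor_class S -> spinor_class (fun t => kill (S t) s).
Proof.
move=> /and5P[i7 j7 ij _ _] RS; apply: relt_class => //; last exact: RS.
by apply: classN; apply: classM; [apply: class_cst|apply: RS].
Qed.

Lemma run_class p S : all wf_step p -> spinor_class S ->
  spinor_class (fun t => run p (S t)) /\ R (fun t => pivots p (S t)).
Proof.
elim: p S => [|s p IH] S /=; first by split=> //; apply: class_cst.
move=> /andP[wf wfp] RS; have [H1 H2] := IH _ wfp (kill_class wf RS).
split; first exact: H1.
by apply: classM => //; apply: RS.
Qed.

End FunctionClass.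

Definition co a b := mk [seq k <- iota 0 6 | (k != a) && (k != b)].

(* The first program kills the coordinates of degree 2 in {0, .., 5}, with pivot the coordinate of degree 0, and
   the coordinates of degree 4 in {0, .., 5} that are not unions of two pairs. *)
Definition prog1 : seq step :=
  [seq Step a true b true (mk [:: a; b]) | a <- iota 0 6, b <- iota a.+1 (5 - a)] ++
  [seq Step 1 true k false (co 0 k) | k <- iota 2 4] ++
  [seq Step 0 true k false (co 1 k) | k <- iota 2 4] ++
  [seq Step 3 true k false (co 2 k) | k <- iota 4 2] ++
  [seq Step 2 true k false (co 3 k) | k <- iota 4 2].

(** For [i != j]: the index 6, both elements of pair [i], none of pair [j], and the odd element of
    the third pair. *)
Definition ym i j := mk [:: 6, i.*2 & [seq k.*2.+1 | k <- rem j (iota 0 3)]].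

(* The second program kills the coordinates containing 6, except those of 6 + (one element of each
   pair, of which 0, 2 or 3 are odd); its pivots are among these and the two coordinates without 6
   left by the first [cube_red]. *)
Definition prog3 : seq step :=
  [seq Step a true 6 true (mk [:: a; 6]) | a <- iota 0 6] ++
  [seq Step 6 true a false (mk (rem a (iota 0 7))) | a <- iota 0 6] ++
  [seq Step j.*2.+1 true i.*2 false (mk [:: 6, j.*2.+1 & [seq k.*2 | k <- rem i (iota 0 3)]])
    | i <- iota 0 3, j <- iota 0 3] ++
  [:: Step 2 true 0 false (ym 1 0); Step 4 true 0 false (ym 2 0);
      Step 1 true 3 false (ym 0 1); Step 1 true 5 false (ym 0 2);
      Step 4 true 2 false (ym 2 1); Step 3 true 5 false (ym 1 2)].

Definition all_masks : seq mask := [seq mk [seq k <- iota 0 7 | odd (n %/ 2 ^ k)] | n <- iota 0 128].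

Definition Z0 : seq mask := [seq m <- all_masks | odd (count id m)].

(* The eight coordinates obtained from base by toggling some of the pairs. *)
Definition cm (base : seq nat) (a b c : bool) : mask :=
  let t (k : nat) (x : bool) m := if x then tgm k.*2 (tgm k.*2.+1 m) else m in
  t 0 a (t 1 b (t 2 c (mk base))).

Definition base1 : seq nat := [::].
Definition base2 : seq nat := [:: 0; 2; 4; 6].

Definition keep_cube (e1 e2 : bool) Z :=
  foldl (fun Z k => keep k.*2 e1 k.*2.+1 e2 Z) Z (iota 0 3).

Definition cube_zeros base := [:: cm base true false false; cm base false true false;
  cm base false false true; cm base true true false; cm base true false true;
  cm base false true true].

(** [Z0] to [Z4] list coordinates known to vanish at the successive stages, from parity alone
    onwards. They do not depend on the spinor, so the claim that only [supp] remains is decided by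
    evaluation. *)
Definition Z1 := foldl zstep Z0 prog1.
Definition Z2 := cube_zeros base1 ++ keep_cube false false (keep_cube true true Z1).
Definition Z3 := foldl zstep Z2 prog3.
Definition up2 Z := foldl (fun Z k => keep k.*2.+1 true k.*2 false Z) Z (iota 0 3).
Definition down2 Z := foldl (fun Z k => keep k.*2 true k.*2.+1 false Z) Z (iota 0 3).
Definition Z4 := cube_zeros base2 ++ down2 (up2 Z3).
Definition supp := [:: cm base1 false false false; cm base1 true true true;
  cm base2 false false false; cm base2 true true true].

(* Under the three root elements toggling a pair, a spinor behaves like a 2 x 2 x 2 tensor (c on
   the empty set, y_k on two pairs, b on three pairs).  Such a tensor is brought to the form
   (c, b) by solving r^2 = c b r + c y_0 y_1 y_2, the up steps having parameters - r / (c y_k) and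
   the down steps - c y_k / (c b - 2 r). *)
Section Cube.
Variables (K : fieldType) (up dn : nat -> K -> K -> spinor K -> spinor K).
Variable base : seq nat.
Implicit Types chi : spinor K.

Definition cube chi (a b c : bool) : K := chi (setm (cm base a b c)).

Definition up_spec (k : nat) := forall n d chi a b c,
  cube (up k n d chi) a b c = d * cube chi a b c +
  if nth false [:: a; b; c] k then
    n * cube chi (a && (k != 0)%N) (b && (k != 1)%N) (c && (k != 2)%N) else 0.

Definition dn_spec (k : nat) := forall n d chi a b c,
  cube (dn k n d chi) a b c = d * cube chi a b c +
  if nth false [:: a; b; c] k then 0 else
    n * cube chi (a || (k == 0)%N) (b || (k == 1)%N) (c || (k == 2)%N).

Hypotheses (up0 : up_spec 0) (up1 : up_spec 1) (up2 : up_spec 2).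
Hypotheses (dn0 : dn_spec 0) (dn1 : dn_spec 1) (dn2 : dn_spec 2).

Definition cube_c chi := cube chi false false false.
Definition cube_b chi := cube chi true true true.
Definition cube_y chi k : K := cube chi (k != 0)%N (k != 1)%N (k != 2)%N.
Definition cube_u chi := cube_c chi * cube_b chi.
Definition cube_v chi := cube_c chi * (cube_y chi 0 * cube_y chi 1 * cube_y chi 2).

Definition cube_up (r : K) chi :=
  foldl (fun s k => up k (- r) (cube_c chi * cube_y chi k) s) chi (iota 0 3).

Definition cube_dn (D c : K) (y : nat -> K) chi :=
  foldl (fun s k => dn k (- (y k * c)) D s) chi (iota 0 3).

Definition cube_red (r : K) chi :=
  cube_dn (cube_u chi - 2 * r) (cube_c chi) (cube_y chi) (cube_up r chi).

Lemma cube_redP r chi :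
  cube chi true false false = 0 -> cube chi false true false = 0 ->
  cube chi false false true = 0 ->
  r ^+ 2 = cube_u chi * r + cube_v chi ->
  cube_c chi != 0 -> (forall k, (k < 3)%N -> cube_y chi k != 0) ->
  cube_u chi - 2 * r != 0 ->
  [/\ vanishes (cube_red r chi) (cube_zeros base), cube_c (cube_red r chi) != 0
    & cube_b (cube_red r chi) != 0].
Proof.
move=> z0 z1 z2 rE c0 y0 D0.
have y00 := y0 0 isT; have y10 := y0 1 isT; have y20 := y0 2 isT.
pose c := cube_c chi; pose b := cube_b chi; pose y k := cube_y chi k.
(* [r] and [u - r] are the two roots of the quadratic equation and their product is [- v], so
   neither vanishes. *)
have rn : r != 0.
  apply/eqP => r0; move: rE; rewrite r0 expr0n mulr0 add0r => /esym/eqP.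
  by rewrite !mulf_eq0 (negbTE c0) (negbTE y00) (negbTE y10) (negbTE y20).
have rn' : c * b - r != 0.
  apply/eqP => r0; move: rE; have -> : r = cube_u chi by apply/esym/eqP; rewrite -subr_eq0; apply/eqP.
  rewrite expr2 => /eqP; rewrite -[X in X == _]addr0 (inj_eq (addrI _)) eq_sym.
  by rewrite !mulf_eq0 (negbTE c0) (negbTE y00) (negbTE y10) (negbTE y20).
move: rE D0 {y0}.
have -> : cube_u chi = c * b by [].
have -> : cube_v chi = c * (y 0 * y 1 * y 2) by [].
move=> rE D0.
have res a1 a2 a3 : cube (cube_red r chi) a1 a2 a3 = 
  (c * y 0) * (c * y 1) * (c * y 2) * (c * b - 2 * r) ^+ 2 *
  (if ~~ (a1 || a2 || a3) then c * (c * b - r) else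
   if [&& a1, a2 & a3] then - r * (c * b - 2 * r) ^+ 3 / (c ^+ 2 * y 0 * y 1 * y 2) else 0).
  rewrite /cube_red /cube_dn /cube_up /=.
  (* Solving the quadratic relation for [b] leaves independent variables, so that [field] can decide
     the eight cases. *)
  have bE : b = (r ^+ 2 - c * (y 0 * y 1 * y 2)) / (c * r).
    by rewrite rE; field; rewrite rn c0.
  case: a1 a2 a3 => [] [] []; rewrite !(dn0, dn1, dn2, up0, up1, up2) /=  ?z0 ?z1 ?z2;
    rewrite /cube_u -/(cube_c chi) -/(cube_b chi) -/(cube_y chi 0) -/(cube_y chi 1) -/(cube_y chi 2) -/(c) -/(y 0) -/(y 1) -/(y 2) -/b bE;
    by field; rewrite ?rn ?c0 ?y00 ?y10 ?y20.
have P0 : (c * y 0) * (c * y 1) * (c * y 2) * (c * b - 2 * r) ^+ 2 != 0.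
  by rewrite !mulf_neq0 ?expf_neq0.
split; last first.
- by rewrite /cube_b res /= !mulf_neq0 ?expf_neq0 ?oppr_eq0 ?invr_eq0 ?mulf_neq0 ?expf_neq0.
- by rewrite /cube_c res /= !mulf_neq0.
move=> m; rewrite !inE => /orP[|/orP[|/orP[|/orP[|/orP[|]]]]] /eqP ->;
  by rewrite -/(cube _ _ _ _) res /= mulr0.
Qed.

End Cube.

Arguments cube_red {K} up dn base r chi.

Section CubeInstances.
Variable K : fieldType.
Implicit Types chi : spinor K.

Definition up_e k n d chi := @relt K k.*2 true k.*2.+1 true n d chi.
(** The sign of [n] undoes the sign produced by the two contractions, so that [dn_spec] holds as it
    does for [dn_o]. *)
Definition dn_e k n d chi := @relt K k.*2 false k.*2.+1 false (- n) d chi.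
Definition up_o k n d chi := @relt K k.*2.+1 true k.*2 false n d chi.
Definition dn_o k n d chi := @relt K k.*2 true k.*2.+1 false n d chi.

Lemma cube_e_spec k : (k < 3)%N -> up_spec up_e base1 k /\ dn_spec dn_e base1 k.
Proof.
by case: k => [|[|[|//]]] _; split=> n d chi [] [] []; rewrite /cube /up_e /dn_e relt_mask //= ?expr0 ?expr1 ?mulN1r ?mulrNN ?mul1r.
Qed.

Lemma cube_o_spec k : (k < 3)%N -> up_spec up_o base2 k /\ dn_spec dn_o base2 k.
Proof.
by case: k => [|[|[|//]]] _; split=> n d chi [] [] []; rewrite /cube /up_o /dn_o relt_mask //= ?expr0 ?expr1 ?mulN1r ?mulrNN ?mul1r.
Qed.

End CubeInstances.

Definition bits (I : {set 'I_7}) : mask := mkseq (fun k => o k \in I) 7.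

Definition indicator (A : comNzRingType) (s : seq mask) : spinor A :=
  [ffun I => (bits I \in s)%:R].

Lemma setm_bits I : setm (bits I) = I.
Proof. exact: setm_mkseq. Qed.

Lemma bits_setm m : size m = 7 -> bits (setm m) = m.
Proof.
move=> sm; apply: (@eq_from_nth _ false); rewrite size_mkseq // => i i7.
by rewrite nth_mkseq // in_setm.
Qed.

Lemma indicatorE (A : comNzRingType) s m : size m = 7 ->
  indicator A s (setm m) = (m \in s)%:R.
Proof. by move=> sm; rewrite ffunE bits_setm. Qed.

Lemma mem_all_masks m : size m = 7 -> m \in all_masks.
Proof.
have: all (fun m => m \in all_masks)
  [seq a :: m | a <- [:: true; false], m <- [seq a :: m | a <- [:: true; false], m <-
   [seq a :: m | a <- [:: true; false], m <- [seq a :: m | a <- [:: true; false], m <-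
   [seq a :: m | a <- [:: true; false], m <- [seq a :: m | a <- [:: true; false], m <-
   [:: [:: true]; [:: false]]]]]]]] by vm_compute.
move/allP; case: m => [|a [|b [|c [|d [|e [|f [|g [|? ?]]]]]]]] //= H _; apply: H.
by case: a b c d e f g => [] [] [] [] [] [] [].
Qed.

Section Reduction.
Variable K : fieldType.
Implicit Types chi psi : spinor K.

Definition nonvanishes chi (N : seq mask) := forall m, m \in N -> chi (setm m) != 0.

(** On these coordinates the root element acts only through the factor [d], so they stay nonzero. *)
Definition unmatched i (e : bool) j (e' : bool) (N : seq mask) : seq mask :=
  [seq m <- N | ~~ ((nth false m i == e) && (nth false m j == e'))].

Lemma unmatched_nonvanishes i e j e' n d chi N : (i < 7)%N -> (j < 7)%N -> i != j ->
  d != 0 -> nonvanishes chi N ->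
  nonvanishes (relt i e j e' n d chi) (unmatched i e j e' N).
Proof.
move=> i7 j7 ij d0 v m; rewrite mem_filter => /andP[/negbTE h mN].
by rewrite relt_mask // h addr0 mulf_neq0 // v.
Qed.

Lemma trivial_on_check p chi Z N : vanishes chi Z -> nonvanishes chi N ->
  all (fun s => (starget s \in Z) && (source (si s) (sj s) (starget s) \in N)) p ->
  trivial_on p chi.
Proof.
move=> v n; elim: p => //= s p IH /andP[/andP[sZ sN] /IH h].
by split=> //; [apply: v|apply: n].
Qed.

Variables (up dn : nat -> K -> K -> spinor K -> spinor K) (base : seq nat).

Lemma cube_red_ind (P : spinor K -> Prop) r chi :
  (forall k n d chi', (k < 3)%N -> d != 0 -> P chi' -> P (up k n d chi')) ->
  (forall k n d chi', (k < 3)%N -> d != 0 -> P chi' -> P (dn k n d chi')) ->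
  cube_c base chi != 0 -> (forall k, (k < 3)%N -> cube_y base chi k != 0) ->
  cube_u base chi - 2 * r != 0 -> P chi -> P (cube_red up dn base r chi).
Proof.
by move=> Pu Pd c0 y0 D0 Pc; do 3!apply: (Pd) => //; do 3!(apply: (Pu) => //; first by rewrite mulf_neq0 ?y0).
Qed.

End Reduction.

Section CubeClass.
Variables (K : fieldType) (T : Type) (R : (T -> K) -> Prop).
Variables (up dn : nat -> K -> K -> spinor K -> spinor K) (base : seq nat).
Hypothesis HR : fun_class R.

Definition op_class (op : nat -> K -> K -> spinor K -> spinor K) :=
  forall k n d S, (k < 3)%N -> R n -> R d -> spinor_class R S ->
  spinor_class R (fun t => op k (n t) (d t) (S t)).

Hypotheses (upc : op_class up) (dnc : op_class dn).

Lemma cube_u_class S : spinor_class R S -> R (fun t => cube_u base (S t)).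
Proof. by move=> RS; apply: (classM HR); apply: RS. Qed.

Lemma cube_v_class S : spinor_class R S -> R (fun t => cube_v base (S t)).
Proof. by move=> RS; apply: (classM HR); [|apply: (classM HR); [apply: (classM HR)|]]; apply: RS. Qed.

Lemma cube_red_class r S : R r -> spinor_class R S ->
  spinor_class R (fun t => cube_red up dn base (r t) (S t)).
Proof.
move=> Rr RS.
have Ry k : R (fun t => cube_y base (S t) k) by apply: RS.
have Rc : R (fun t => cube_c base (S t)) by apply: RS.
have RD : R (fun t => cube_u base (S t) - 2 * r t).
  apply: (classD HR (cube_u_class RS)); apply: (classN HR).
  exact: (classM HR (class_cst HR _)).
have Rn k : R (fun t => - (cube_y base (S t) k * cube_c base (S t))).
  by apply: (classN HR); apply: (classM HR).
do 3!apply: (dnc) => //.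
do 2!(apply: (upc) => //; [by apply: (classN HR)|by apply: (classM HR)|]).
by apply: (upc) => //; [apply: (classN HR)|apply: (classM HR)].
Qed.

End CubeClass.

Lemma op_class_e (K : fieldType) T (R : (T -> K) -> Prop) : fun_class R ->
  op_class R (@up_e K) /\ op_class R (@dn_e K).
Proof.
move=> HR; split=> -[|[|[|//]]] n d S _ Rn Rd RS; apply: relt_class => //.
all: exact: (classN HR).
Qed.

Section Generic.
Variable K : numClosedFieldType.
Implicit Types psi chi : spinor K.

Definition polyfun (f : spinor K -> K) : Prop :=
  exists P : {mpoly K[#|{: {set 'I_7}}|]}, forall psi, P.@[fun i => psi (enum_val i)] = f psi.

Lemma polyfun_class : fun_class polyfun.
Proof.
split.
- by move=> f g [P E] fg; exists P => psi; rewrite E.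
- by move=> c; exists c%:MP => psi; rewrite mevalC.
- by move=> f g [P E] [Q F]; exists (P + Q) => psi; rewrite mevalD E F.
- by move=> f g [P E] [Q F]; exists (P * Q) => psi; rewrite mevalM E F.
Qed.

Lemma polyfun_coord : spinor_class polyfun id.
Proof. by move=> I; exists 'X_(enum_rank I) => psi; rewrite mevalXU enum_rankK. Qed.

(* Functions on the double cover r^2 = u r + v of the space of spinors, on which the first
   [cube_red] is defined; they descend by taking norms. *)
Definition coverfun (u v : spinor K -> K) (f : spinor K * K -> K) : Prop :=
  exists c1 c2 : spinor K -> K, [/\ polyfun c1, polyfun c2 &
    forall psi r, r ^+ 2 = u psi * r + v psi -> f (psi, r) = c1 psi + c2 psi * r].

Lemma coverfun_class u v : polyfun u -> polyfun v -> fun_class (coverfun u v).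
Proof.
have C := polyfun_class; move=> Ru Rv; split.
- move=> f g [c1 [c2 [R1 R2 E]]] fg; exists c1, c2; split=> // psi r h.
  by rewrite -fg E.
- move=> c; exists (fun=> c), (fun=> 0).
  by split; rewrite ?mul0r ?addr0; try apply: (class_cst C); move=> psi r _; rewrite mul0r addr0.
- move=> f g [c1 [c2 [R1 R2 E]]] [d1 [d2 [S1 S2 F]]].
  exists (fun t => c1 t + d1 t), (fun t => c2 t + d2 t).
  by split; [apply: (classD C)|apply: (classD C)|move=> psi r h; rewrite E // F //; ring].
- move=> f g [c1 [c2 [R1 R2 E]]] [d1 [d2 [S1 S2 F]]].
  exists (fun t => c1 t * d1 t + c2 t * d2 t * v t),
    (fun t => (c1 t * d2 t + c2 t * d1 t) + c2 t * d2 t * u t).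
  split; [by do ![apply: (classD C)|apply: (classM C)] | by do ![apply: (classD C)|apply: (classM C)]|].
  move=> psi r h; rewrite E // F //.
  transitivity (c1 psi * d1 psi + (c1 psi * d2 psi + c2 psi * d1 psi) * r
    + c2 psi * d2 psi * r ^+ 2); first by ring.
  by rewrite h; ring.
Qed.

(** [u - r] is the conjugate root, so the product is the norm of the double cover, which no longer
    involves [r]. *)
Lemma coverfun_norm u v f : polyfun u -> polyfun v -> coverfun u v f ->
  exists2 N, polyfun N & forall psi r, r ^+ 2 = u psi * r + v psi ->
    N psi = f (psi, r) * f (psi, u psi - r).
Proof.
have C := polyfun_class; move=> Ru Rv [c1 [c2 [R1 R2 E]]].
exists (fun t => c1 t * c1 t + c1 t * c2 t * u t - c2 t * c2 t * v t).
  apply: (classD C); last by apply: (classN C); do !apply: (classM C).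
  by apply: (classD C); do !apply: (classM C).
move=> psi r h; rewrite E // E; last first.
  by transitivity (u psi ^+ 2 - 2 * u psi * r + r ^+ 2); [ring|rewrite h; ring].
have -> : v psi = r ^+ 2 - u psi * r by rewrite h; ring.
ring.
Qed.

(* In the coordinates of the elimination, psi0 is the normal form 1 + p_0 q_0 p_1 q_1 p_2 q_2
   + p_0 p_1 p_2 x + q_0 q_1 q_2 x, where p_k = e_2k, q_k = e_2k+1 and x = e_6. *)
Definition psi0 : spinor K := indicator K supp.

Lemma reduced_mask chi : vanishes chi Z4 -> forall I : {set 'I_7}, bits I \notin supp -> chi I = 0.
Proof.
move=> v I nI; rewrite -(setm_bits I); apply: v.
have: all (fun m => (m \in Z4) || (m \in supp)) all_masks by vm_compute.
move/allP/(_ (bits I)); rewrite mem_all_masks ?size_mkseq // => /(_ isT) /orP[//|].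
by rewrite (negbTE nI).
Qed.

Lemma normalize chi : even_spinor chi -> vanishes chi Z4 -> nonvanishes chi supp ->
  spin_equiv chi psi0.
Proof.
move=> ev v nv; set g := fun m => chi (setm m).
have nz m : m \in supp -> g m != 0 by apply: nv.
pose m1 := cm base1 false false false; pose m2 := cm base1 true true true.
pose m3 := cm base2 false false false; pose m4 := cm base2 true true true.
have g1 : g m1 != 0 by exact: nz. have g2 : g m2 != 0 by exact: nz.
have g3 : g m3 != 0 by exact: nz. have g4 : g m4 != 0 by exact: nz.
(* The four coefficients become 1 when c1 g1 = c1 c2 c3 g2 = c1 c2 x g3 = c1 c3 x g4 = 1;
   eliminating the c's leaves this equation for the square of x. *)
pose x := sqrtC (g m1 * g m2 / (g m3 * g m4)).
have x2 : x ^+ 2 = g m1 * g m2 / (g m3 * g m4) by rewrite sqrtCK.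
have x0 : x != 0 by rewrite sqrtC_eq0 !mulf_neq0 ?invr_eq0 ?mulf_neq0.
have [c1 c1E] : exists c, c = (g m1)^-1 by eexists.
have [c2 c2E] : exists c, c = g m1 / (g m3 * x) by eexists.
have [c3 c3E] : exists c, c = g m1 / (g m4 * x) by eexists.
have c10 : c1 != 0 by rewrite c1E invr_eq0.
have c20 : c2 != 0 by rewrite c2E mulf_neq0 ?invr_eq0 ?mulf_neq0.
have c30 : c3 != 0 by rewrite c3E mulf_neq0 ?invr_eq0 ?mulf_neq0.
pose tor i c (s : spinor K) : spinor K := [ffun I : {set 'I_7} => (if o i \in I then c else 1) * s I].
have evt i c s : even_spinor s -> even_spinor (tor i c s).
  by move=> es I oI; rewrite ffunE es ?mulr0.
have evs : even_spinor (sc c1 chi) by move=> I oI; rewrite scE ev ?mulr0.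
apply: spin_equiv_trans (scale_equiv ev c10) _.
apply: spin_equiv_trans (torus_equiv (o 0) c20 evs) _.
apply: spin_equiv_trans (torus_equiv (o 1) c30 (evt _ _ _ evs)) _.
apply: spin_equiv_trans (torus_equiv (o 6) x0 (evt _ _ _ (evt _ _ _ evs))) _.
set s := (X in spin_equiv X _); suff -> : s = psi0 by apply: spin_equiv_refl.
apply/ffunP => I; rewrite /s /psi0 [RHS]ffunE; have [|nI] := boolP (bits I \in supp); last first.
  by rewrite !ffunE (reduced_mask v nI) !mulr0.
rewrite -[in LHS](setm_bits I) !ffunE !in_setm //.
rewrite !inE => /orP[|/orP[|/orP[|]]] /eqP ->; rewrite -/(g _) /=.
- by rewrite c1E !mul1r mulVf.
- rewrite -/m2 c1E c2E c3E mul1r.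
  transitivity (g m1 * g m2 / (g m3 * g m4 * x ^+ 2)); first by field; rewrite g1 g3 g4 x0.
  by rewrite x2; field; rewrite g1 g2 g3 g4.
- by rewrite -/m3 c1E c2E; field; rewrite g1 g3 x0.
- by rewrite -/m4 c1E c3E; field; rewrite g1 g4 x0.
Qed.

End Generic.

Definition zero_unmatched N s := unmatched (si s) (se s) (sj s) (se' s) N.

Lemma mul_neq0 (K : fieldType) (a b : K) : a * b != 0 -> a != 0 /\ b != 0.
Proof. by rewrite mulf_eq0 negb_or => /andP. Qed.

Lemma run_nonvanishes (K : fieldType) p (chi : spinor K) N : all wf_step p ->
  pivots p chi != 0 -> nonvanishes chi N ->
  nonvanishes (run p chi) (foldl zero_unmatched N p).
Proof.
elim: p chi N => [|s p IH] chi N //= /andP[/and5P[i7 j7 ij _ _] wf].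
rewrite mulf_eq0 negb_or => /andP[p0 ps] nv; apply: IH => //.
exact: unmatched_nonvanishes.
Qed.

Lemma card_setm m : size m = 7 -> #|setm m| = count id m.
Proof.
rewrite -sum1_card big_mkcond /=; under eq_bigr do rewrite inE.
rewrite !big_ord_recl big_ord0 /bump /=.
by case: m => [|a [|b [|c [|d [|e [|f [|g [|? ?]]]]]]]] //= _; case: a; case: b; case: c; case: d; case: e; case: f; case: g.
Qed.

Lemma size_all_masks m : m \in all_masks -> size m = 7.
Proof.
by move=> mA; have/allP/(_ _ mA)/eqP : all (fun m => size m == 7) all_masks by vm_compute.
Qed.

Lemma even_Z0 (K : fieldType) (psi : spinor K) : even_spinor psi -> vanishes psi Z0.
Proof.
move=> ev m; rewrite mem_filter => /andP[om mA]; apply: ev.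
by rewrite card_setm ?size_all_masks.
Qed.

Section CubeDisc.
Variables (K : fieldType) (base : seq nat).
Implicit Types chi : spinor K.

(** For a 2 x 2 x 2 tensor whose three coordinates next to [c] vanish, [u ^+ 2 + 4 * v] is Cayley's
    hyperdeterminant. The factor [v] keeps [c] and the [y k] away from 0. *)
Definition cube_disc chi := cube_v base chi * (cube_u base chi ^+ 2 + 4 * cube_v base chi).

(** For either root, the square of [u - 2 * r] is the discriminant [u ^+ 2 + 4 * v]. *)
Lemma cube_disc_neq0 chi r : r ^+ 2 = cube_u base chi * r + cube_v base chi ->
  cube_disc chi != 0 ->
  [/\ cube_c base chi != 0, forall k, (k < 3)%N -> cube_y base chi k != 0
    & cube_u base chi - 2 * r != 0].
Proof.
move=> rE; rewrite /cube_disc mulf_eq0 negb_or => /andP[v0 d0].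
have D : cube_u base chi - 2 * r != 0.
  apply: contraNneq d0 => D0; have -> : cube_v base chi = r ^+ 2 - cube_u base chi * r by rewrite rE; ring.
  by apply/eqP; transitivity ((cube_u base chi - 2 * r) ^+ 2); [ring|rewrite D0 expr0n].
move: v0; rewrite /cube_v !mulf_eq0 !negb_or => /andP[c0 /andP[/andP[y0 y1] y2]].
by split=> // -[|[|[|//]]].
Qed.

End CubeDisc.

(** * Genericity of the normal form *)

Section Main.
Variable K : numClosedFieldType.
Implicit Types psi chi : spinor K.

Lemma quadratic_root (u v : K) : exists r, r ^+ 2 = u * r + v.
Proof.
exists ((u + sqrtC (u ^+ 2 + 4 * v)) / 2); set s := sqrtC _.
have s2 : s ^+ 2 = u ^+ 2 + 4 * v by rewrite sqrtCK.
have -> : v = (s ^+ 2 - u ^+ 2) / 4 by rewrite s2; field.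
by field.
Qed.

Definition st1 psi := run prog1 psi.
Definition st2 (t : spinor K * K) := cube_red (@up_e K) (@dn_e K) base1 t.2 (st1 t.1).
Definition st3 t := run prog3 (st2 t).
Definition cond1 psi := pivots prog1 psi * cube_disc base1 (st1 psi).
Definition cond2 t := pivots prog3 (st2 t) * cube_disc base2 (st3 t).
Definition uu psi := cube_u base1 (st1 psi).
Definition vv psi := cube_v base1 (st1 psi).

Lemma wf1 : all wf_step prog1. Proof. by vm_compute. Qed.
Lemma wf3 : all wf_step prog3. Proof. by vm_compute. Qed.

Lemma cube_e_red chi r : vanishes chi [:: cm base1 true false false; cm base1 false true false;
  cm base1 false false true] ->
  r ^+ 2 = cube_u base1 chi * r + cube_v base1 chi -> cube_disc base1 chi != 0 ->
  [/\ vanishes (cube_red (@up_e K) (@dn_e K) base1 r chi) (cube_zeros base1),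
      cube_c base1 (cube_red (@up_e K) (@dn_e K) base1 r chi) != 0
    & cube_b base1 (cube_red (@up_e K) (@dn_e K) base1 r chi) != 0].
Proof.
move=> v rE d0; have [c0 y0 D0] := cube_disc_neq0 rE d0.
have S k (k3 : (k < 3)%N) := cube_e_spec K k3.
apply: cube_redP => //; try by have [] := S _ (isT : (0 < 3)%N).
1,3: by have [] := S _ (isT : (1 < 3)%N).
1,2: by have [] := S _ (isT : (2 < 3)%N).
all: by apply: v; rewrite !inE eqxx ?orbT.
Qed.

Lemma cube_o_red chi r : vanishes chi [:: cm base2 true false false; cm base2 false true false;
  cm base2 false false true] ->
  r ^+ 2 = cube_u base2 chi * r + cube_v base2 chi -> cube_disc base2 chi != 0 ->
  [/\ vanishes (cube_red (@up_o K) (@dn_o K) base2 r chi) (cube_zeros base2),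
      cube_c base2 (cube_red (@up_o K) (@dn_o K) base2 r chi) != 0
    & cube_b base2 (cube_red (@up_o K) (@dn_o K) base2 r chi) != 0].
Proof.
move=> v rE d0; have [c0 y0 D0] := cube_disc_neq0 rE d0.
have S k (k3 : (k < 3)%N) := cube_o_spec K k3.
apply: cube_redP => //; try by have [] := S _ (isT : (0 < 3)%N).
1,3: by have [] := S _ (isT : (1 < 3)%N).
1,2: by have [] := S _ (isT : (2 < 3)%N).
all: by apply: v; rewrite !inE eqxx ?orbT.
Qed.

Lemma cube_e_keep chi r Z : vanishes chi Z ->
  vanishes (cube_red (@up_e K) (@dn_e K) base1 r chi)
    (keep_cube false false (keep_cube true true Z)).
Proof. by move=> v; do 6!apply: keep_vanishes => //. Qed.

Lemma cube_o_keep chi r Z : vanishes chi Z ->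
  vanishes (cube_red (@up_o K) (@dn_o K) base2 r chi) (down2 (up2 Z)).
Proof. by move=> v; do 6!apply: keep_vanishes => //. Qed.

Definition unmatched_e N := foldl (fun N k => unmatched k.*2 false k.*2.+1 false N)
  (foldl (fun N k => unmatched k.*2 true k.*2.+1 true N) N (iota 0 3)) (iota 0 3).
Definition unmatched_o N := foldl (fun N k => unmatched k.*2 true k.*2.+1 false N)
  (foldl (fun N k => unmatched k.*2.+1 true k.*2 false N) N (iota 0 3)) (iota 0 3).

Lemma cube_e_unmatched chi r N : r ^+ 2 = cube_u base1 chi * r + cube_v base1 chi ->
  cube_disc base1 chi != 0 -> nonvanishes chi N ->
  nonvanishes (cube_red (@up_e K) (@dn_e K) base1 r chi) (unmatched_e N).
Proof.
move=> rE d0 v; have [c0 y0 D0] := cube_disc_neq0 rE d0.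
by do 3!apply: unmatched_nonvanishes => //;
  do 3!(apply: unmatched_nonvanishes => //; first by rewrite mulf_neq0 ?y0).
Qed.

Lemma cube_o_unmatched chi r N : r ^+ 2 = cube_u base2 chi * r + cube_v base2 chi ->
  cube_disc base2 chi != 0 -> nonvanishes chi N ->
  nonvanishes (cube_red (@up_o K) (@dn_o K) base2 r chi) (unmatched_o N).
Proof.
move=> rE d0 v; have [c0 y0 D0] := cube_disc_neq0 rE d0.
by do 3!apply: unmatched_nonvanishes => //;
  do 3!(apply: unmatched_nonvanishes => //; first by rewrite mulf_neq0 ?y0).
Qed.

Lemma vanishes_cat chi Z Z' : vanishes chi Z -> vanishes chi Z' -> vanishes chi (Z ++ Z').
Proof. by move=> v v' m; rewrite mem_cat => /orP[/v|/v']. Qed.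

Lemma vanishes_sub chi Z Z' : vanishes chi Z -> all (fun m => m \in Z) Z' -> vanishes chi Z'.
Proof. by move=> v /allP s m /s /v. Qed.

Lemma nonvanishes_sub chi N N' : nonvanishes chi N -> all (fun m => m \in N) N' -> nonvanishes chi N'.
Proof. by move=> v /allP s m /s /v. Qed.

Definition equiv_even psi chi := spin_equiv psi chi /\ even_spinor chi.

Lemma relt_equiv_even i e j e' n d psi chi : (i < 7)%N -> (j < 7)%N -> i != j -> d != 0 ->
  equiv_even psi chi -> equiv_even psi (relt i e j e' n d chi).
Proof.
move=> i7 j7 ij d0 [E ev]; have [E' ev'] := relt_equiv e e' n i7 j7 ij d0 ev.
by split=> //; apply: spin_equiv_trans E E'.
Qed.

Lemma good_equiv psi r : even_spinor psi -> r ^+ 2 = uu psi * r + vv psi ->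
  cond1 psi != 0 -> cond2 (psi, r) != 0 -> spin_equiv psi (psi0 K).
Proof.
move=> ev rE /mul_neq0 [p1 d1] /mul_neq0 [p3 d3].
have [E1 ev1] := run_equiv wf1 ev p1.
have V1 : vanishes (st1 psi) Z1 := run_vanishes wf1 (even_Z0 ev).
have [c1 y1 D1] := cube_disc_neq0 rE d1.
have [E2 ev2] : equiv_even psi (st2 (psi, r)).
  by apply: cube_red_ind => // -[|[|[|//]]] n d chi' _ d0 EE; apply: relt_equiv_even.
have [m2 c2 b2] : [/\ vanishes (st2 (psi, r)) (cube_zeros base1),
   cube_c base1 (st2 (psi, r)) != 0 & cube_b base1 (st2 (psi, r)) != 0].
  have V1' : vanishes (st1 psi) [:: cm base1 true false false; cm base1 false true false;
      cm base1 false false true].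
    apply: vanishes_sub V1 _.
    vm_compute.
    by [].
  exact: (cube_e_red V1' rE d1).
have V2 : vanishes (st2 (psi, r)) Z2.
  exact: (vanishes_cat m2 (cube_e_keep r V1)).
have N2 : nonvanishes (st2 (psi, r)) [:: cm base1 false false false; cm base1 true true true].
  by move=> m; rewrite !inE => /orP[] /eqP ->; [exact: c2|exact: b2].
have [E3 ev3] := run_equiv wf3 ev2 p3.
have V3 : vanishes (st3 (psi, r)) Z3 := run_vanishes wf3 V2.
have N3 : nonvanishes (st3 (psi, r)) (foldl zero_unmatched
    [:: cm base1 false false false; cm base1 true true true] prog3).
  exact: (run_nonvanishes wf3 p3 N2).
(* This second root enters no later condition, so the open set needs no further cover. *)
have [s sE] := quadratic_root (cube_u base2 (st3 (psi, r))) (cube_v base2 (st3 (psi, r))).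
have [c3 y3 D3] := cube_disc_neq0 sE d3.
set st4 := cube_red (@up_o K) (@dn_o K) base2 s (st3 (psi, r)).
have [E4 ev4] : equiv_even psi st4.
  apply: (cube_red_ind _ _ c3 y3 D3 (conj (spin_equiv_trans E2 E3) ev3)).
    by move=> [|[|[|//]]] n d chi' _ d0 EE; apply: relt_equiv_even.
  by move=> [|[|[|//]]] n d chi' _ d0 EE; apply: relt_equiv_even.
have [m4 c4 b4] : [/\ vanishes st4 (cube_zeros base2), cube_c base2 st4 != 0 & cube_b base2 st4 != 0].
  apply: cube_o_red sE d3; apply: vanishes_sub V3 _.
  by vm_compute.
apply: spin_equiv_trans E4 _; apply: normalize ev4 (vanishes_cat m4 (cube_o_keep s V3)) _.
(* After the first cube reduction, the coordinates at the empty set and at {0, .., 5} are only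
   rescaled. *)
have N4 : nonvanishes st4 [:: cm base1 false false false; cm base1 true true true].
  apply: nonvanishes_sub (cube_o_unmatched sE d3 N3) _.
  by vm_compute.
move=> m; rewrite !inE => /orP[h|/orP[h|/orP[/eqP ->|/eqP ->]]]; [| |exact: c4|exact: b4];
  by apply: N4; rewrite !inE h ?orbT.
Qed.

(* A spinor on which no pivot of the elimination vanishes: both programs only rescale it, so that
   the nonvanishing condition is not identically false. *)
Definition supp1 : seq mask := [:: cm base1 false false false; cm base1 false true true;
  cm base1 true false true; cm base1 true true false; cm base2 false false false;
  cm base2 false true true; cm base2 true false true; cm base2 true true false].
Definition psi1 : spinor K := indicator K supp1.
Definition Zw := [seq m <- all_masks | m \notin supp1].

Lemma psi1_vanishes : vanishes psi1 Zw.
Proof.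
move=> m; rewrite mem_filter => /andP[/negbTE nm mA].
by rewrite /psi1 indicatorE ?nm // size_all_masks.
Qed.

Lemma psi1_nonvanishes : nonvanishes psi1 supp1.
Proof.
move=> m mS; rewrite /psi1 indicatorE ?mS ?oner_neq0 //; apply: size_all_masks.
by have/allP/(_ _ mS) : all (fun m => m \in all_masks) supp1 by vm_compute.
Qed.

Lemma cube_disc_sc base (c : K) chi : c != 0 -> cube_disc base chi != 0 -> cube_disc base (sc c chi) != 0.
Proof.
move=> c0 d0; suff -> : cube_disc base (sc c chi) = c ^+ 8 * cube_disc base chi.
  by rewrite mulf_neq0 ?expf_neq0.
by rewrite /cube_disc /cube_v /cube_u /cube_c /cube_b /cube_y /cube !scE; ring.
Qed.

Lemma cube_disc_special base chi : nonvanishes chi [:: cm base false false false;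
    cm base false true true; cm base true false true; cm base true true false] ->
  cube_b base chi = 0 -> cube_disc base chi != 0.
Proof.
move=> n b0; rewrite /cube_disc /cube_u b0 mulr0 expr0n add0r.
have v0 : cube_v base chi != 0.
  rewrite /cube_v; apply: mulf_neq0; [|apply: mulf_neq0; [apply: mulf_neq0|]];
  by rewrite /cube_y /cube_c /cube /=; apply: n; rewrite !inE eqxx ?orbT.
by apply: mulf_neq0 => //; apply: mulf_neq0 => //; rewrite pnatr_eq0.
Qed.

Lemma cond1_psi1 : cond1 psi1 != 0 /\ exists2 c, c != 0 & st1 psi1 = sc c psi1.
Proof.
have [p1 [c c0 E]] : pivots prog1 psi1 != 0 /\ exists2 c, c != 0 & run prog1 psi1 = sc c psi1.
  apply: run_trivial; apply: trivial_on_check psi1_vanishes psi1_nonvanishes _.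
  by vm_compute.
split; last by exists c.
apply: mulf_neq0 p1 _; rewrite /st1 E; apply: cube_disc_sc c0 _; apply: cube_disc_special.
  by apply: nonvanishes_sub psi1_nonvanishes _; vm_compute.
by apply: psi1_vanishes; vm_compute.
Qed.

(** Every root [r] is covered, because the norm is the product of the values at both roots. *)
Lemma cond2_psi1 r : r ^+ 2 = uu psi1 * r + vv psi1 -> cond2 (psi1, r) != 0.
Proof.
move=> rE; have [d1 [c c0 E]] := cond1_psi1.
have [_ {}d1] := mul_neq0 d1.
have V1 : vanishes (st1 psi1) Zw by move=> m mZ; rewrite E scE psi1_vanishes ?mulr0.
have N1 : nonvanishes (st1 psi1) supp1.
  by move=> m mZ; rewrite E scE mulf_neq0 // psi1_nonvanishes.
have [m2 c2 b2] : [/\ vanishes (st2 (psi1, r)) (cube_zeros base1),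
   cube_c base1 (st2 (psi1, r)) != 0 & cube_b base1 (st2 (psi1, r)) != 0].
  apply: cube_e_red rE d1; apply: vanishes_sub V1 _.
  by vm_compute.
have V2 : vanishes (st2 (psi1, r)) (cube_zeros base1 ++ keep_cube false false (keep_cube true true Zw)).
  exact: (vanishes_cat m2 (cube_e_keep r V1)).
have N2' : nonvanishes (st2 (psi1, r)) (unmatched_e supp1).
  exact: (cube_e_unmatched rE d1 N1).
have N2 : nonvanishes (st2 (psi1, r)) ([:: cm base1 false false false; cm base1 true true true] ++ unmatched_e supp1).
  move=> m; rewrite mem_cat => /orP[|/N2' //].
  by rewrite !inE => /orP[] /eqP ->; [exact: c2|exact: b2].
have [p3 [c3 c30 E3]] : pivots prog3 (st2 (psi1, r)) != 0 /\
    exists2 c, c != 0 & run prog3 (st2 (psi1, r)) = sc c (st2 (psi1, r)).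
  by apply: run_trivial; apply: trivial_on_check V2 N2 _; vm_compute.
apply: mulf_neq0 p3 _; rewrite /st3 E3; apply: cube_disc_sc c30 _; apply: cube_disc_special.
  apply: nonvanishes_sub N2 _.
  by vm_compute.
by apply: V2; vm_compute.
Qed.

Lemma psi1_even : even_spinor psi1.
Proof.
move=> I oI; rewrite -(setm_bits I); apply: psi1_vanishes.
rewrite mem_filter mem_all_masks ?size_mkseq // andbT; apply: contraL oI => bI.
rewrite -(setm_bits I) card_setm ?size_mkseq //.
by have/allP/(_ _ bI) : all (fun m => ~~ odd (count id m)) supp1 by vm_compute.
Qed.

(** The polynomial is [cond1] times the norm of [cond2]; where it is nonzero, either root can be
    used for the reduction. *)
Lemma generic_equiv : for_general_even_spinor (fun psi => spin_equiv psi (psi0 K)).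
Proof.
have C := polyfun_class K.
have [S1 P1] := run_class C wf1 (@polyfun_coord K).
have Ru : polyfun uu := cube_u_class base1 C S1.
have Rv : polyfun vv := cube_v_class base1 C S1.
have disc_class base T (R : (T -> K) -> Prop) (S : T -> spinor K) : fun_class R ->
    spinor_class R S -> R (fun t => cube_disc base (S t)).
  move=> CR RS; have Rw := cube_v_class base CR RS.
  have Rx := cube_u_class base CR RS.
  apply: (classM CR) => //; apply: (classD CR).
    by apply: (class_ext CR) (classM CR Rx Rx) _ => t; rewrite expr2.
  by apply: (classM CR) => //; apply: (class_cst CR).
have R1 : polyfun cond1 by apply: (classM C) => //; apply: disc_class.
have CC := coverfun_class Ru Rv.
have S1' : spinor_class (coverfun uu vv) (fun t => st1 t.1).
  move=> I; exists (fun psi => st1 psi I), (fun=> 0); split; [exact: S1|exact: (class_cst C)|].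
  by move=> psi r _; rewrite mul0r addr0.
have Rr : coverfun uu vv snd.
  exists (fun=> 0), (fun=> 1); split; [exact: (class_cst C)|exact: (class_cst C)|].
  by move=> psi r _; rewrite mul1r add0r.
have [ce de] := op_class_e CC.
have S2 : spinor_class (coverfun uu vv) st2 by apply: cube_red_class.
have [S3 P3] := run_class CC wf3 S2.
have R2 : coverfun uu vv cond2 by apply: (classM CC) => //; apply: disc_class.
have [N RN NE] := coverfun_norm Ru Rv R2.
have [P PE] := classM C R1 RN.
exists P; split.
  exists psi1; split; first exact: psi1_even.
  have [r rE] := quadratic_root (uu psi1) (vv psi1).
  rewrite PE (NE _ _ rE); have [c1 _] := cond1_psi1.
  apply: (mulf_neq0 c1); apply: mulf_neq0; apply: cond2_psi1; first exact: rE.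
  by transitivity (uu psi1 ^+ 2 - 2 * uu psi1 * r + r ^+ 2); [ring|rewrite rE; ring].
move=> psi ev; rewrite PE; have [r rE] := quadratic_root (uu psi) (vv psi).
rewrite (NE _ _ rE) => /mul_neq0[c1 /mul_neq0[c2 _]].
exact: good_equiv rE c1 c2.
Qed.

End Main.

(** * Zero locus of the normal form *)

Definition term : Type := (nat * bool * (nat * bool) * bool)%type.

(** Symbolic expansion of one coordinate of u . v . psi, for psi the sum of the basis spinors in
    [s]. Evaluated beforehand, it leaves [ring] a short polynomial. *)
Definition terms (s : seq mask) (m : mask) : seq term :=
  [seq ((i, nth false m i), (j, nth false (tgm i m) j), msgn i m (+) msgn j (tgm i m))
    | i <- iota 0 7, j <- [seq j <- iota 0 7 | tgm j (tgm i m) \in s]].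

Section Eval.
Variable A : comNzRingType.

Definition eval_term (U V : nat -> bool -> A) (t : term) : A :=
  let: ((i, b), (j, b'), s) := t in
  if s then - (U i b * V j b') else U i b * V j b'.

Definition eval_terms U V (l : seq term) : A := foldr (fun t a => eval_term U V t + a) 0 l.

Lemma eval_termsE U V l : eval_terms U V l = \sum_(t <- l) eval_term U V t.
Proof. by elim: l => [|t l IH]; rewrite ?big_nil ?big_cons //= IH. Qed.

Lemma sum_ord7 (F : 'I_7 -> A) : \sum_i F i = \sum_(i <- iota 0 7) F (o i).
Proof.
transitivity (\sum_(0 <= i < 7) F (o i)); last by [].
by rewrite big_mkord; apply: eq_bigr => i _; rewrite /o inord_val.
Qed.

Lemma clifford_mask (w : 'rV[A]_(7 + 7)) chi m :
  clifford w chi (setm m) = \sum_(i <- iota 0 7)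
    cf w (o i) (nth false m i) * (-1) ^+ msgn i m * chi (setm (tgm i m)).
Proof.
rewrite cliffordE sum_ord7; apply: eq_big_seq => i; rewrite mem_iota => /andP[_ i7].
by rewrite in_setm // sgn_setm // tog_setm.
Qed.

Lemma clifford2_mask (u v : 'rV[A]_(7 + 7)) s m :
  clifford u (clifford v (indicator A s)) (setm m) =
  eval_terms (fun i b => cf u (o i) b) (fun i b => cf v (o i) b) (terms s m).
Proof.
rewrite clifford_mask eval_termsE big_allpairs_dep.
apply: eq_bigr => i _; rewrite clifford_mask big_filter mulr_sumr [RHS]big_mkcond.
apply: eq_bigr => j _; rewrite indicatorE ?size_mkseq //; case: ifP => _; last by rewrite !mulr0.
by rewrite mulr1 /eval_term; case: (msgn i m); case: (msgn j _); rewrite ?expr0 ?expr1; ring.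
Qed.

End Eval.


(* The relations cutting out G_2 in so_7, for the Plucker coordinates of the pair (x, y): the
   cross product of x and y, as imaginary octonions, vanishes. *)
Definition lin7 (A : comNzRingType) (x y : nat -> A) : Prop :=
  let p i j := x i * y j - x j * y i in
  [/\ [/\ p 1%N 2%N = p 0%N 6%N, p 2%N 3%N = p 0%N 4%N & p 3%N 1%N = p 0%N 5%N],
      [/\ p 4%N 5%N = - p 0%N 3%N, p 5%N 6%N = - p 0%N 1%N & p 6%N 4%N = - p 0%N 2%N]
    & p 1%N 4%N + p 2%N 5%N + p 3%N 6%N = 0].

(* The coordinates of a vector of V from its components x and x' in the two 7-dimensional summands
   of V attached to psi0. *)
Definition Uc (A : comNzRingType) (x x' : nat -> A) (i : nat) (b : bool) : A :=
  if i == 6 then (if b then x 0%N + x' 0%N else x 0%N - x' 0%N)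
  else if odd i then x' (i./2 + if b then 1 else 4)%N
  else if b then x (i./2 + 1)%N else - x (i./2 + 4)%N.

(** For [i > 0]: the index of V, and the side (true for E), where [Uc] puts the component [x i];
    that of [x' i] has the next index. *)
Definition pbit (i : nat) : nat * bool := if (i < 4)%N then ((i - 1).*2, true) else ((i - 4).*2, false).

(** A coordinate of u . v . psi0 fed by the basis vectors of [x i] and [x' j] together; up to sign,
    its vanishing is the mixed relation for [i] and [j]. *)
Definition mixmask (i j : nat) : mask :=
  let (k, b) := pbit i in let (l, b') := pbit j in
  head [::] [seq m <- [seq tgm k (tgm l.+1 s) | s <- supp] | (nth false m k == b) && (nth false m l.+1 == b')].

Fact lc_add (A : comNzRingType) (a b : A) : a = 0 -> b = 0 -> a + b = 0.
Proof. by move=> -> ->; rewrite addr0. Qed.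

Fact lc_opp (A : comNzRingType) (a : A) : a = 0 -> - a = 0.
Proof. by move=> ->; rewrite oppr0. Qed.

Ltac by_comb e := by apply: (etrans _ e); ring.

Ltac lc1 a := first [by_comb a | by_comb (lc_opp a)].

Ltac lc2 a b := first [by_comb (lc_add a b) | by_comb (lc_add a (lc_opp b))
  | by_comb (lc_add (lc_opp a) b) | by_comb (lc_add (lc_opp a) (lc_opp b))].

Ltac to0 := apply/eqP; rewrite -subr_eq0; apply/eqP.

Section Local.
Variable A : comNzRingType.
Variables x x' y y' : nat -> A.
Hypothesis two : forall a : A, 2 * a = 0 -> a = 0.

Definition ev m := eval_terms (Uc x x') (Uc y y') (terms supp m).

Hypothesis H : forall m, size m = 7 -> ev m = 0.

Ltac evm m h :=
  let L := eval vm_compute in (terms supp m) in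
  have h : eval_terms (Uc x x') (Uc y y') L = 0 by
    [rewrite (_ : L = terms supp m); [apply: (H (m := m)); vm_compute|by vm_compute]];
  rewrite /eval_terms /eval_term /Uc /= ?add0n ?addn0 in h.

Lemma mixed_local i j : (0 < i < 7)%N -> (0 < j < 7)%N -> x i * y' j = y i * x' j.
Proof.
move=> /andP[i0 i7] /andP[j0 j7]; to0.
case: i i0 i7 => [//|[|[|[|[|[|[|//]]]]]]] _ _; case: j j0 j7 => [//|[|[|[|[|[|[|//]]]]]]] _ _.
all: let go i j := (evm (mixmask i j) h; lc1 h) in match goal with |- x ?i * y' ?j - _ = _ => go i j end.
Qed.


Ltac torsion a b := to0; apply: two; lc2 a b.

(** The components of index 0 occur only as [x 0 + x' 0] and [x 0 - x' 0], so two coordinates have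
    to be combined and a factor 2 cancelled. *)
Lemma mixed_local0 i : (0 < i < 7)%N -> x i * y' 0%N = y i * x' 0%N /\ x 0%N * y' i = y 0%N * x' i.
Proof.
move=> /andP[i0 i7]; case: i i0 i7 => [//|[|[|[|[|[|[|//]]]]]]] _ _; split.
- evm (mk [:: 0; 6]) a; evm (mk [:: 0; 1; 3; 5]) b; torsion a b.
- evm (mk [:: 1; 6]) a; evm (mk [:: 1; 0; 2; 4]) b; torsion a b.
- evm (mk [:: 2; 6]) a; evm (mk [:: 2; 1; 3; 5]) b; torsion a b.
- evm (mk [:: 3; 6]) a; evm (mk [:: 3; 0; 2; 4]) b; torsion a b.
- evm (mk [:: 4; 6]) a; evm (mk [:: 4; 1; 3; 5]) b; torsion a b.
- evm (mk [:: 5; 6]) a; evm (mk [:: 5; 0; 2; 4]) b; torsion a b.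
- evm (mk [:: 2; 4]) a; evm (mk [:: 1; 2; 3; 4; 5; 6]) b; torsion a b.
- evm (mk [:: 3; 5]) a; evm (mk [:: 0; 2; 3; 4; 5; 6]) b; torsion a b.
- evm (mk [:: 0; 4]) a; evm (mk [:: 0; 1; 3; 4; 5; 6]) b; torsion a b.
- evm (mk [:: 1; 5]) a; evm (mk [:: 0; 1; 2; 4; 5; 6]) b; torsion a b.
- evm (mk [:: 0; 2]) a; evm (mk [:: 0; 1; 2; 3; 5; 6]) b; torsion a b.
- evm (mk [:: 1; 3]) a; evm (mk [:: 0; 1; 2; 3; 4; 6]) b; torsion a b.
Qed.

(** A signed sum of four coordinates is 4 times the relation. *)
Lemma mixed_local00 : x 0%N * y' 0%N = y 0%N * x' 0%N.
Proof.
evm (mk [::]) a; evm (mk [:: 0; 1; 2; 3; 4; 5]) b.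
evm (mk [:: 0; 2; 4; 6]) c; evm (mk [:: 1; 3; 5; 6]) d.
to0; apply: two; apply: two.
by_comb (lc_opp (lc_add (lc_add c d) (lc_opp (lc_add a b)))).
Qed.

(** In the six binomial relations, the coordinate equation also contains a mixed product with
    [x' 0], which the previous lemma removes. The last relation comes from the four coordinates used
    in [mixed_local00], with other signs. *)
Lemma lin7_local : lin7 x y.
Proof.
have m0 i : (0 < i < 7)%N -> x i * y' 0%N - y i * x' 0%N = 0.
  by move=> /mixed_local0 [-> _]; rewrite subrr.
split; [split|split|].
- evm (mk [:: 0; 2]) a; have b := m0 6 isT; to0; lc2 a b.
- evm (mk [:: 2; 4]) a; have b := m0 4 isT; to0; lc2 a b.
- evm (mk [:: 0; 4]) a; have b := m0 5 isT; to0; lc2 a b.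
- evm (mk [:: 4; 6]) a; have b := m0 3 isT; to0; lc2 a b.
- evm (mk [:: 0; 6]) a; have b := m0 1%N isT; to0; lc2 a b.
- evm (mk [:: 2; 6]) a; have b := m0 2 isT; to0; lc2 a b.
evm (mk [::]) a; evm (mk [:: 0; 1; 2; 3; 4; 5]) b.
evm (mk [:: 0; 2; 4; 6]) c; evm (mk [:: 1; 3; 5; 6]) d.
apply: two.
by_comb (lc_add (lc_add a (lc_opp b)) (lc_add d (lc_opp c))).
Qed.

Lemma lin7_local' : lin7 x' y'.
Proof.
have m0 i : (0 < i < 7)%N -> x 0%N * y' i - y 0%N * x' i = 0.
  by move=> /mixed_local0 [_ ->]; rewrite subrr.
split; [split|split|].
- evm (mk [:: 1; 3]) a; have b := m0 6 isT; to0; lc2 a b.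
- evm (mk [:: 3; 5]) a; have b := m0 4 isT; to0; lc2 a b.
- evm (mk [:: 1; 5]) a; have b := m0 5 isT; to0; lc2 a b.
- evm (mk [:: 5; 6]) a; have b := m0 3 isT; to0; lc2 a b.
- evm (mk [:: 1; 6]) a; have b := m0 1%N isT; to0; lc2 a b.
- evm (mk [:: 3; 6]) a; have b := m0 2 isT; to0; lc2 a b.
evm (mk [::]) a; evm (mk [:: 0; 1; 2; 3; 4; 5]) b.
evm (mk [:: 0; 2; 4; 6]) c; evm (mk [:: 1; 3; 5; 6]) d.
apply: two.
by_comb (lc_opp (lc_add (lc_add a (lc_opp b)) (lc_add c (lc_opp d)))).
Qed.

End Local.

Section LocalConverse.
Variable A : comNzRingType.
Variables x y : nat -> A.
Hypothesis two : forall a : A, 2 * a = 0 -> a = 0.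
Hypothesis lin : lin7 x y.
Hypothesis bil0 : x 1%N * y 4%N + x 4%N * y 1%N + (x 2%N * y 5%N + x 5%N * y 2%N) +
  (x 3%N * y 6%N + x 6%N * y 3%N) - 2 * (x 0%N * y 0%N) = 0.

Ltac evconv l1 l2 l3 l4 l5 l6 l7 :=
  match goal with |- ev _ _ _ _ ?m = 0 =>
    rewrite /ev; let L := eval vm_compute in (terms supp m) in
    rewrite (_ : terms supp m = L); [|by vm_compute] end;
  rewrite /eval_terms /eval_term /Uc /= ?add0n ?addn0;
  first [by ring | lc1 l1 | lc1 l2 | lc1 l3 | lc1 l4 | lc1 l5 | lc1 l6 |
         apply: two; lc2 l7 bil0].

(** Each coordinate is identically zero, or a relation of [lin7] up to sign, or half a signed sum of
    the last relation and isotropy. *)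
Lemma local_conv m : size m = 7 -> ev x (fun=> 0) y (fun=> 0) m = 0.
Proof.
have [[l1 l2 l3] [l4 l5 l6] l7] := lin.
move/eqP: l1 l2 l3 l4 l5 l6; rewrite -subr_eq0 => /eqP l1 /eqP; rewrite -subr_eq0 => /eqP l2 /eqP.
rewrite -subr_eq0 => /eqP l3 /eqP; rewrite -subr_eq0 => /eqP l4 /eqP.
rewrite -subr_eq0 => /eqP l5 /eqP; rewrite -subr_eq0 => /eqP l6.
case: m => [|[] [|[] [|[] [|[] [|[] [|[] [|[] [|? ?]]]]]]]] //= _.
all: evconv l1 l2 l3 l4 l5 l6 l7.
Qed.

Lemma local_conv' m : size m = 7 -> ev (fun=> 0) x (fun=> 0) y m = 0.
Proof.
have [[l1 l2 l3] [l4 l5 l6] l7] := lin.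
move/eqP: l1 l2 l3 l4 l5 l6; rewrite -subr_eq0 => /eqP l1 /eqP; rewrite -subr_eq0 => /eqP l2 /eqP.
rewrite -subr_eq0 => /eqP l3 /eqP; rewrite -subr_eq0 => /eqP l4 /eqP.
rewrite -subr_eq0 => /eqP l5 /eqP; rewrite -subr_eq0 => /eqP l6.
case: m => [|[] [|[] [|[] [|[] [|[] [|[] [|[] [|? ?]]]]]]]] //= _.
all: evconv l1 l2 l3 l4 l5 l6 l7.
Qed.

End LocalConverse.

(** * Special pairs and the splitting of V *)

Section PairDefs.
Variable A : comNzRingType.

Definition rowc m (X : 'M[A]_(m, 7)) (i : 'I_m) (k : nat) : A := X i (o k).

Definition N7 (x : nat -> A) : A :=
  x 1%N * x 4%N + x 2%N * x 5%N + x 3%N * x 6%N - x 0%N ^+ 2.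

Definition B7 (x y : nat -> A) : A :=
  x 1%N * y 4%N + x 4%N * y 1%N + (x 2%N * y 5%N + x 5%N * y 2%N) +
  (x 3%N * y 6%N + x 6%N * y 3%N) - 2 * (x 0%N * y 0%N).

(* Special pairs span the null planes parametrized by the adjoint variety G_2 / P_2. *)
Definition special (X : 'M[A]_(2, 7)) : Prop :=
  let x := rowc X 0 in let y := rowc X 1 in
  [/\ lin7 x y, N7 x = 0, N7 y = 0 & B7 x y = 0].

(* The components in the two summands of a frame on which psi0 vanishes. *)
Definition split_pair (X X' : 'M[A]_(2, 7)) : Prop :=
  [/\ lin7 (rowc X 0) (rowc X 1), lin7 (rowc X' 0) (rowc X' 1),
      forall i j, X 0 i * X' 1 j = X 1 i * X' 0 j &
      [/\ N7 (rowc X 0) = N7 (rowc X' 0), N7 (rowc X 1) = N7 (rowc X' 1)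
        & B7 (rowc X 0) (rowc X 1) = B7 (rowc X' 0) (rowc X' 1)]].

End PairDefs.

(** [D1], [D2] are the inclusions of the two 7-dimensional summands and [E1], [E2] the projections,
    acting on rows. The third clause concerns planes inside one summand, whereas the second cannot
    conclude that a component vanishes: over a product of rings both may be nonzero. *)
Definition decomposes (K : fieldType) (psi : spinor K)
    (D1 D2 : 'M[K]_(7, 7 + 7)) (E1 E2 : 'M[K]_(7 + 7, 7)) : Prop :=
  [/\ [/\ D1 *m E1 = 1%:M, D2 *m E2 = 1%:M, D1 *m E2 = 0 & D2 *m E1 = 0],
      forall (A : comAlgType K) (M : 'M[A]_(2, 7 + 7)), zero_frame (bc A psi) M ->
        (exists N : 'M[A]_(7 + 7, 2), M *m N = 1%:M) /\
        split_pair (M *m map_mx (in_alg A) E1) (M *m map_mx (in_alg A) E2)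
    & forall (A : comAlgType K) (X : 'M[A]_(2, 7)), special X ->
        (exists N : 'M[A]_(7, 2), X *m N = 1%:M) ->
        zero_frame (bc A psi) (X *m map_mx (in_alg A) D1) /\
        zero_frame (bc A psi) (X *m map_mx (in_alg A) D2)].

Lemma decomposes_equiv (K : fieldType) (psi psi' : spinor K) D1 D2 E1 E2 :
  spin_equiv psi psi' -> decomposes psi' D1 D2 E1 E2 ->
  exists D1 D2 E1 E2, decomposes psi D1 D2 E1 E2.
Proof.
move=> [g [g' [gg' eqv]]] [[h11 h22 h12 h21] dec con].
have g'g : g' *m g = 1%:M by apply: mulmx1C.
exists (D1 *m g'), (D2 *m g'), (g *m E1), (g *m E2); split.
- have E (D : 'M[K]_(7, 7 + 7)) (F : 'M[K]_(7 + 7, 7)) : D *m g' *m (g *m F) = D *m F.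
    by rewrite mulmxA -(mulmxA D) g'g mulmx1.
  by rewrite !E.
- move=> A M /eqv /dec [[N MN] S]; split.
    by exists (map_mx (in_alg A) g *m N); rewrite mulmxA.
  by rewrite !map_mxM !mulmxA.
- move=> A X sX XN; have [H1 H2] := con A X sX XN.
  have E (D : 'M[K]_(7, 7 + 7)) :
      X *m map_mx (in_alg A) (D *m g') *m map_mx (in_alg A) g = X *m map_mx (in_alg A) D.
    by rewrite -mulmxA -map_mxM -mulmxA g'g mulmx1.
  by split; apply/eqv; rewrite E.
Qed.

Lemma o_eq i j : (i < 7)%N -> (j < 7)%N -> (o i == o j) = (i == j).
Proof. by move=> i7 j7; rewrite -val_eqE /= !inordK. Qed.

Lemma dot_bv (A : comNzRingType) (w : 'rV[A]_(7 + 7)) i e : (w *m (bv A i e)^T) 0 0 = cf w i e.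
Proof.
have -> : bv A i e = flip (bv A i (~~ e)) by rewrite /flip /bv row_mxKl row_mxKr; case: e.
by rewrite -bil_flip flipK bil_bv negbK.
Qed.

Section Standard.
Variable K : numClosedFieldType.

(** [c := 1] gives a basis of the summand and [c := 2^-1] the dual basis for the dot product, whose
    transpose is the projection. *)
Definition row1 (c : K) (k : nat) : 'rV[K]_(7 + 7) :=
  if k == 0%N then c *: (bv K (o 6) true + bv K (o 6) false)
  else if (k < 4)%N then bv K (o (k - 1).*2) true else - bv K (o (k - 4).*2) false.

Definition row2 (c : K) (k : nat) : 'rV[K]_(7 + 7) :=
  if k == 0%N then c *: (bv K (o 6) true - bv K (o 6) false)
  else if (k < 4)%N then bv K (o (k - 1).*2.+1) true else bv K (o (k - 4).*2.+1) false.

Definition D1_0 : 'M[K]_(7, 7 + 7) := \matrix_(k < 7) row1 1 k.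
Definition D2_0 : 'M[K]_(7, 7 + 7) := \matrix_(k < 7) row2 1 k.
Definition E1_0 : 'M[K]_(7 + 7, 7) := (\matrix_(k < 7) row1 2^-1 k)^T.
Definition E2_0 : 'M[K]_(7 + 7, 7) := (\matrix_(k < 7) row2 2^-1 k)^T.

Lemma mul_rows_tr (R : nat -> 'rV[K]_(7 + 7)) (A : comAlgType K) m (w : 'M[A]_(m, 7 + 7)) i k : (k < 7)%N ->
  (w *m map_mx (in_alg A) ((\matrix_(k < 7) R k)^T)) i (o k) =
  (row i w *m map_mx (in_alg A) (R k)^T) 0 0.
Proof.
move=> k7; rewrite !mxE; apply: eq_bigr => j _; rewrite !mxE.
by rewrite /o inordK.
Qed.

Definition half (A : comAlgType K) : A := (2^-1 : K)%:A.

Lemma coord1 (A : comAlgType K) m (w : 'M[A]_(m, 7 + 7)) i k : (k < 7)%N ->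
  rowc (w *m map_mx (in_alg A) E1_0) i k =
  if k == 0%N then half A * (cf (row i w) (o 6) true + cf (row i w) (o 6) false)
  else if (k < 4)%N then cf (row i w) (o (k - 1).*2) true
  else - cf (row i w) (o (k - 4).*2) false.
Proof.
move=> k7; rewrite /rowc mul_rows_tr // /row1.
have bvm j e : map_mx (in_alg A) (bv K j e)^T = (bv A j e)^T.
  by rewrite -map_trmx /bv map_row_mx; case: e; rewrite map_delta_mx map_mx0.
case: ifP => _; last case: ifP => _.
- by rewrite linearZ linearD map_mxZ map_mxD !bvm -scalemxAr mxE mulmxDr mxE !dot_bv.
- by rewrite bvm dot_bv.
- by rewrite linearN map_mxN bvm mulmxN mxE dot_bv.
Qed.

Lemma coord2 (A : comAlgType K) m (w : 'M[A]_(m, 7 + 7)) i k : (k < 7)%N ->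
  rowc (w *m map_mx (in_alg A) E2_0) i k =
  if k == 0%N then half A * (cf (row i w) (o 6) true - cf (row i w) (o 6) false)
  else if (k < 4)%N then cf (row i w) (o (k - 1).*2.+1) true
  else cf (row i w) (o (k - 4).*2.+1) false.
Proof.
move=> k7; rewrite /rowc mul_rows_tr // /row2.
have bvm j e : map_mx (in_alg A) (bv K j e)^T = (bv A j e)^T.
  by rewrite -map_trmx /bv map_row_mx; case: e; rewrite map_delta_mx map_mx0.
case: ifP => _; last case: ifP => _.
- by rewrite linearZ linearB map_mxZ map_mxB !bvm -scalemxAr mxE mulmxBr mxE [X in _ + X]mxE !dot_bv.
- by rewrite bvm dot_bv.
- by rewrite bvm dot_bv.
Qed.


Lemma halfE (A : comAlgType K) : 2 * half A = 1.
Proof.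
rewrite /half -(rmorph_nat (in_alg A)) -in_algE -rmorphM divff ?rmorph1 //.
by rewrite pnatr_eq0.
Qed.

Lemma two_torsion (A : comAlgType K) (a : A) : 2 * a = 0 -> a = 0.
Proof. by move=> a0; rewrite -[a]mul1r -(halfE A) mulrAC a0 mul0r. Qed.

Lemma coordUc (A : comAlgType K) m (w : 'M[A]_(m, 7 + 7)) i n b : (n < 7)%N ->
  cf (row i w) (o n) b = Uc (rowc (w *m map_mx (in_alg A) (E1_0)) i)
    (rowc (w *m map_mx (in_alg A) (E2_0)) i) n b.
Proof.
have h2 := halfE A; have hh (a c : A) : half A * (a + c) + half A * (a - c) = a.
  by transitivity (2 * half A * a); [ring|rewrite h2 mul1r].
have hh' (a c : A) : half A * (a + c) - half A * (a - c) = c.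
  by transitivity (2 * half A * c); [ring|rewrite h2 mul1r].
by case: n => [|[|[|[|[|[|[|//]]]]]]] _; case: b; rewrite /Uc /= ?addn0 ?add0n ?(coord1, coord2) //= ?opprK ?hh ?hh'.
Qed.

Lemma regularE m n (X : 'M[K]_(m, n)) : map_mx (in_alg K^o) X = X.
Proof. by apply/matrixP => i j; rewrite mxE; apply: mulr1. Qed.

Lemma cfN (A : comNzRingType) (u : 'rV[A]_(7 + 7)) i b : cf (- u) i b = - cf u i b.
Proof. by rewrite -scaleN1r cfZ mulN1r. Qed.

Lemma standard_dual : [/\ D1_0 *m E1_0 = 1%:M, D2_0 *m E2_0 = 1%:M,
  D1_0 *m E2_0 = 0 & D2_0 *m E1_0 = 0].
Proof.
have e2 : 2^-1 * (1 + 1) = 1 :> K by rewrite mulVf // pnatr_eq0.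
have r1 k : (k < 7)%N -> row (o k) D1_0 = row1 1 k.
  by move=> k7; rewrite rowK /o inordK.
have r2 k : (k < 7)%N -> row (o k) D2_0 = row2 1 k.
  by move=> k7; rewrite rowK /o inordK.
have E (D : 'M[K]_(7, 7 + 7)) (F : 'M[K]_(7 + 7, 7)) (a : K) :
    (forall i k, (i < 7)%N -> (k < 7)%N ->
      @rowc K^o 7 (D *m map_mx (in_alg K^o) F) (o i) k = a *+ (i == k)) -> D *m F = a%:M.
  move=> H; apply/matrixP => i k; have := H i k (ltn_ord i) (ltn_ord k).
  by rewrite regularE /rowc /o !inord_val mxE => ->; rewrite mxE.
have half1 : half K^o = 2^-1 :> K by apply: mulr1.
split; rewrite -?(raddf0 (@scalar_mx K 7)); apply: E => i k i7 k7; rewrite ?(coord1, coord2) // ?(r1, r2) //.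
all: case: i i7 => [|[|[|[|[|[|[|//]]]]]]] _; case: k k7 => [|[|[|[|[|[|[|//]]]]]]] _.
all: rewrite /row1 /row2 /= ?scale1r ?cfD ?cfN ?cf_bv ?o_eq //= ?half1.
all: rewrite ?mul0rn.
all: by first [ring | rewrite -[RHS]e2; ring].
Qed.

Lemma eval_terms_ext (A : comNzRingType) (U V U' V' : nat -> bool -> A) s m :
  (forall i b, (i < 7)%N -> U i b = U' i b) -> (forall i b, (i < 7)%N -> V i b = V' i b) ->
  eval_terms U V (terms s m) = eval_terms U' V' (terms s m).
Proof.
move=> EU EV; rewrite !eval_termsE; apply: eq_big_seq => t /allpairsPdep[i [j [iI jI ->]]].
move: iI jI; rewrite mem_filter !mem_iota => /andP[_ i7] /andP[_ /andP[_ j7]].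
by rewrite /eval_term EU // EV.
Qed.

Lemma Uc_quad (A : comNzRingType) (x x' : nat -> A) :
  \sum_(i <- iota 0 7) Uc x x' i true * Uc x x' i false = N7 x' - N7 x.
Proof. by rewrite !big_cons big_nil /Uc /= /N7; ring. Qed.

Lemma Uc_bil (A : comNzRingType) (x x' y y' : nat -> A) :
  \sum_(i <- iota 0 7) (Uc x x' i true * Uc y y' i false + Uc x x' i false * Uc y y' i true)
  = B7 x' y' - B7 x y.
Proof. by rewrite !big_cons big_nil /Uc /= /B7; ring. Qed.

Section Frames.
Variables (A : comAlgType K) (M : 'M[A]_(2, 7 + 7)).
Let X := M *m map_mx (in_alg A) E1_0.
Let X' := M *m map_mx (in_alg A) E2_0.

Lemma quad_coord i : quad (row i M) = N7 (rowc X' i) - N7 (rowc X i).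
Proof.
rewrite quadE sum_ord7 -Uc_quad; apply: eq_big_seq => n; rewrite mem_iota => /andP[_ n7].
by rewrite !coordUc.
Qed.

Lemma bil_coord i j : bil (row i M) (row j M) = B7 (rowc X' i) (rowc X' j) - B7 (rowc X i) (rowc X j).
Proof.
rewrite /bil sum_ord7 -Uc_bil; apply: eq_big_seq => n; rewrite mem_iota => /andP[_ n7].
by rewrite !coordUc.
Qed.

Lemma clifford2_coord m : clifford (row 0 M) (clifford (row 1 M) (bc A (psi0 K))) (setm m) =
  ev (rowc X 0) (rowc X' 0) (rowc X 1) (rowc X' 1) m.
Proof.
have -> : bc A (psi0 K) = indicator A supp.
  by apply/ffunP => I; rewrite bcE !ffunE; case: (_ \in _); rewrite ?scale1r ?scale0r.
rewrite clifford2_mask /ev; apply: eval_terms_ext => i b i7; exact: coordUc.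
Qed.

End Frames.

Lemma ord7P (P : 'I_7 -> Prop) : (forall i, (i < 7)%N -> P (o i)) -> forall i, P i.
Proof. by move=> H i; have := H i (ltn_ord i); rewrite /o inord_val. Qed.

Lemma even_psi0 (A : comAlgType K) : even_spinor (bc A (psi0 K)).
Proof.
apply: even_bc => I oI; rewrite ffunE; case: (boolP (_ \in _)) => // h.
have/allP/(_ _ h) : all (fun m => ~~ odd (count id m)) supp by vm_compute.
by rewrite -card_setm ?size_mkseq // setm_bits oI.
Qed.

Lemma decomposes_psi0 : decomposes (psi0 K) D1_0 D2_0 E1_0 E2_0.
Proof.
have [d11 d22 d12 d21] := standard_dual.
split=> // A.
- move=> M [iso van]; split; first by case: iso.
  have [q0 q1 q01] := (isotropic_rows M).1 iso.2.
  have/ffunP van' := (section_vanishes_iff iso (even_psi0 A)).1 van.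
  have H m : size m = 7 -> ev (rowc (M *m map_mx (in_alg A) E1_0) 0) (rowc (M *m map_mx (in_alg A) E2_0) 0) (rowc (M *m map_mx (in_alg A) E1_0) 1) (rowc (M *m map_mx (in_alg A) E2_0) 1) m = 0.
    by move=> _; rewrite -clifford2_coord van' ffunE.
  split.
  + exact: (lin7_local (@two_torsion A) H).
  + exact: (lin7_local' (@two_torsion A) H).
  + elim/ord7P => i i7; elim/ord7P => j j7.
    case: i i7 => [|i] i7; case: j j7 => [|j] j7.
    * exact: (mixed_local00 (@two_torsion A) H).
    * exact: (mixed_local0 (@two_torsion A) H (i := j.+1) j7).2.
    * exact: (mixed_local0 (@two_torsion A) H (i := i.+1) i7).1.
    * exact: (mixed_local H (i := i.+1) (j := j.+1) i7 j7).
  + split; apply/esym/eqP; rewrite -subr_eq0 -?quad_coord -?bil_coord; apply/eqP => //.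
- move=> X [lin n0 n1 b01] [N XN].
  have mD (D : 'M[K]_(7, 7 + 7)) (E : 'M[K]_(7 + 7, 7)) :
     X *m map_mx (in_alg A) D *m map_mx (in_alg A) E = X *m map_mx (in_alg A) (D *m E).
    by rewrite map_mxM mulmxA.
  have z0 i k : rowc (0 : 'M[A]_(2, 7)) i k = 0 by rewrite /rowc mxE.
  have inv (D : 'M[K]_(7, 7 + 7)) (E : 'M[K]_(7 + 7, 7)) : D *m E = 1%:M ->
      exists N : 'M[A]_(7 + 7, 2), X *m map_mx (in_alg A) D *m N = 1%:M.
    by move=> DE; exists (map_mx (in_alg A) E *m N); rewrite mulmxA mD DE map_mx1 mulmx1.
  have N0 i : N7 (rowc (0 : 'M[A]_(2, 7)) i) = 0 by rewrite /N7 !z0; ring.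
  have B0 i j : B7 (rowc (0 : 'M[A]_(2, 7)) i) (rowc (0 : 'M[A]_(2, 7)) j) = 0.
    by rewrite /B7 !z0; ring.
  have iso1 : isotropic_frame (X *m map_mx (in_alg A) D1_0).
    split; first exact: inv d11.
    apply/isotropic_rows; rewrite !quad_coord bil_coord !mD d11 d12 map_mx1 map_mx0 mulmx1 mulmx0.
    by rewrite !N0 B0 n0 n1 b01 !subr0.
  have iso2 : isotropic_frame (X *m map_mx (in_alg A) D2_0).
    split; first exact: inv d22.
    apply/isotropic_rows; rewrite !quad_coord bil_coord !mD d22 d21 map_mx1 map_mx0 mulmx1 mulmx0.
    by rewrite !N0 B0 n0 n1 b01 !subr0.
  have b01' : B7 (rowc X 0) (rowc X 1) = 0 by [].
  split; split=> //; apply/section_vanishes_iff => //; try exact: even_psi0.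
  all: apply/ffunP => I; rewrite -(setm_bits I) clifford2_coord !mD ?d11 ?d12 ?d21 ?d22 map_mx1 map_mx0 mulmx1 mulmx0.
  + rewrite [RHS]ffunE -(local_conv (@two_torsion A) lin b01 (m := bits I)) ?size_mkseq //.
    by apply: eval_terms_ext => i b _; rewrite /Uc !z0.
  + rewrite [RHS]ffunE -(local_conv' (@two_torsion A) lin b01 (m := bits I)) ?size_mkseq //.
    by apply: eval_terms_ext => i b _; rewrite /Uc !z0.
Qed.
End Standard.

(** * Plücker tensors and root elements of G_2 *)

Section Wedge.
Variables (A : comNzRingType) (n : nat).

Definition wedge (M : 'M[A]_(2, n)) : 'M[A]_n :=
  (row 0 M)^T *m row 1 M - (row 1 M)^T *m row 0 M.

Lemma wedgeE M i j : wedge M i j = M 0 i * M 1 j - M 1 i * M 0 j.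
Proof. by rewrite !mxE !big_ord1 !mxE. Qed.

Lemma wedgeM (M : 'M[A]_(2, n)) p (D : 'M[A]_(n, p)) :
  (row 0 (M *m D))^T *m row 1 (M *m D) - (row 1 (M *m D))^T *m row 0 (M *m D) =
  D^T *m wedge M *m D.
Proof. by rewrite /wedge !row_mul !trmx_mul mulmxBr mulmxBl !mulmxA. Qed.

End Wedge.

Lemma plucker_wedge (A : comNzRingType) (M : 'M[A]_(2, 7 + 7)) : plucker M = mxvec (wedge M).
Proof. by rewrite /plucker; congr mxvec; apply/matrixP => i j; rewrite !mxE !big_ord1 !mxE. Qed.

Section Generators.
Variable K : numClosedFieldType.

Definition mat7 (L : seq (seq K)) : 'M[K]_7 :=
  \matrix_(j < 7, k < 7) nth 0 (nth [::] L j) k.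

Lemma rowc_mat7 (A : comAlgType K) m (X : 'M[A]_(m, 7)) L i k : (k < 7)%N ->
  rowc (X *m map_mx (in_alg A) (mat7 L)) i k =
  \sum_(j <- iota 0 7) rowc X i j * (nth 0 (nth [::] L j) k)%:A.
Proof.
move=> k7; rewrite /rowc mxE sum_ord7; apply: eq_big_seq => j; rewrite mem_iota => /andP[_ j7].
by rewrite !mxE /o !inordK.
Qed.

Definition preserves_special (g : 'M[K]_7) : Prop :=
  forall (A : comAlgType K) (X : 'M[A]_(2, 7)), special X -> special (X *m map_mx (in_alg A) g).

Lemma preserves_specialM g h : preserves_special g -> preserves_special h ->
  preserves_special (g *m h).
Proof. by move=> Pg Ph A X sX; rewrite map_mxM mulmxA; apply/Ph/Pg. Qed.

(* gU and gL are root subgroups of G_2 for a short and a long root, gC has order 3, and gW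
   exchanges the two 3-dimensional summands for SL_3. *)
Definition gU (t : K) := mat7 [::
  [:: 1; 0; 0; 0; 2 * t; 0; 0];
  [:: t; 1; 0; 0; t * t; 0; 0];
  [:: 0; 0; 1; 0; 0; 0; 0];
  [:: 0; 0; 0; 1; 0; 0; 0];
  [:: 0; 0; 0; 0; 1; 0; 0];
  [:: 0; 0; 0; - t; 0; 1; 0];
  [:: 0; 0; t; 0; 0; 0; 1]].

Definition gL (t : K) := mat7 [::
  [:: 1; 0; 0; 0; 0; 0; 0];
  [:: 0; 1; t; 0; 0; 0; 0];
  [:: 0; 0; 1; 0; 0; 0; 0];
  [:: 0; 0; 0; 1; 0; 0; 0];
  [:: 0; 0; 0; 0; 1; 0; 0];
  [:: 0; 0; 0; 0; - t; 1; 0];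
  [:: 0; 0; 0; 0; 0; 0; 1]].

Definition gC := mat7 [::
  [:: 1; 0; 0; 0; 0; 0; 0];
  [:: 0; 0; 1; 0; 0; 0; 0];
  [:: 0; 0; 0; 1; 0; 0; 0];
  [:: 0; 1; 0; 0; 0; 0; 0];
  [:: 0; 0; 0; 0; 0; 1; 0];
  [:: 0; 0; 0; 0; 0; 0; 1];
  [:: 0; 0; 0; 0; 1; 0; 0]].

Definition gW := mat7 [::
  [:: -1; 0; 0; 0; 0; 0; 0];
  [:: 0; 0; 0; 0; 1; 0; 0];
  [:: 0; 0; 0; 0; 0; 1; 0];
  [:: 0; 0; 0; 0; 0; 0; 1];
  [:: 0; 1; 0; 0; 0; 0; 0];
  [:: 0; 0; 1; 0; 0; 0; 0];
  [:: 0; 0; 0; 1; 0; 0; 0]].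

Lemma alg_scalars (A : comAlgType K) :
  (forall a b : K, (a * b)%:A = a%:A * b%:A :> A) *
  ((forall a : K, (- a)%:A = - a%:A :> A) * (((2 : K)%:A = 2 :> A) *
  (((0 : K)%:A = 0 :> A) * ((1 : K)%:A = 1 :> A)))).
Proof.
split=> [a b|]; first by rewrite -!in_algE rmorphM.
split=> [a|]; first by rewrite scaleNr.
split; first by rewrite -in_algE rmorph_nat.
by rewrite scale0r scale1r.
Qed.


Fact lc_mul (A : comNzRingType) (c a : A) : a = 0 -> c * a = 0.
Proof. by move=> ->; rewrite mulr0. Qed.

Fact eq_sub0 (A : zmodType) (a b : A) : a = b -> a - b = 0.
Proof. by move=> ->; rewrite subrr. Qed.

Lemma special_intro (A : comNzRingType) (x y : nat -> A) :
  let p i j := x i * y j - x j * y i in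
  p 1%N 2%N - p 0%N 6%N = 0 -> p 2%N 3%N - p 0%N 4%N = 0 -> p 3%N 1%N - p 0%N 5%N = 0 ->
  p 4%N 5%N + p 0%N 3%N = 0 -> p 5%N 6%N + p 0%N 1%N = 0 -> p 6%N 4%N + p 0%N 2%N = 0 ->
  p 1%N 4%N + p 2%N 5%N + p 3%N 6%N = 0 -> N7 x = 0 -> N7 y = 0 -> B7 x y = 0 ->
  [/\ lin7 x y, N7 x = 0, N7 y = 0 & B7 x y = 0].
Proof.
move=> /= r1 r2 r3 r4 r5 r6 r7 n0 n1 b; split=> //; split; [split|split|] => //; to0=> //.
all: by [apply: (etrans _ r4); ring|apply: (etrans _ r5); ring|apply: (etrans _ r6); ring].
Qed.

Lemma special_elim (A : comNzRingType) (x y : nat -> A) : lin7 x y ->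
  let p i j := x i * y j - x j * y i in
  [/\ [/\ p 1%N 2%N - p 0%N 6%N = 0, p 2%N 3%N - p 0%N 4%N = 0 & p 3%N 1%N - p 0%N 5%N = 0],
      [/\ p 4%N 5%N + p 0%N 3%N = 0, p 5%N 6%N + p 0%N 1%N = 0 & p 6%N 4%N + p 0%N 2%N = 0] &
      p 1%N 4%N + p 2%N 5%N + p 3%N 6%N = 0].
Proof.
move=> [[l1 l2 l3] [l4 l5 l6] l7] /=.
by split=> //; split; rewrite ?l1 ?l2 ?l3 ?l4 ?l5 ?l6 ?subrr ?addNr.
Qed.

Lemma gUE (A : comAlgType K) m (X : 'M[A]_(m, 7)) (t : K) i :
  let x := rowc X i in let x' := rowc (X *m map_mx (in_alg A) (gU t)) i in
  ((x' 0%N = (x 0%N + t%:A * x 1%N)%R) * (x' 1%N = (x 1%N)%R) * (x' 2%N = (x 2%N + t%:A * x 6%N)%R) * (x' 3%N = (x 3%N - t%:A * x 5%N)%R) * (x' 4%N = (x 4%N + 2 * t%:A * x 0%N + t%:A ^+ 2 * x 1%N)%R) * (x' 5%N = (x 5%N)%R) * (x' 6%N = (x 6%N)%R))%type.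
Proof.
by move=> x x'; rewrite /x' !rowc_mat7 // !big_cons !big_nil /= !(alg_scalars A); do ![split]; rewrite -/x; ring.
Qed.

(** The seven relations of [lin7] span a copy of V_7 in the dual of the exterior square, on which
    [gU t] acts unipotently; the multipliers of the linear relations are the entries of this
    action. *)
Lemma gU_special (t : K) : preserves_special (gU t).
Proof.
move=> A X [/special_elim[[r1 r2 r3] [r4 r5 r6] r7] n0 n1 b].
rewrite /N7 in n0 n1; rewrite /B7 in b.
apply: special_intro; rewrite /N7 /B7 !(gUE X).
- by_comb r1.
- by_comb (lc_add (lc_add r2 (lc_mul (- t%:A) r7)) (lc_mul (t%:A ^+ 2) r5)).
- by_comb r3.
- by_comb (lc_add r4 (lc_mul (- t%:A) r3)).
- by_comb r5.
- by_comb (lc_add r6 (lc_mul (t%:A) r1)).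
- by_comb (lc_add r7 (lc_mul (- 2 * t%:A) r5)).
- by_comb n0.
- by_comb n1.
- by_comb b.
Qed.

Lemma gLE (A : comAlgType K) m (X : 'M[A]_(m, 7)) (t : K) i :
  let x := rowc X i in let x' := rowc (X *m map_mx (in_alg A) (gL t)) i in
  ((x' 0%N = (x 0%N)%R) * (x' 1%N = (x 1%N)%R) * (x' 2%N = (x 2%N + t%:A * x 1%N)%R) * (x' 3%N = (x 3%N)%R) * (x' 4%N = (x 4%N - t%:A * x 5%N)%R) * (x' 5%N = (x 5%N)%R) * (x' 6%N = (x 6%N)%R))%type.
Proof.
by move=> x x'; rewrite /x' !rowc_mat7 // !big_cons !big_nil /= !(alg_scalars A); do ![split]; rewrite -/x; ring.
Qed.

Lemma gL_special (t : K) : preserves_special (gL t).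
Proof.
move=> A X [/special_elim[[r1 r2 r3] [r4 r5 r6] r7] n0 n1 b].
rewrite /N7 in n0 n1; rewrite /B7 in b.
apply: special_intro; rewrite /N7 /B7 !(gLE X).
- by_comb r1.
- by_comb (lc_add r2 (lc_mul (- t%:A) r3)).
- by_comb r3.
- by_comb r4.
- by_comb r5.
- by_comb (lc_add r6 (lc_mul (t%:A) r5)).
- by_comb r7.
- by_comb n0.
- by_comb n1.
- by_comb b.
Qed.

Lemma gCE (A : comAlgType K) m (X : 'M[A]_(m, 7)) i :
  let x := rowc X i in let x' := rowc (X *m map_mx (in_alg A) gC) i in
  ((x' 0%N = (x 0%N)%R) * (x' 1%N = (x 3%N)%R) * (x' 2%N = (x 1%N)%R) * (x' 3%N = (x 2%N)%R) * (x' 4%N = (x 6%N)%R) * (x' 5%N = (x 4%N)%R) * (x' 6%N = (x 5%N)%R))%type.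
Proof.
by move=> x x'; rewrite /x' !rowc_mat7 // !big_cons !big_nil /= !(alg_scalars A); do ![split]; rewrite -/x; ring.
Qed.

Lemma gC_special : preserves_special gC.
Proof.
move=> A X [/special_elim[[r1 r2 r3] [r4 r5 r6] r7] n0 n1 b].
rewrite /N7 in n0 n1; rewrite /B7 in b.
apply: special_intro; rewrite /N7 /B7 !(gCE X).
- by_comb r3.
- by_comb r1.
- by_comb r2.
- by_comb r6.
- by_comb r4.
- by_comb r5.
- by_comb r7.
- by_comb n0.
- by_comb n1.
- by_comb b.
Qed.

Lemma gWE (A : comAlgType K) m (X : 'M[A]_(m, 7)) i :
  let x := rowc X i in let x' := rowc (X *m map_mx (in_alg A) gW) i in
  ((x' 0%N = (- x 0%N)%R) * (x' 1%N = (x 4%N)%R) * (x' 2%N = (x 5%N)%R) * (x' 3%N = (x 6%N)%R) * (x' 4%N = (x 1%N)%R) * (x' 5%N = (x 2%N)%R) * (x' 6%N = (x 3%N)%R))%type.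
Proof.
by move=> x x'; rewrite /x' !rowc_mat7 // !big_cons !big_nil /= !(alg_scalars A); do ![split]; rewrite -/x; ring.
Qed.

Lemma gW_special : preserves_special gW.
Proof.
move=> A X [/special_elim[[r1 r2 r3] [r4 r5 r6] r7] n0 n1 b].
rewrite /N7 in n0 n1; rewrite /B7 in b.
apply: special_intro; rewrite /N7 /B7 !(gWE X).
- by_comb r4.
- by_comb r5.
- by_comb r6.
- by_comb r1.
- by_comb r2.
- by_comb r3.
- by_comb (lc_opp r7).
- by_comb n0.
- by_comb n1.
- by_comb b.
Qed.

End Generators.
Arguments gU {K}.
Arguments gL {K}.
Arguments gC {K}.
Arguments gW {K}.

(** * The group G_2 *)

Section Form.
Variable A : comNzRingType.
Implicit Types x y z : nat -> A.

Definition vol3 (i j k : nat) x y z : A :=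
  x i * (y j * z k - y k * z j) - x j * (y i * z k - y k * z i) + x k * (y i * z j - y j * z i).

Definition form3 x y z : A :=
  vol3 0 1 4 x y z + vol3 0 2 5 x y z + vol3 0 3 6 x y z + vol3 1 2 3 x y z + vol3 4 5 6 x y z.

End Form.

Lemma det3 (A : comNzRingType) (M : 'M[A]_3) : \det M =
  M 0 0 * (M 1 1 * M 2 2 - M 1 2 * M 2 1) - M 0 1 * (M 1 0 * M 2 2 - M 1 2 * M 2 0)
  + M 0 2 * (M 1 0 * M 2 1 - M 1 1 * M 2 0).
Proof.
pose f a b : A := M (inord a) (inord b).
have ME i j : M i j = f i j by rewrite /f !inord_val.
rewrite (expand_det_row _ 0) !big_ord_recl big_ord0 /cofactor !(expand_det_row _ 0).
rewrite !big_ord_recl !big_ord0 /cofactor !det_mx11 !mxE !ME /= /bump /=; ring.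
Qed.

Section Gens.
Variable K : numClosedFieldType.
Implicit Types x y z : 'rV[K]_7.

Lemma g2_formE x y z : g2_form x y z = form3 (rowc x 0) (rowc y 0) (rowc z 0).
Proof.
have w (i j k : 'I_7) : wedge3 i j k x y z = vol3 i j k (rowc x 0) (rowc y 0) (rowc z 0).
  by rewrite /wedge3 det3 !mxE /= /vol3 /rowc /o !inord_val; ring.
by rewrite /g2_form !w.
Qed.

Definition Gram : 'M[K]_7 := mat7 [::
  [:: -2; 0; 0; 0; 0; 0; 0];
  [:: 0; 0; 0; 0; 1; 0; 0];
  [:: 0; 0; 0; 0; 0; 1; 0];
  [:: 0; 0; 0; 0; 0; 0; 1];
  [:: 0; 1; 0; 0; 0; 0; 0];
  [:: 0; 0; 1; 0; 0; 0; 0];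
  [:: 0; 0; 0; 1; 0; 0; 0]].

Lemma rowc_mul_mat7 m (X : 'M[K]_(m, 7)) L i k : (k < 7)%N ->
  rowc (X *m mat7 L) i k = \sum_(j <- iota 0 7) rowc X i j * nth 0 (nth [::] L j) k.
Proof.
move=> k7; rewrite /rowc mxE sum_ord7; apply: eq_big_seq => j; rewrite mem_iota => /andP[_ j7].
by rewrite mxE /o !inordK.
Qed.

Lemma GramE x y : (x *m Gram *m y^T) 0 0 = B7 (rowc x 0) (rowc y 0).
Proof.
rewrite mxE sum_ord7 !big_cons big_nil.
have E k : (x *m Gram) 0 (o k) = rowc (x *m Gram) 0 k by [].
rewrite !E /Gram !rowc_mul_mat7 // !big_cons !big_nil /= ![y^T _ _]mxE /B7 /rowc; ring.
Qed.

(** Invariance of [Gram] is carried along in order to compare the action on Plücker tensors with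
    conjugation of matrices. *)
Definition isG2 (g : 'M[K]_7) : Prop := G2_group g /\ g *m Gram *m g^T = Gram.

Lemma isG2_intro g : \det g = 1 ->
  (forall x y z, form3 (rowc (x *m g) 0) (rowc (y *m g) 0) (rowc (z *m g) 0) =
     form3 (rowc x 0) (rowc y 0) (rowc z 0)) ->
  (forall x y, B7 (rowc (x *m g) 0) (rowc (y *m g) 0) = B7 (rowc x 0) (rowc y 0)) -> isG2 g.
Proof.
move=> dg fg bg; split; first by split=> // x y z; rewrite !g2_formE.
apply/matrixP => i j.
have E (M : 'M[K]_7) : M i j = (delta_mx 0 i *m M *m (delta_mx 0 j)^T : 'M_1) 0 0.
  by rewrite trmx_delta -rowE -colE !mxE.
by rewrite E [RHS]E GramE -bg -GramE trmx_mul !mulmxA.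
Qed.

Lemma isG2M g h : isG2 g -> isG2 h -> isG2 (g *m h).
Proof.
move=> [[dg fg] bg] [[dh fh] bh]; split; last first.
  by rewrite trmx_mul !mulmxA -(mulmxA g h) -(mulmxA g) bh.
by split=> [|x y z]; rewrite ?det_mulmx ?dg ?dh ?mulr1 // !mulmxA fh fg.
Qed.

Lemma isG21 : isG2 1%:M.
Proof. by split; [split=> [|x y z]|]; rewrite ?det1 ?trmx1 ?mul1mx ?mulmx1. Qed.

(** A torus element conjugates a unipotent [g] to its square, so the determinant of [g] is a nonzero
    idempotent; this replaces an expansion in size 7. The inverse of [h] is given up to the scalar
    [c], which keeps its entries integral. *)
Lemma det_conj_square n (g g' h h' : 'M[K]_n) c :
  g *m g' = 1%:M -> h *m h' = c%:M -> c != 0 -> h *m g = g *m g *m h -> \det g = 1.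
Proof.
move=> /(congr1 determinant) gg /(congr1 determinant) hh c0 /(congr1 determinant).
move: gg hh; rewrite !det_mulmx det1 det_scalar => gg hh /eqP.
have g0 : \det g != 0 by apply: contra_eq_neq gg => ->; rewrite mul0r eq_sym oner_neq0.
have h0 : \det h != 0.
  by apply: contra_eq_neq hh => ->; rewrite mul0r eq_sym expf_neq0.
rewrite [\det h * _]mulrC (inj_eq (mulIf h0)) -[X in X == _]mulr1 (inj_eq (mulfI g0)).
by move=> /eqP.
Qed.

Lemma mat7_ext (g h : 'M[K]_7) : (forall (x : 'rV[K]_7) k, (k < 7)%N ->
  rowc (x *m g) 0 k = rowc (x *m h) 0 k) -> g = h.
Proof.
move=> H; apply/row_matrixP => i; apply/rowP; elim/ord7P => k k7.
by rewrite !rowE; apply: H.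
Qed.

Lemma gU_inv t : gU t *m gU (- t) = 1%:M :> 'M[K]_7.
Proof.
apply: mat7_ext => x k k7; rewrite mulmxA mulmx1 -[gU t]regularE -[gU (- t)]regularE.
by case: k k7 => [|[|[|[|[|[|[|//]]]]]]] _; rewrite !(@gUE K K^o) ?scaleNr; ring.
Qed.

Lemma gL_inv t : gL t *m gL (- t) = 1%:M :> 'M[K]_7.
Proof.
apply: mat7_ext => x k k7; rewrite mulmxA mulmx1 -[gL t]regularE -[gL (- t)]regularE.
by case: k k7 => [|[|[|[|[|[|[|//]]]]]]] _; rewrite !(@gLE K K^o) ?scaleNr; ring.
Qed.

Lemma gC_inv : gC *m (gC *m gC) = 1%:M :> 'M[K]_7.
Proof.
apply: mat7_ext => x k k7; rewrite !mulmxA mulmx1 -[gC]regularE.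
by case: k k7 => [|[|[|[|[|[|[|//]]]]]]] _; rewrite !(@gCE K K^o).
Qed.

Lemma gW_inv : gW *m gW = 1%:M :> 'M[K]_7.
Proof.
apply: mat7_ext => x k k7; rewrite mulmxA mulmx1 -[gW]regularE.
by case: k k7 => [|[|[|[|[|[|[|//]]]]]]] _; rewrite !(@gWE K K^o) ?opprK.
Qed.

Definition diag7 (L : seq K) : 'M[K]_7 := diag_mx (\row_(k < 7) nth 0 L k).

Lemma rowc_diag7 m (X : 'M[K]_(m, 7)) L i k : (k < 7)%N ->
  rowc (X *m diag7 L) i k = rowc X i k * nth 0 L k.
Proof. by move=> k7; rewrite /rowc mul_mx_diag !mxE /o inordK. Qed.

Lemma det_gU t : \det (gU t : 'M[K]_7) = 1.
Proof.
have c0 : 4 != 0 :> K by rewrite pnatr_eq0.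
(* The weights make conjugation double [t]: their ratio is 2 at the entries linear in [t] and 4 at
   [t * t]. *)
apply: (det_conj_square (gU_inv t) (h := diag7 [:: 2; 4; 1; 1; 1; 2; 2]) (h' := diag7 [:: 2; 1; 4; 4; 4; 2; 2]) _ c0).
  apply: mat7_ext => x k k7; rewrite mulmxA mul_mx_scalar [RHS]/rowc mxE !rowc_diag7 //.
  by case: k k7 => [|[|[|[|[|[|[|//]]]]]]] _ /=; rewrite /rowc; ring.
apply: mat7_ext => x k k7; rewrite !mulmxA -[gU t]regularE.
by case: k k7 => [|[|[|[|[|[|[|//]]]]]]] _;
  rewrite !(@gUE K K^o, rowc_diag7) //=; ring.
Qed.

Lemma det_gL t : \det (gL t : 'M[K]_7) = 1.
Proof.
have c0 : 2 != 0 :> K by rewrite pnatr_eq0.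
apply: (det_conj_square (gL_inv t) (h := diag7 [:: 1; 2; 1; 1; 1; 2; 1]) (h' := diag7 [:: 2; 1; 2; 2; 2; 1; 2]) _ c0).
  apply: mat7_ext => x k k7; rewrite mulmxA mul_mx_scalar [RHS]/rowc mxE !rowc_diag7 //.
  by case: k k7 => [|[|[|[|[|[|[|//]]]]]]] _ /=; rewrite /rowc; ring.
apply: mat7_ext => x k k7; rewrite !mulmxA -[gL t]regularE.
by case: k k7 => [|[|[|[|[|[|[|//]]]]]]] _;
  rewrite !(@gLE K K^o, rowc_diag7) //=; ring.
Qed.

Lemma rowc_tperm m (X : 'M[K]_(m, 7)) a b i k : (a < 7)%N -> (b < 7)%N -> (k < 7)%N ->
  rowc (X *m tperm_mx (o a) (o b)) i k = rowc X i (if k == a then b else if k == b then a else k).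
Proof.
move=> a7 b7 k7; rewrite -xcolE /rowc mxE; congr (X i _).
have [->|ka] := eqVneq k a; first by rewrite tpermL.
have [->|kb] := eqVneq k b; first by rewrite tpermR.
by rewrite tpermD // o_eq // eq_sym.
Qed.

Lemma det_tperm a b : (a < 7)%N -> (b < 7)%N -> a != b -> \det (tperm_mx (o a) (o b) : 'M[K]_7) = -1.
Proof. by move=> a7 b7 ab; rewrite det_perm odd_tperm o_eq // ab expr1. Qed.

Lemma det_gC : \det (gC : 'M[K]_7) = 1.
Proof.
have -> : gC = tperm_mx (o 1) (o 2) *m tperm_mx (o 1) (o 3) *m
    (tperm_mx (o 4) (o 5) *m tperm_mx (o 4) (o 6)) :> 'M[K]_7.
  apply: mat7_ext => x k k7; rewrite !mulmxA -[gC]regularE.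
  by case: k k7 => [|[|[|[|[|[|[|//]]]]]]] _; rewrite (@gCE K K^o) !rowc_tperm.
by rewrite !det_mulmx !det_tperm // !mulrNN !mulr1.
Qed.

Lemma det_gW : \det (gW : 'M[K]_7) = 1.
Proof.
have -> : gW = diag7 [:: -1; 1; 1; 1; 1; 1; 1] *m tperm_mx (o 1) (o 4) *m
    (tperm_mx (o 2) (o 5) *m tperm_mx (o 3) (o 6)) :> 'M[K]_7.
  apply: mat7_ext => x k k7; rewrite !mulmxA -[gW]regularE.
  by case: k k7 => [|[|[|[|[|[|[|//]]]]]]] _; rewrite (@gWE K K^o) !rowc_tperm ?rowc_diag7 //=; ring.
by rewrite !det_mulmx !det_tperm // det_diag !big_ord_recl big_ord0 !mxE /=; ring.
Qed.

Lemma isG2_gU t : isG2 (gU t).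
Proof.
apply: isG2_intro => [|x y z|x y]; rewrite ?det_gU // -[gU t]regularE.
  by rewrite /form3 /vol3 !(@gUE K K^o); ring.
by rewrite /B7 !(@gUE K K^o); ring.
Qed.

Lemma isG2_gL t : isG2 (gL t).
Proof.
apply: isG2_intro => [|x y z|x y]; rewrite ?det_gL // -[gL t]regularE.
  by rewrite /form3 /vol3 !(@gLE K K^o); ring.
by rewrite /B7 !(@gLE K K^o); ring.
Qed.

Lemma isG2_gC : isG2 gC.
Proof.
apply: isG2_intro => [|x y z|x y]; rewrite ?det_gC // -[gC]regularE.
  by rewrite /form3 /vol3 !(@gCE K K^o); ring.
by rewrite /B7 !(@gCE K K^o); ring.
Qed.

Lemma isG2_gW : isG2 gW.
Proof.
apply: isG2_intro => [|x y z|x y]; rewrite ?det_gW // -[gW]regularE.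
  by rewrite /form3 /vol3 !(@gWE K K^o); ring.
by rewrite /B7 !(@gWE K K^o); ring.
Qed.

End Gens.

(** * Reducedness *)

Lemma nonroot (K : numClosedFieldType) (q : {poly K}) : q != 0 -> exists c, q.[c] != 0.
Proof.
move=> q0; have : ~~ all (root q) [seq i%:R | i <- iota 0 (size q)].
  apply/negP => /(max_poly_roots q0); rewrite size_map size_iota ltnn => H.
  by have := H; rewrite map_inj_uniq ?iota_uniq; [move/(_ isT)|by move=> i j /eqP; rewrite eqr_nat => /eqP].
by case/allPn => c _ qc; exists c.
Qed.

Lemma base_expansion_inj n N (a b : 'I_n -> nat) :
  (forall i, a i < N)%N -> (forall i, b i < N)%N ->
  (\sum_i a i * N ^ i = \sum_i b i * N ^ i)%N -> a =1 b.
Proof.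
elim: n a b => [|n IH] a b aN bN; first by move=> _ [].
have E (c : 'I_n.+1 -> nat) : (\sum_i c i * N ^ i = c ord0 + N * \sum_(i < n) c (lift ord0 i) * N ^ i)%N.
  rewrite big_ord_recl expn0 muln1 big_distrr; congr (_ + _)%N.
  by apply: eq_bigr => i _; rewrite /= expnS mulnCA.
rewrite !E => H.
have N0 : (0 < N)%N by apply: leq_ltn_trans (aN ord0).
have H0 : a ord0 = b ord0.
  have := congr1 (modn^~ N) H; rewrite ![(N * _)%N]mulnC ![(_ ord0 + _)%N]addnC.
  by rewrite !modnMDl !modn_small.
move: H; rewrite H0 => /addnI /eqP; rewrite eqn_pmul2l // => /eqP H.
have {}IH := IH _ _ (fun i => aN _) (fun i => bN _) H.
by move=> i; case: (unliftP ord0 i) => [j ->|->].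
Qed.

(* Kronecker substitution: x_i := T ^ (N ^ i) separates the monomials with exponents below N. *)
Lemma mpoly_vanishing (K : numClosedFieldType) n (P : {mpoly K[n]}) :
  (forall v, P.@[v] = 0) -> P = 0.
Proof.
move=> H; apply/mpolyP => m0; rewrite mcoeff0; apply/eqP; apply: contraT => m0P.
pose N := msize P; pose w (m : 'X_{1..n}) := (\sum_(i < n) m i * N ^ i)%N.
pose q : {poly K} := \sum_(m : 'X_{1..n < N}) P@_m *: 'X^(w m).
have mN (m : 'X_{1..n}) : (mdeg m < N)%N -> forall i, (m i < N)%N.
  move=> dm i; apply: leq_ltn_trans dm.
  by rewrite mdegE (bigD1 i) //= leq_addr.
have m0N : (mdeg m0 < N)%N.
  by apply: msize_mdeg_lt; rewrite mcoeff_msupp.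
have : q != 0.
  apply: contra_neq m0P => q0; have := congr1 (fun p : {poly K} => p`_(w m0)) q0.
  rewrite coef0 coef_sum (bigD1 (BMultinom m0N)) //= coefZ coefXn eqxx mulr1 big1 ?addr0 // => m mm0.
  rewrite coefZ coefXn; case: eqP => [e|]; rewrite ?mulr0 //.
  case/eqP: mm0; apply/val_inj/mnmP => i /=.
  by have := base_expansion_inj (mN _ m0N) (mN _ (bmdeg m)) e; move=> ->.
case/nonroot => c /eqP[]; rewrite -(H (fun i => c ^+ (N ^ i))).
rewrite /meval (mmapE N) // horner_sum; apply: eq_bigr => m _.
rewrite hornerZ hornerXn /= /mmap1; congr (_ * _).
by rewrite expr_sum; apply: eq_bigr => i _; rewrite -exprM mulnC.
Qed.

Section PolyLaws.
Variable K : numClosedFieldType.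

(* Homogeneous polynomial functions, as natural transformations on commutative algebras. *)
Definition law n := forall A : comAlgType K, 'rV[A]_n -> A.

(** Homogeneity and naturality survive linear substitutions, and naturality reduces the chart to its
    universal point. *)
Definition poly_law n d (F : law n) : Prop :=
  (forall (A : comAlgType K) c v, F A (c *: v) = c ^+ d * F A v) /\
  (forall (A B : comAlgType K) (h : {rmorphism A -> B}), (forall c : K, h c%:A = c%:A) ->
     forall v, h (F A v) = F B (map_mx h v)).

Definition law_comp m n (L : 'M[K]_(m, n)) (F : law n) : law m :=
  fun A v => F A (v *m map_mx (in_alg A) L).

Lemma law_compP m n d (L : 'M[K]_(m, n)) (F : law n) : poly_law d F -> poly_law d (law_comp L F).
Proof.
move=> [H1 H2]; split=> [A c v|A B h hK v]; first by rewrite /law_comp -scalemxAl H1.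
rewrite /law_comp (H2 _ _ _ hK) map_mxM; congr (F B (_ *m _)).
by apply/matrixP => i j; rewrite !mxE; apply: hK.
Qed.

Definition mpoly_law n (P : {mpoly K[n]}) : law n :=
  fun A v => (map_mpoly (in_alg A) P).@[fun i => v 0 i].

Lemma mpoly_lawE n (P : {mpoly K[n]}) (A : comAlgType K) (v : 'rV[A]_n) :
  mpoly_law P v = \sum_(m : 'X_{1..n < msize P}) (P@_m)%:A * \prod_i v 0 i ^+ m i.
Proof.
rewrite /mpoly_law (map_mpolyE (in_alg A) (leqnn _)) raddf_sum; apply: eq_bigr => m _.
by rewrite /= mevalZ mevalX.
Qed.

Lemma mpoly_lawP n d (P : {mpoly K[n]}) : P \is d.-homog -> poly_law d (mpoly_law P).
Proof.
move=> hP; split=> [A c v|A B h hK v]; rewrite !mpoly_lawE.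
  rewrite mulr_sumr; apply: eq_bigr => m _.
  have [md|md] := eqVneq (mdeg m) d; last by rewrite (dhomog_nemf_coeff hP md) scale0r !mul0r mulr0.
  rewrite mulrCA; congr (_ * _); under eq_bigr do rewrite mxE exprMn.
  by rewrite big_split /= -expr_sum -mdegE md.
rewrite rmorph_sum; apply: eq_bigr => m _; rewrite rmorphM hK rmorph_prod; congr (_ * _).
by apply: eq_bigr => i _; rewrite rmorphXn mxE.
Qed.

End PolyLaws.

Section Annihilator.
Variables (A : comNzRingType) (z : A).

(* a is in the radical of the annihilator of z. *)
Definition nilkill (a : A) : Prop := exists N, a ^+ N * z = 0.

Lemma nilkillM b a : nilkill a -> nilkill (b * a).
Proof. by move=> [N E]; exists N; rewrite exprMn -mulrA E mulr0. Qed.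

Lemma nilkillD a b : nilkill a -> nilkill b -> nilkill (a + b).
Proof.
move=> [N E] [M F]; exists (N + M)%N; rewrite exprDn mulr_suml big1 // => i _.
have ge c n m : c ^+ m * z = 0 -> (m <= n)%N -> c ^+ n * z = 0.
  by move=> E0 /subnK <-; rewrite exprD -mulrA E0 mulr0.
rewrite mulrnAl; have [iM|iM] := leqP M i; first by rewrite -mulrA (ge _ _ _ F iM) mulr0 mul0rn.
by rewrite mulrAC (ge _ _ _ E) ?mul0r ?mul0rn // -addnBA ?leq_addr // ltnW.
Qed.

Lemma nilkill0 : nilkill 0.
Proof. by exists 1; rewrite expr1 mul0r. Qed.

Lemma nilkillN a : nilkill a -> nilkill (- a).
Proof. by rewrite -mulN1r; apply: nilkillM. Qed.

Lemma nilkill1 : nilkill 1 -> z = 0.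
Proof. by move=> [N]; rewrite expr1n mul1r. Qed.

Lemma nilkill_sum (I : finType) (F : I -> A) : (forall i, nilkill (F i)) -> nilkill (\sum_i F i).
Proof. by move=> H; elim/big_ind: _ => //; [apply: nilkill0|apply: nilkillD]. Qed.

End Annihilator.

Definition conjm (A : comNzRingType) n p (D : 'M[A]_(n, p)) : 'M[A]_(n * n, p * p) :=
  lin_mx (mulmxr D \o mulmx D^T).

Lemma mul_conjm (A : comNzRingType) n p (D : 'M[A]_(n, p)) w :
  mxvec w *m conjm D = mxvec (D^T *m w *m D).
Proof. by rewrite mul_vec_lin. Qed.

Lemma map_conjm (A B : comNzRingType) (f : {rmorphism A -> B}) n p (D : 'M[A]_(n, p)) :
  map_mx f (conjm D) = conjm (map_mx f D).
Proof.
apply/row_matrixP => k; case/mxvec_indexP: k => i j.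
rewrite -map_row !rowE -mxvec_delta mul_conjm map_mxvec !map_mxM -map_trmx map_delta_mx.
by rewrite -mul_conjm mxvec_delta.
Qed.

Section Cell.
Variable K : numClosedFieldType.

Definition pp (A : comNzRingType) (Y : 'M[A]_(2, 7)) i j : A :=
  rowc Y 0 i * rowc Y 1 j - rowc Y 0 j * rowc Y 1 i.

Lemma wedge_pp (A : comNzRingType) (Y : 'M[A]_(2, 7)) i j : wedge Y (o i) (o j) = pp Y i j.
Proof. by rewrite wedgeE /pp /rowc [X in _ - X]mulrC. Qed.

Definition vanishes_on_cone (F : law K (7 * 7)) : Prop :=
  forall X : 'M[K^o]_(2, 7), special X -> wedge X != 0 -> F K^o (mxvec (wedge X)) = 0.

Definition mat27 (A : comNzRingType) (L : seq (seq A)) : 'M[A]_(2, 7) :=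
  \matrix_(i < 2, k < 7) nth 0 (nth [::] L i) k.

Lemma rowc_mat27 (A : comNzRingType) (L : seq (seq A)) i k : (k < 7)%N ->
  rowc (mat27 L) i k = nth 0 (nth [::] L i) k.
Proof. by move=> k7; rewrite /rowc mxE /o inordK. Qed.

(* The special planes with p15 != 0 (up to scaling by powers of p15 = t 0): a chart of G_2 / P_2. *)
Definition chart (A : comNzRingType) (t : nat -> A) : 'M[A]_(2, 7) :=
  let s := t 0%N in let a0 := t 1%N in let b0 := t 2%N in
  let a2 := t 3%N in let a3 := t 4%N in let b6 := t 5%N in
  mat27 [:: [:: s * a0; s * s; s * a2; s * a3; a0 * a0 + a3 * b0; 0; - (s * b0)];
            [:: s * b0; 0; a0 * b6 + b0 * b0; - (s * a0); a0 * b0 - s * a2 - a3 * b6; s * s; s * b6]].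

Lemma chart_special (A : comAlgType K) (t : nat -> A) : special (chart t).
Proof. by apply: special_intro; rewrite /N7 /B7 !rowc_mat27 //=; ring. Qed.

Lemma chart_pp (A : comNzRingType) (t : nat -> A) : pp (chart t) 1 5 = t 0%N ^+ 4.
Proof. by rewrite /pp !rowc_mat27 //=; ring. Qed.

Lemma map_chart (A B : comNzRingType) (h : {rmorphism A -> B}) (t : nat -> A) (t' : nat -> B) :
  (forall k, (k < 6)%N -> h (t k) = t' k) -> map_mx h (chart t) = chart t'.
Proof.
move=> E; apply/matrixP => i k; rewrite !mxE.
by case: i => [[|[|//]] /= _]; case: k => [[|[|[|[|[|[|[|//]]]]]]] /= _];
  rewrite ?(rmorph0, rmorphN, rmorphB, rmorphD, rmorphM) ?E.
Qed.

Lemma map_wedge (A B : comNzRingType) (h : {rmorphism A -> B}) n (M : 'M[A]_(2, n)) :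
  map_mx h (wedge M) = wedge (map_mx h M).
Proof. by apply/matrixP => i j; rewrite [LHS]mxE !wedgeE rmorphB !rmorphM !mxE. Qed.

(** By naturality it suffices to take for [t] the variables of a polynomial ring. The value there is
    a polynomial that vanishes wherever the first variable is nonzero; times that variable it
    vanishes everywhere, hence it is 0. *)
Lemma chart_vanishes d (F : law K (7 * 7)) : poly_law d F -> vanishes_on_cone F ->
  forall (A : comAlgType K) (t : nat -> A), F A (mxvec (wedge (chart t))) = 0.
Proof.
move=> [_ natF] van A t.
pose B : comAlgType K := {mpoly K[6]}.
pose q : {mpoly K[6]} := F B (mxvec (wedge (chart (fun k => 'X_(inord k) : B)))).
have hq (A' : comAlgType K) (t' : nat -> A') :
    mmap (in_alg A') (fun i => t' i) q = F A' (mxvec (wedge (chart t'))).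
  have hK c : mmap (in_alg A') (fun i : 'I_6 => t' i) (c%:A : B) = c%:A.
    by rewrite -[c%:A : B]mul_mpolyC mulr1 mmapC.
  rewrite /q (natF B A' _ hK) map_mxvec map_wedge (map_chart (t' := t')) // => k k6.
  by rewrite /= mmapX mmap1U inordK.
suff q0 : 'X_(inord 0) * q = 0.
  move/eqP: q0; rewrite mulf_eq0 => /orP[/eqP X0|/eqP q1]; last by rewrite -hq q1 rmorph0.
  have := oner_neq0 K; rewrite -(mevalXU (fun=> 1) (inord 0 : 'I_6)) X0 meval0.
  by rewrite eqxx.
apply: mpoly_vanishing => v; rewrite mevalM mevalXU.
have [->|s0] := eqVneq (v (inord 0)) 0; first by rewrite mul0r.
suff -> : q.@[v] = 0 by rewrite mulr0.
transitivity (mmap (in_alg K^o) v q).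
  by apply: eq_bigr => m _; congr (_ * _); apply/esym/mulr1.
transitivity (mmap (in_alg K^o) (fun i => v (inord i)) q).
  by apply: eq_bigr => m _; congr (_ * _); apply: mmap1_eq => i; rewrite inord_val.
rewrite (hq K^o (fun k => v (inord k))); apply: van; first exact: chart_special.
apply/eqP => /matrixP /(_ (o 1) (o 5)); rewrite wedge_pp chart_pp mxE => /eqP.
by rewrite expf_eq0 (negbTE s0) andbF.
Qed.

End Cell.

Section Cone.
Variable K : numClosedFieldType.

Lemma wedgeZ (A : comNzRingType) n (c : A) (M : 'M[A]_(2, n)) : wedge (c *: M) = c ^+ 2 *: wedge M.
Proof. by apply/matrixP => i j; rewrite [RHS]mxE !wedgeE !mxE; ring. Qed.

Lemma wedge_mulmx (A : comNzRingType) n p (M : 'M[A]_(2, n)) (D : 'M[A]_(n, p)) :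
  wedge (M *m D) = D^T *m wedge M *m D.
Proof. by rewrite -wedgeM. Qed.

Lemma ord2P (P : 'I_2 -> Prop) : P 0 -> P 1 -> forall i, P i.
Proof.
move=> P0 P1 [[|[|//]] i]; [move: P0|move: P1]; congr P; exact/val_inj.
Qed.

Lemma mul_row2 (A : comNzRingType) n (T : 'M[A]_2) (M : 'M[A]_(2, n)) i j :
  (T *m M) i j = T i 0 * M 0 j + T i 1 * M 1 j.
Proof.
rewrite mxE !big_ord_recl big_ord0 addr0.
by have -> : lift ord0 ord0 = 1 :> 'I_2 by apply/val_inj.
Qed.

Lemma wedge_det (A : comNzRingType) n (T : 'M[A]_2) (M : 'M[A]_(2, n)) :
  wedge (T *m M) = (T 0 0 * T 1 1 - T 0 1 * T 1 0) *: wedge M.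
Proof. by apply/matrixP => i j; rewrite [RHS]mxE !wedgeE !mul_row2; ring. Qed.

Lemma special_mul (A : comNzRingType) (T : 'M[A]_2) (X : 'M[A]_(2, 7)) :
  special X -> special (T *m X).
Proof.
move=> [/special_elim[[r1 r2 r3] [r4 r5 r6] r7] n0 n1 b].
rewrite /N7 in n0 n1; rewrite /B7 in b.
have E i k : rowc (T *m X) i k = T i 0 * rowc X 0 k + T i 1 * rowc X 1 k by apply: mul_row2.
apply: special_intro; rewrite /N7 /B7 !E.
- by_comb (lc_mul (T 0 0 * T 1 1 - T 0 1 * T 1 0) r1).
- by_comb (lc_mul (T 0 0 * T 1 1 - T 0 1 * T 1 0) r2).
- by_comb (lc_mul (T 0 0 * T 1 1 - T 0 1 * T 1 0) r3).
- by_comb (lc_mul (T 0 0 * T 1 1 - T 0 1 * T 1 0) r4).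
- by_comb (lc_mul (T 0 0 * T 1 1 - T 0 1 * T 1 0) r5).
- by_comb (lc_mul (T 0 0 * T 1 1 - T 0 1 * T 1 0) r6).
- by_comb (lc_mul (T 0 0 * T 1 1 - T 0 1 * T 1 0) r7).
- by_comb (lc_add (lc_add (lc_mul (T 0 0 ^+ 2) n0) (lc_mul (T 0 1 ^+ 2) n1)) (lc_mul (T 0 0 * T 0 1) b)).
- by_comb (lc_add (lc_add (lc_mul (T 1 0 ^+ 2) n0) (lc_mul (T 1 1 ^+ 2) n1)) (lc_mul (T 1 0 * T 1 1) b)).
- by_comb (lc_add (lc_add (lc_mul (2 * T 0 0 * T 1 0) n0) (lc_mul (2 * T 0 1 * T 1 1) n1))
    (lc_mul (T 0 0 * T 1 1 + T 0 1 * T 1 0) b)).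
Qed.

(** The relations determine the dependent coordinates only after multiplication by powers of [s]. As
    [s] may be a zero divisor, these powers stay in the identity. *)
Lemma special_chart (A : comAlgType K) (X : 'M[A]_(2, 7)) (s : A) : special X ->
  rowc X 0 1%N = s -> rowc X 0 5%N = 0 -> rowc X 1 1%N = 0 -> rowc X 1 5%N = s ->
  exists t : nat -> A, t 0%N = s /\ s ^+ 2 *: X = s *: chart t.
Proof.
move=> [/special_elim[[r1 r2 r3] [r4 r5 r6] r7] n0 n1 b] x1 x5 y1 y5.
rewrite /N7 in n0 n1; rewrite ?x1 ?x5 ?y1 ?y5 in r1 r2 r3 r4 r5 r6 r7 n0 n1.
pose t := nth 0 [:: s; rowc X 0 0; rowc X 1 0; rowc X 0 2; rowc X 0 3; rowc X 1 6].
exists t; split=> //.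
suff H i k : (k < 7)%N -> s ^+ 2 * rowc X i k = s * rowc (chart t) i k.
  by apply/matrixP => i; elim/ord7P => k k7; rewrite !mxE; have := H i k k7; rewrite /rowc mxE => ->.
move=> k7; rewrite !rowc_mat27 //.
move: i k k7; elim/ord2P => -[|[|[|[|[|[|[|//]]]]]]] _ /=; rewrite /t /= ?x1 ?x5 ?y1 ?y5; try ring; to0.
- by_comb (lc_add (lc_mul s n0) (lc_mul (rowc X 0 3) r5)).
- by_comb (lc_mul (- s) r5).
- by_comb (lc_add (lc_mul s r1) (lc_mul (rowc X 1 0) r5)).
- by_comb (lc_mul (- s) r3).
- by_comb (lc_add (lc_mul s r7) (lc_add (lc_mul (- rowc X 1 3) r5) (lc_mul (rowc X 1 0) r3))).
Qed.


Lemma cell d (F : law K (7 * 7)) : poly_law d F -> vanishes_on_cone F ->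
  forall (A : comAlgType K) (X : 'M[A]_(2, 7)), special X ->
  nilkill (F A (mxvec (wedge X))) (pp X 1 5).
Proof.
move=> lawF van A X sX; have [homF _] := lawF.
set s := pp X 1 5.
(* The adjugate of the minor in columns 1 and 5: there [T *m X] is [s] times the identity. *)
pose T : 'M[A]_2 := \matrix_(i, j) nth 0 (nth [::] [:: [:: rowc X 1 5; - rowc X 0 5];
  [:: - rowc X 1 1; rowc X 0 1]] i) j.
have TE i k : rowc (T *m X) i k = T i 0 * rowc X 0 k + T i 1 * rowc X 1 k by apply: mul_row2.
have [||||t [_ tE]] := special_chart (s := s) (special_mul T sX); try by rewrite TE !mxE /= /s /pp; ring.
have dT : T 0 0 * T 1 1 - T 0 1 * T 1 0 = s by rewrite !mxE /= /s /pp; ring.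
(* The wedge of s^2 T X = s chart has the factor s^4 s on the left, since T has determinant s; this
   gives the exponent 5 for each degree. *)
exists (5 * d)%N; rewrite exprM -homF.
have -> : s ^+ 5 *: mxvec (wedge X) = s ^+ 2 *: mxvec (wedge (chart t)).
  rewrite -!linearZ /=; congr mxvec; rewrite -wedgeZ -tE wedgeZ wedge_det dT scalerA.
  by congr (_ *: _); ring.
by rewrite homF (chart_vanishes lawF van) mulr0.
Qed.

Definition good (g : 'M[K]_7) : Prop :=
  [/\ preserves_special g, exists2 g', g *m g' = 1%:M & preserves_special g' & isG2 g].

Lemma goodM g h : good g -> good h -> good (g *m h).
Proof.
move=> [Pg [g' gg' Pg'] Gg] [Ph [h' hh' Ph'] Gh]; split; [exact: preserves_specialM| |exact: isG2M].
exists (h' *m g'); last exact: preserves_specialM.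
by rewrite mulmxA -(mulmxA g) hh' mulmx1.
Qed.

Lemma good1 : good 1%:M.
Proof.
have P1 : preserves_special (1%:M : 'M[K]_7) by move=> A X; rewrite map_mx1 mulmx1.
by split=> //; [exists 1%:M; rewrite ?mulmx1|apply: isG21].
Qed.

Lemma good_gU t : good (gU t).
Proof. by split; [|exists (gU (- t)); [apply: gU_inv|]|apply: isG2_gU]; apply: gU_special. Qed.

Lemma good_gL t : good (gL t).
Proof. by split; [|exists (gL (- t)); [apply: gL_inv|]|apply: isG2_gL]; apply: gL_special. Qed.

Lemma good_gC : good gC.
Proof.
split; [exact: gC_special| |exact: isG2_gC].
exists (gC *m gC); first exact: gC_inv.
by apply: preserves_specialM; apply: gC_special.
Qed.

Lemma good_gW : good gW.
Proof. by split; [|exists gW; [apply: gW_inv|]|apply: isG2_gW]; apply: gW_special. Qed.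

End Cone.

Section Span.
Variable K : numClosedFieldType.

Lemma nilkill_nat (A : comAlgType K) (z a : A) n : nilkill z (n.+1%:R * a) -> nilkill z a.
Proof.
move=> /(nilkillM (n.+1%:R^-1 : K)%:A); rewrite mulrA -(rmorph_nat (in_alg A)) -in_algE -rmorphM.
by rewrite mulVf ?pnatr_eq0 // rmorph1 mul1r.
Qed.

Lemma vanishes_conj (F : law K (7 * 7)) (g : 'M[K]_7) : vanishes_on_cone F -> good g ->
  exists2 h, g *m h = 1%:M & vanishes_on_cone (law_comp (conjm h) F).
Proof.
move=> van [Pg [h gh Ph] _]; exists h => // X sX wX.
rewrite /law_comp map_conjm mul_conjm -wedge_mulmx; apply: van; first exact: Ph.
have hg := mulmx1C gh; apply: contra_neq wX => w0.
have -> : X = X *m map_mx (in_alg K^o) h *m map_mx (in_alg K^o) g.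
  by rewrite -mulmxA -map_mxM hg map_mx1 mulmx1.
by rewrite wedge_mulmx w0 mulmx0 mul0mx.
Qed.

Lemma nilkill_good d (F : law K (7 * 7)) (A : comAlgType K) (X : 'M[A]_(2, 7)) g :
  poly_law d F -> vanishes_on_cone F -> special X -> good g ->
  nilkill (F A (mxvec (wedge X))) (pp (X *m map_mx (in_alg A) g) 1 5).
Proof.
move=> lawF van sX gg; have [h gh vanh] := vanishes_conj van gg.
have := cell (law_compP (conjm h) lawF) vanh (let: And3 Pg _ _ := gg in Pg _ _ sX).
rewrite /law_comp map_conjm mul_conjm -wedge_mulmx -mulmxA -map_mxM gh.
by rewrite map_mx1 mulmx1.
Qed.

Lemma nilkill_eq (A : comNzRingType) (z a b : A) : nilkill z a -> a = b -> nilkill z b.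
Proof. by move=> H <-. Qed.

Section Fixed.
Variables (A : comAlgType K) (z : A).

Definition on_orbit (X : 'M[A]_(2, 7)) (P : 'M[A]_(2, 7) -> Prop) :=
  forall g, good g -> P (X *m map_mx (in_alg A) g).

Lemma on_orbit_mul X P h : good h -> on_orbit X P -> on_orbit X (fun Y => P (Y *m map_mx (in_alg A) h)).
Proof. by move=> gh H g gg; rewrite -mulmxA -map_mxM; apply: H; apply: goodM. Qed.

Variable X : 'M[A]_(2, 7).
Hypothesis sX : special X.
Hypothesis H15 : on_orbit X (fun Y => nilkill z (pp Y 1 5)).

Let gC' := map_mx (in_alg A) (gC (K := K)).

Lemma ppC Y : (pp (Y *m gC') 1 5 = pp Y 3 4) * (pp (Y *m gC') 3 4 = pp Y 2 6) *
  (pp (Y *m gC') 4 2 = pp Y 6 1) * (pp (Y *m gC') 6 1 = pp Y 5 3) *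
  (pp (Y *m gC') 3 0 = pp Y 2 0) * (pp (Y *m gC') 2 0 = pp Y 1 0) *
  (pp (Y *m gC') 5 0 = pp Y 4 0) * (pp (Y *m gC') 4 0 = pp Y 6 0) *
  (pp (Y *m gC') 1 4 = pp Y 3 6) * (pp (Y *m gC') 2 5 = pp Y 1 4).
Proof. by rewrite /pp /gC' !gCE. Qed.

Lemma on_orbitC P Q : on_orbit X P -> (forall Y, P (Y *m gC') -> Q Y) -> on_orbit X Q.
Proof. by move=> HP PQ g gg; apply: PQ; exact: (on_orbit_mul (good_gC K) HP). Qed.

(** The coordinates 15, 34, 26, 42, 61, 53 are those at the six long roots, permuted transitively by
    [gC] and [gW]. *)
Lemma H34 : on_orbit X (fun Y => nilkill z (pp Y 3 4)).
Proof. by apply: on_orbitC H15 _ => Y; rewrite ppC. Qed.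
Lemma H26 : on_orbit X (fun Y => nilkill z (pp Y 2 6)).
Proof. by apply: on_orbitC H34 _ => Y; rewrite ppC. Qed.
Lemma H42 : on_orbit X (fun Y => nilkill z (pp Y 4 2)).
Proof.
move=> g gg; have := on_orbit_mul (good_gW K) H15 gg.
by rewrite {1}/pp !gWE.
Qed.
Lemma H61 : on_orbit X (fun Y => nilkill z (pp Y 6 1)).
Proof. by apply: on_orbitC H42 _ => Y; rewrite ppC. Qed.
Lemma H53 : on_orbit X (fun Y => nilkill z (pp Y 5 3)).
Proof. by apply: on_orbitC H61 _ => Y; rewrite ppC. Qed.

Lemma orbit_special : on_orbit X (fun Y => special Y).
Proof. by move=> g [Pg _ _]; apply: Pg. Qed.

(** The string of the short root of [gU] through 34 has length four: long roots at the ends 34 and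
    51, short roots at 30 and 50. *)
Lemma ppU t Y : special Y -> pp (Y *m map_mx (in_alg A) (gU t)) 3 4 =
  pp Y 3 4 + 3 * t%:A * pp Y 3 0 - 3 * t%:A ^+ 2 * pp Y 5 0 - t%:A ^+ 3 * pp Y 5 1.
Proof.
move=> [/special_elim[[_ _ r3] [r4 _ _] _] _ _ _]; rewrite /pp !gUE; to0.
by_comb (lc_add (lc_mul (t%:A) r4) (lc_mul (t%:A ^+ 2) r3)).
Qed.

Lemma H30_50 : on_orbit X (fun Y => nilkill z (pp Y 3 0) /\ nilkill z (pp Y 5 0)).
Proof.
move=> g gg; set Y := _ *m _; have sY : special Y := orbit_special gg.
have n1 := on_orbit_mul (good_gU 1) H34 gg; have n2 := on_orbit_mul (good_gU (-1)) H34 gg.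
move: n1 n2; rewrite -/Y !ppU // !(alg_scalars A) => n1 n2.
have n51 : nilkill z (pp Y 5 1).
  by apply: nilkill_eq (nilkillN (H15 gg)) _; rewrite -/Y /pp; ring.
have n34 : nilkill z (pp Y 3 4) := H34 gg.
(* The values at [t = 1] and [t = -1] separate the odd and even coefficients; 5 stands for the
   factor 6, [nilkill_nat] being stated for a successor. *)
split; apply: (@nilkill_nat _ _ _ 5).
  by apply: nilkill_eq (nilkillD (nilkillD n1 (nilkillN n2)) (nilkillM 2 n51)) _; ring.
by apply: nilkill_eq (nilkillD (nilkillN (nilkillD n1 n2)) (nilkillM 2 n34)) _; ring.
Qed.

Lemma H30 : on_orbit X (fun Y => nilkill z (pp Y 3 0)).
Proof. by move=> g gg; case: (H30_50 gg). Qed.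
Lemma H50 : on_orbit X (fun Y => nilkill z (pp Y 5 0)).
Proof. by move=> g gg; case: (H30_50 gg). Qed.
Lemma H20 : on_orbit X (fun Y => nilkill z (pp Y 2 0)).
Proof. by apply: on_orbitC H30 _ => Y; rewrite ppC. Qed.
Lemma H10 : on_orbit X (fun Y => nilkill z (pp Y 1 0)).
Proof. by apply: on_orbitC H20 _ => Y; rewrite ppC. Qed.
Lemma H40 : on_orbit X (fun Y => nilkill z (pp Y 4 0)).
Proof. by apply: on_orbitC H50 _ => Y; rewrite ppC. Qed.
Lemma H60 : on_orbit X (fun Y => nilkill z (pp Y 6 0)).
Proof. by apply: on_orbitC H40 _ => Y; rewrite ppC. Qed.

(** A long root element moves 42 to 15 across the zero weight space, and the term linear in its
    parameter is this difference up to sign. *)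
Lemma Hcartan : on_orbit X (fun Y => nilkill z (pp Y 1 4 - pp Y 2 5)).
Proof.
move=> g gg; set Y := _ *m _.
have n24 := on_orbit_mul (good_gL 1) H42 gg; rewrite -/Y in n24.
apply: nilkill_eq (nilkillD (nilkillN n24) (nilkillD (H42 gg) (H15 gg))) _.
by rewrite -/Y /pp !gLE !(alg_scalars A); ring.
Qed.

(** Two differences of 14, 25, 36 and the vanishing of their sum give 3 times the first. *)
Lemma H14 : on_orbit X (fun Y => nilkill z (pp Y 1 4)).
Proof.
move=> g gg; set Y := _ *m _.
have c2 := on_orbit_mul (good_gC K) Hcartan gg; rewrite -/Y -/gC' !ppC in c2.
apply: (@nilkill_nat _ _ _ 2).
have [/special_elim[_ _ r7] _ _ _] : special Y := orbit_special gg.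
apply: nilkill_eq (nilkillD (Hcartan gg) (nilkillN c2)) _; rewrite -/Y; to0; rewrite /pp.
by_comb (lc_opp r7).
Qed.
Lemma H36 : on_orbit X (fun Y => nilkill z (pp Y 3 6)).
Proof. by apply: on_orbitC H14 _ => Y; rewrite ppC. Qed.
Lemma H25 : on_orbit X (fun Y => nilkill z (pp Y 2 5)).
Proof.
by move=> g gg; apply: nilkill_eq (nilkillD (H14 gg) (nilkillN (Hcartan gg))) _; ring.
Qed.

(** The coordinates not yet reached equal those at short roots up to sign, by the binomial relations
    of [lin7]. *)
Lemma nilkill_pp i j : (i < 7)%N -> (j < 7)%N -> nilkill z (pp X i j).
Proof.
have [/special_elim[[r1 r2 r3] [r4 r5 r6] r7] _ _ _] := sX.
have E P : on_orbit X P -> P X by move=> /(_ _ (good1 K)); rewrite map_mx1 mulmx1.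
have S k l : nilkill z (pp X k l) -> nilkill z (pp X l k).
  by move=> H; apply: nilkill_eq (nilkillN H) _; rewrite /pp; ring.
have D k : nilkill z (pp X k k).
  by apply: nilkill_eq (nilkill0 z) _; rewrite /pp; ring.
have h15 := E _ H15; have h34 := E _ H34; have h26 := E _ H26; have h42 := E _ H42.
have h61 := E _ H61; have h53 := E _ H53; have h14 := E _ H14; have h25 := E _ H25.
have h36 := E _ H36; have h10 := E _ H10; have h20 := E _ H20; have h30 := E _ H30.
have h40 := E _ H40; have h50 := E _ H50; have h60 := E _ H60.
have h12 : nilkill z (pp X 1 2).
  by apply: nilkill_eq (S _ _ h60) _; apply/esym; to0; apply: (etrans _ r1); rewrite /pp; ring.
have h23 : nilkill z (pp X 2 3).
  by apply: nilkill_eq (S _ _ h40) _; apply/esym; to0; apply: (etrans _ r2); rewrite /pp; ring.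
have h31 : nilkill z (pp X 3 1).
  by apply: nilkill_eq (S _ _ h50) _; apply/esym; to0; apply: (etrans _ r3); rewrite /pp; ring.
have h45 : nilkill z (pp X 4 5).
  by apply: nilkill_eq (h30) _; apply/esym; to0; apply: (etrans _ r4); rewrite /pp; ring.
have h56 : nilkill z (pp X 5 6).
  by apply: nilkill_eq (h10) _; apply/esym; to0; apply: (etrans _ r5); rewrite /pp; ring.
have h64 : nilkill z (pp X 6 4).
  by apply: nilkill_eq (h20) _; apply/esym; to0; apply: (etrans _ r6); rewrite /pp; ring.
by case: i => [|[|[|[|[|[|[|//]]]]]]] _; case: j => [|[|[|[|[|[|[|//]]]]]]] _; first [exact: D|assumption|apply: S; assumption].
Qed.

End Fixed.

Theorem nilkill_wedge d (F : law K (7 * 7)) (A : comAlgType K) (X : 'M[A]_(2, 7)) i j :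
  poly_law d F -> vanishes_on_cone F -> special X ->
  nilkill (F A (mxvec (wedge X))) (wedge X i j).
Proof.
move=> lawF van sX; move: i j; elim/ord7P => i i7; elim/ord7P => j j7.
rewrite wedge_pp; apply: nilkill_pp => // g gg.
exact: (nilkill_good lawF van sX gg).
Qed.

End Span.

(** * The zero scheme through split pairs *)

Section SplitPairs.
Variable A : comNzRingType.
Implicit Types X : 'M[A]_(2, 7).

(** Cauchy-Binet: the Plücker coordinates of a frame generate the unit ideal. *)
Lemma wedge_unit n (M : 'M[A]_(2, n)) (N : 'M[A]_(n, 2)) : M *m N = 1%:M ->
  \sum_k \sum_l wedge M k l * (N k 0 * N l 1) = 1.
Proof.
move=> MN; have E i j : (M *m N) i j = (i == j)%:R by rewrite MN mxE.
transitivity ((M *m N) 0 0 * (M *m N) 1 1 - (M *m N) 1 0 * (M *m N) 0 1); last first.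
  by rewrite !E /= mulr0 subr0 mulr1.
rewrite !mxE !mulr_suml -sumrB; apply: eq_bigr => k _.
rewrite !mulr_sumr -sumrB; apply: eq_bigr => l _.
by rewrite wedgeE; ring.
Qed.

Lemma split_pair_kill X (X' : 'M[A]_(2, 7)) i j : split_pair X X' -> wedge X i j *: X' = 0.
Proof.
move=> [_ _ mix _]; apply/matrixP => a k; rewrite [LHS]mxE [RHS]mxE wedgeE; move: a; elim/ord2P.
  transitivity (X 1 j * X' 0 k * X 0 i - X 1 i * X' 0 k * X 0 j); first by ring.
  by rewrite -!mix; ring.
transitivity (X 0 i * X' 1 k * X 1 j - X 0 j * X' 1 k * X 1 i); first by ring.
by rewrite !mix; ring.
Qed.

Lemma split_pairC X (X' : 'M[A]_(2, 7)) : split_pair X X' -> split_pair X' X.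
Proof.
move=> [l l' mix [n0 n1 b]]; split=> // i j.
by rewrite mulrC -mix mulrC.
Qed.

Lemma wedge_split n (D1 D2 : 'M[A]_(7, n)) X (X' : 'M[A]_(2, 7)) : split_pair X X' ->
  wedge (X *m D1 + X' *m D2) = wedge (X *m D1) + wedge (X' *m D2).
Proof.
move=> [_ _ mix _].
have mixD i j : (X *m D1) 0 i * (X' *m D2) 1 j = (X *m D1) 1 i * (X' *m D2) 0 j.
  rewrite !mxE !mulr_suml; apply: eq_bigr => k _; rewrite !mulr_sumr; apply: eq_bigr => l _.
  by rewrite mulrACA mix mulrACA.
apply/matrixP => i j; rewrite [RHS]mxE !wedgeE.
rewrite ![(X *m D1 + X' *m D2) _ _]mxE.
move: (mixD i j) (mixD j i) => h1 h2; to0.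
by_comb (lc_add (eq_sub0 h1) (lc_opp (eq_sub0 h2))).
Qed.

End SplitPairs.

Section Locus.
Variables (K : numClosedFieldType) (psi : spinor K).
Variables (D1 D2 : 'M[K]_(7, 7 + 7)) (E1 E2 : 'M[K]_(7 + 7, 7)).
Hypothesis dec : decomposes psi D1 D2 E1 E2.

Lemma bcK : bc K^o psi = psi.
Proof. by apply/ffunP => I; rewrite ffunE; apply: mulr1. Qed.

Lemma resolution : E1 *m D1 + E2 *m D2 = 1%:M.
Proof.
have [[h11 h22 h12 h21] _ _] := dec.
have : col_mx D1 D2 *m row_mx E1 E2 = 1%:M.
  by rewrite mul_col_row h11 h22 h12 h21 -scalar_mx_block.
by move/mulmx1C; rewrite mul_row_col.
Qed.

Lemma reconstruct (A : comAlgType K) (M : 'M[A]_(2, 7 + 7)) :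
  M = M *m map_mx (in_alg A) E1 *m map_mx (in_alg A) D1 +
      M *m map_mx (in_alg A) E2 *m map_mx (in_alg A) D2.
Proof.
by rewrite -!mulmxA -!map_mxM -mulmxDr -map_mxD resolution map_mx1 mulmx1.
Qed.

(** Isotropy only equates the quadratic forms of [X] and [X']; multiplied by c^2, those of [X']
    become the forms of [c *: X'], which is 0. *)
Lemma special_scale (A : comAlgType K) (X X' : 'M[A]_(2, 7)) c :
  split_pair X X' -> c *: X' = 0 -> special (c *: X).
Proof.
move=> [lin _ _ [n0 n1 b]] cX.
have [[r1 r2 r3] [r4 r5 r6] r7] := special_elim lin.
have E i k : rowc (c *: X) i k = c * rowc X i k by rewrite /rowc mxE.
have E' i k : c * rowc X' i k = 0 by have /matrixP/(_ i (o k)) := cX; rewrite !mxE.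
have N0 i : c ^+ 2 * N7 (rowc X' i) = 0.
  transitivity (N7 (fun k => c * rowc X' i k)); first by rewrite /N7; ring.
  by rewrite /N7 !E'; ring.
have B0 : c ^+ 2 * B7 (rowc X' 0) (rowc X' 1) = 0.
  transitivity (B7 (fun k => c * rowc X' 0 k) (fun k => c * rowc X' 1 k)); first by rewrite /B7; ring.
  by rewrite /B7 !E'; ring.
apply: special_intro; rewrite ?E.
- by_comb (lc_mul (c ^+ 2) r1).
- by_comb (lc_mul (c ^+ 2) r2).
- by_comb (lc_mul (c ^+ 2) r3).
- by_comb (lc_mul (c ^+ 2) r4).
- by_comb (lc_mul (c ^+ 2) r5).
- by_comb (lc_mul (c ^+ 2) r6).
- by_comb (lc_mul (c ^+ 2) r7).
- by rewrite -(N0 0) -n0 /N7 !E; ring.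
- by rewrite -(N0 1) -n1 /N7 !E; ring.
- by rewrite -B0 -b /B7 !E; ring.
Qed.

Definition component (D : 'M[K]_(7, 7 + 7)) (p : 'rV[K]_((7 + 7) * (7 + 7))) : Prop :=
  exists X : 'M[K]_(2, 7), [/\ special X, wedge X != 0 & p = mxvec (wedge (X *m D))].

Lemma wedge_neq0 n (X : 'M[K]_(2, n)) : wedge X != 0 -> exists i j, wedge X i j != 0.
Proof.
move=> w0; have /existsP[i /existsP[j w]] : [exists i, exists j, wedge X i j != 0].
  apply: contraNT w0 => /existsPn H; apply/eqP/matrixP => i j; rewrite [RHS]mxE.
  by have /existsPn/(_ j) := H i; rewrite negbK => /eqP.
by exists i, j.
Qed.

Lemma wedge_frame n (X : 'M[K]_(2, n)) : wedge X != 0 -> exists N, X *m N = 1%:M.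
Proof.
case/wedge_neq0 => i [j wij].
(* Cramer's rule: the adjugate of the minor in columns [i] and [j], divided by its determinant. *)
exists ((wedge X i j)^-1 *: \matrix_(k, a) ((k == i)%:R * (if a == 0 then X 1 j else - X 0 j)
   + (k == j)%:R * (if a == 0 then - X 1 i else X 0 i))).
have S (Y : 'I_n -> K) a b : \sum_k Y k * ((k == i)%:R * a + (k == j)%:R * b) = Y i * a + Y j * b.
  under eq_bigr do rewrite mulrDr; rewrite big_split /= (bigD1 i) //= [X in _ + X](bigD1 j) //=.
  rewrite !eqxx !mul1r big1 ?addr0 => [|k /negbTE ->]; last by rewrite mul0r mulr0.
  by rewrite big1 ?addr0 // => k /negbTE ->; rewrite mul0r mulr0.
apply/matrixP => a b; rewrite -scalemxAr [LHS]mxE [RHS]mxE; apply: (mulfI wij).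
rewrite mulrA divff // mul1r wedgeE mxE; under eq_bigr do rewrite mxE.
rewrite S.
move: a b; elim/ord2P; elim/ord2P => /=. 
all: ring.
Qed.

Lemma zero_locus_iff p : zero_locus psi p <-> component D1 p \/ component D2 p.
Proof.
have [[h11 h22 h12 h21] dfr con] := dec.
have mK m n (D : 'M[K]_(m, n)) : map_mx (in_alg K^o) D = D := regularE D.
split=> [[M [zM ->]]|].
  have := dfr K^o M; rewrite bcK !mK => /(_ zM) [[N MN] S].
  have EM := reconstruct (A := K^o) M; rewrite !mK in EM.
  move: (M *m E1) (M *m E2) S EM => X X' S EM.
  have sc (Y Y' : 'M[K^o]_(2, 7)) : split_pair Y Y' -> wedge Y != 0 -> Y' = 0 /\ special Y.
    move=> SY wY.
    have [i [j wij]] := wedge_neq0 wY.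
    have Y0 : Y' = 0.
      have /eqP := split_pair_kill i j SY; rewrite scaler_eq0 (negbTE wij) => /eqP //.
    split=> //; have := special_scale (c := 1) SY; rewrite !scale1r; apply.
    exact: Y0.
  have [wX|wX] := eqVneq (wedge X) 0; last first.
    left; have [X'0 sX] := sc _ _ S wX; exists X; split=> //.
    by rewrite plucker_wedge {1}EM X'0 mul0mx addr0.
  have [wX'|wX'] := eqVneq (wedge X') 0; last first.
    right; have [X0 sX] := sc _ _ (split_pairC S) wX'; exists X'; split=> //.
    by rewrite plucker_wedge {1}EM X0 mul0mx add0r.
  have wM : wedge M = 0.
    by rewrite EM (wedge_split D1 D2 S) !wedge_mulmx wX wX' !mulmx0 !mul0mx addr0.
  have := wedge_unit MN; rewrite wM big1 => [/esym/eqP|k _]; first by rewrite oner_eq0.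
  by rewrite big1 // => l _; rewrite mxE mul0r.
move=> [] [X [sX w0 ->]]; have := con K^o X sX (wedge_frame w0); rewrite bcK !mK => -[z1 z2].
  by exists (X *m D1); rewrite plucker_wedge.
by exists (X *m D2); rewrite plucker_wedge.
Qed.

Lemma mpoly_lawK n (P : {mpoly K[n]}) (v : 'rV[K^o]_n) : mpoly_law P v = peval P v.
Proof.
rewrite mpoly_lawE /peval /meval (mmapE (msize P)) //; apply: eq_bigr => m _.
by congr (_ * _); apply: mulr1.
Qed.

Lemma reduced_aux (A : comAlgType K) (M : 'M[A]_(2, 7 + 7)) (X X' : 'M[A]_(2, 7))
    (D D' : 'M[K]_(7, 7 + 7)) d (P : {mpoly K[(7 + 7) * (7 + 7)]}) i j :
  M = X *m map_mx (in_alg A) D + X' *m map_mx (in_alg A) D' -> split_pair X X' ->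
  P \is d.-homog -> (forall p, component D p -> peval P p = 0) ->
  nilkill (mpoly_law P (mxvec (wedge M))) (wedge X i j).
Proof.
move=> EM S hP van; set c := wedge X i j; set z := mpoly_law P _.
have lawP := mpoly_lawP hP.
have cX' : c *: X' = 0 by apply: split_pair_kill.
have sX : special (c *: X) by apply: special_scale S cX'.
have vanF : vanishes_on_cone (law_comp (conjm D) (mpoly_law P)).
  move=> Y sY wY; rewrite /law_comp map_conjm mul_conjm mpoly_lawK -wedge_mulmx regularE.
  by apply: van; exists Y.
have [N] := nilkill_wedge i j (law_compP (conjm D) lawP) vanF sX.
have -> : law_comp (conjm D) (mpoly_law P) (mxvec (wedge (c *: X))) = (c ^+ 2) ^+ d * z.
  rewrite /law_comp map_conjm mul_conjm -wedge_mulmx -(lawP.1) -linearZ -wedgeZ.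
  by rewrite EM scalerDr !scalemxAl cX' mul0mx addr0.
(* The coordinate of [c *: X] is c^3, which gives [3 * N]; homogeneity of [P] under c^2 gives
   [2 * d]. *)
rewrite wedgeZ mxE -/c => H; exists (3 * N + 2 * d)%N.
by rewrite -H exprD -mulrA !exprM -exprSr.
Qed.

Lemma reduced : zero_scheme_reduced psi.
Proof.
have [_ dfr _] := dec.
move=> A M zM d P hP van.
have [[N MN] S] := dfr A M zM.
have EM := reconstruct M.
move: (M *m map_mx _ E1) (M *m map_mx _ E2) S EM => X X' S EM.
suff n1 : nilkill (mpoly_law P (mxvec (wedge M))) 1.
  by have := nilkill1 n1; rewrite /mpoly_law -plucker_wedge.
have van1 p : component D1 p -> peval P p = 0 by move=> h; apply: van; apply/zero_locus_iff; left.
have van2 p : component D2 p -> peval P p = 0 by move=> h; apply: van; apply/zero_locus_iff; right.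
have k1 i j := reduced_aux i j EM S hP van1.
have EM' := EM; rewrite addrC in EM'.
have k2 i j := reduced_aux i j EM' (split_pairC S) hP van2.
rewrite -(wedge_unit MN); apply: nilkill_sum => k; apply: nilkill_sum => l.
rewrite mulrC; apply: nilkillM.
rewrite {2}EM (wedge_split _ _ S) !wedge_mulmx mxE; apply: nilkillD.
  rewrite mxE; apply: nilkill_sum => b; rewrite mulrC; apply: nilkillM.
  by rewrite mxE; apply: nilkill_sum => a; apply: nilkillM; exact: k1.
rewrite mxE; apply: nilkill_sum => b; rewrite mulrC; apply: nilkillM.
by rewrite mxE; apply: nilkill_sum => a; apply: nilkillM.
Qed.

End Locus.

(** * Closed sets and the adjoint variety *)

Section HomogeneousFunctions.
Variables (K : fieldType) (n : nat).

(** Functions instead of polynomials, so that the equations of a closed set can be written as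
    expressions in the coordinates. *)
Definition homfun d (f : 'rV[K]_n -> K) : Prop :=
  exists P : {mpoly K[n]}, P \is d.-homog /\ forall x, peval P x = f x.

Lemma homfun_coord i : homfun 1 (fun x => x 0 i).
Proof. by exists 'X_i; split=> [|x]; rewrite ?dhomogX /= ?mdeg1 // /peval mevalXU. Qed.

Lemma homfun0 d : homfun d (fun=> 0).
Proof. by exists 0; split=> [|x]; [apply: dhomog0|rewrite /peval meval0]. Qed.

Lemma homfunD d f g : homfun d f -> homfun d g -> homfun d (fun x => f x + g x).
Proof.
move=> [P [hP EP]] [Q [hQ EQ]]; exists (P + Q); split=> [|x]; first exact: dhomogD.
by rewrite -EP -EQ /peval mevalD.
Qed.

Lemma homfunZ d c f : homfun d f -> homfun d (fun x => c * f x).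
Proof.
move=> [P [hP EP]]; exists (c *: P); split=> [|x]; first exact: dhomogZ.
by rewrite -EP /peval mevalZ.
Qed.

Lemma homfunM d e f g : homfun d f -> homfun e g -> homfun (d + e) (fun x => f x * g x).
Proof.
move=> [P [hP EP]] [Q [hQ EQ]]; exists (P * Q); split=> [|x]; first exact: dhomogM.
by rewrite -EP -EQ /peval mevalM.
Qed.

Lemma eq_homfun d f g : homfun d f -> f =1 g -> homfun d g.
Proof. by move=> [P [hP EP]] fg; exists P; split=> // x; rewrite EP. Qed.

Lemma homfunB d f g : homfun d f -> homfun d g -> homfun d (fun x => f x - g x).
Proof.
move=> hf hg; apply: eq_homfun (homfunD hf (homfunZ (-1) hg)) _ => x.
by rewrite mulN1r.
Qed.

Lemma homfun_sum d (I : Type) (r : seq I) (F : I -> 'rV[K]_n -> K) :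
  (forall i, homfun d (F i)) -> homfun d (fun x => \sum_(i <- r) F i x).
Proof.
move=> H; elim: r => [|i r IH].
  by apply: eq_homfun (homfun0 d) _ => x; rewrite big_nil.
by apply: eq_homfun (homfunD (H i) IH) _ => x; rewrite big_cons.
Qed.

Lemma homfunX e f k : homfun e f -> homfun (k * e) (fun x => f x ^+ k).
Proof.
move=> hf; elim: k => [|k IH]; first by exists 1; split=> [|x]; [apply: dhomog1|rewrite /peval meval1].
by apply: eq_homfun (homfunM hf IH) _ => x; rewrite exprS.
Qed.

End HomogeneousFunctions.

Section ClosedSets.
Variable K : fieldType.

Lemma homfun_linear m n (L : 'M[K]_(m, n)) k : homfun 1 (fun x => (x *m L) 0 k).
Proof.
have H i : homfun 1 (fun x : 'rV[K]_m => L i k * x 0 i) := homfunZ _ (homfun_coord K i).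
apply: eq_homfun (homfun_sum (index_enum _) H) _ => x.
by rewrite mxE; apply: eq_bigr => i _; rewrite mulrC.
Qed.

Lemma homfun_comp m n (L : 'M[K]_(m, n)) d f : homfun d f -> homfun d (fun x => f (x *m L)).
Proof.
move=> [P [hP EP]].
have mono (s : seq 'I_n) (k : 'X_{1..n}) :
    homfun (\sum_(i <- s) k i)%N (fun x => \prod_(i <- s) (x *m L) 0 i ^+ k i).
  elim: s => [|i s IH].
    rewrite big_nil; exists 1; split=> [|x]; first exact: dhomog1.
    by rewrite /peval meval1 big_nil.
  rewrite big_cons; apply: eq_homfun (homfunM _ IH) _ => [|x]; last by rewrite big_cons.
  by rewrite -[X in homfun X]muln1; apply/homfunX/homfun_linear.
have term (k : 'X_{1..n}) : homfun d (fun x => P@_k * \prod_i (x *m L) 0 i ^+ k i).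
  have [kd|kd] := eqVneq (mdeg k) d.
    by apply: homfunZ; have := mono (index_enum _) k; rewrite -mdegE kd.
  by apply: eq_homfun (homfun0 K m d) _ => x; rewrite (dhomog_nemf_coeff hP kd) mul0r.
apply: eq_homfun (homfun_sum (msupp P) term) _ => x.
by rewrite -EP /peval /meval /mmap; apply: eq_bigr => k _.
Qed.

Lemma zariski_closedI n (X : 'rV[K]_n -> Prop) : (forall x, X x -> x != 0) ->
  (forall x, x != 0 ->
     (forall d f, homfun d f -> (forall y, X y -> f y = 0) -> f x = 0) -> X x) ->
  zariski_closed X.
Proof.
move=> X0 H; exists (fun P => (exists d, P \is d.-homog) /\ forall y, X y -> peval P y = 0).
split=> [P []//|x]; split=> [Xx|[x0 Sx]].
  by split=> [|P [_ PX]]; [apply: X0|apply: PX].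
apply: H => // d f [P [hP EP]] fX; rewrite -EP; apply: Sx; split; first by exists d.
by move=> y Xy; rewrite EP; apply: fX.
Qed.

Definition image m n (X : 'rV[K]_m -> Prop) (L : 'M[K]_(m, n)) (y : 'rV[K]_n) : Prop :=
  exists2 x, X x & y = x *m L.

(** [y = y *m L' *m L] is a system of linear equations for the image of [L]; the others are those of
    [X] pulled back along [L']. *)
Lemma zariski_closed_image m n (X : 'rV[K]_m -> Prop) (L : 'M[K]_(m, n)) L' :
  L *m L' = 1%:M -> zariski_closed X -> zariski_closed (image X L).
Proof.
move=> LL' [S [hS XS]].
have xK x : x *m L *m L' = x by rewrite -mulmxA LL' mulmx1.
apply: zariski_closedI => [_ [x /XS[x0 _] ->]|y y0 H].
  by apply: contra_neq x0 => x0; rewrite -[x]xK x0 mul0mx.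
have yE : y = y *m L' *m L.
  apply/rowP => k; apply/eqP; rewrite -subr_eq0; apply/eqP.
  apply: (H 1%N (fun z => z 0 k - (z *m L' *m L) 0 k)) => [|_ [x _ ->]]; last by rewrite xK subrr.
  apply: homfunB; first exact: homfun_coord.
  by apply: (homfun_comp L' (f := fun x => (x *m L) 0 k)); apply: homfun_linear.
exists (y *m L') => //; apply/XS; split.
  by apply: contra_neq y0 => y0; rewrite yE y0 mul0mx.
move=> P SP; have [d hP] := hS P SP.
apply: (H d (fun z => peval P (z *m L'))) => [|_ [x /XS[_ Px] ->]]; last by rewrite xK Px.
by apply: (homfun_comp L' (f := peval P)); exists P.
Qed.

Lemma regular_linear m n (X : 'rV[K]_m -> Prop) (Y : 'rV[K]_n -> Prop) (L : 'M[K]_(m, n)) :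
  (forall x, X x -> Y (x *m L)) -> (forall y, Y y -> y != 0) -> regular_map X Y (mulmx^~ L).
Proof.
move=> XY Y0; split=> // x Xx; exists 1%N.
exists (fun k => \sum_i L i k *: 'X_i).
have E y : \row_k peval (\sum_i L i k *: 'X_i) y = y *m L.
  apply/rowP => k; rewrite !mxE /peval raddf_sum; apply: eq_bigr => i _.
  by rewrite /= mevalZ mevalXU mulrC.
split=> [k||y _ _]; first by apply: rpred_sum => i _; apply: dhomogZ; rewrite dhomogX /= mdeg1.
  by rewrite E; apply/Y0/XY.
by rewrite E; exists 1; rewrite oner_neq0 scale1r.
Qed.

Lemma isomorphic_images m n p (X : 'rV[K]_m -> Prop) (L : 'M[K]_(m, n)) L'
    (R : 'M[K]_(m, p)) R' : L *m L' = 1%:M -> R *m R' = 1%:M ->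
  (forall x, X x -> x != 0) -> isomorphic (image X L) (image X R).
Proof.
move=> LL RR X0.
have LK x : x *m L *m L' = x by rewrite -mulmxA LL mulmx1.
have RK x : x *m R *m R' = x by rewrite -mulmxA RR mulmx1.
have same q (x : 'rV[K]_q) : same_point x x by exists 1; rewrite oner_neq0 scale1r.
have nz q (M : 'M[K]_(m, q)) M' : M *m M' = 1%:M -> forall y, image X M y -> y != 0.
  move=> MM _ [x /X0 x0 ->]; apply: contra_neq x0 => x0.
  by rewrite -[x]mulmx1 -MM mulmxA x0 mul0mx.
exists (mulmx^~ (L' *m R)), (mulmx^~ (R' *m L)); split.
- by apply: regular_linear (nz _ _ _ RR) => _ [x Xx ->]; exists x => //; rewrite mulmxA LK.
- by apply: regular_linear (nz _ _ _ LL) => _ [x Xx ->]; exists x => //; rewrite mulmxA RK.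
- by move=> _ [x Xx ->]; rewrite !mulmxA LK RK.
- by move=> _ [x Xx ->]; rewrite !mulmxA RK LK.
Qed.

End ClosedSets.

Section Cone.
Variable K : numClosedFieldType.

Definition cone (p : 'rV[K]_(7 * 7)) : Prop :=
  exists X : 'M[K]_(2, 7), [/\ special X, wedge X != 0 & p = mxvec (wedge X)].

Lemma cone_neq0 p : cone p -> p != 0.
Proof. by move=> [X [_ w ->]]; rewrite mxvec_eq0. Qed.

Definition tc (p : 'rV[K]_(7 * 7)) (i j : nat) : K := vec_mx p (o i) (o j).

Lemma tc_wedge X i j : tc (mxvec (wedge X)) i j = pp X i j.
Proof. by rewrite /tc mxvecK wedge_pp. Qed.

Lemma homfun_tc i j : homfun 1 (fun p => tc p i j).
Proof. by apply: eq_homfun (homfun_coord K (mxvec_index (o i) (o j))) _ => p; rewrite /tc mxE. Qed.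

Lemma homfun_tc2 i j k l : homfun 2 (fun p => tc p i j * tc p k l).
Proof. exact: (homfunM (homfun_tc i j) (homfun_tc k l)). Qed.

Lemma homfun_B7 i j : homfun 2 (fun p => B7 (tc p i) (tc p j)).
Proof.
apply: eq_homfun (homfunB (homfunD (homfunD
  (homfunD (homfun_tc2 i 1 j 4) (homfun_tc2 i 4 j 1)) (homfunD (homfun_tc2 i 2 j 5) (homfun_tc2 i 5 j 2)))
  (homfunD (homfun_tc2 i 3 j 6) (homfun_tc2 i 6 j 3))) (homfunZ 2 (homfun_tc2 i 0 j 0))) _ => p.
by rewrite /B7.
Qed.

(** The rows of the tensor lie in the plane, which is totally isotropic. *)
Lemma B7_tc X i j : special X -> B7 (tc (mxvec (wedge X)) i) (tc (mxvec (wedge X)) j) = 0.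
Proof.
move=> [_ n0 n1 b]; rewrite /B7 !tc_wedge /pp; rewrite /N7 in n0 n1; rewrite /B7 in b.
by_comb (lc_add (lc_add (lc_mul (2 * rowc X 0 i * rowc X 0 j) n1) (lc_mul (2 * rowc X 1 i * rowc X 1 j) n0))
  (lc_mul (- (rowc X 0 i * rowc X 1 j + rowc X 1 i * rowc X 0 j)) b)).
Qed.

Lemma B7_diag (A : comNzRingType) (x : nat -> A) : B7 x x = 2 * N7 x.
Proof. by rewrite /B7 /N7; ring. Qed.

Lemma special_of_wedge (X : 'M[K]_(2, 7)) : lin7 (rowc X 0) (rowc X 1) ->
  (forall i j, B7 (rowc X i) (rowc X j) = 0) -> special X.
Proof.
move=> lin H; split=> //; [have := H 0 0|have := H 1 1]; rewrite B7_diag => /eqP;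
  by rewrite mulf_eq0 pnatr_eq0 => /eqP.
Qed.

(** At a nonzero coordinate [c] of the tensor, its rows [i] and [j], the latter divided by [c], span
    the plane by the quadratic Plücker relations. That this pair is special then amounts to
    homogeneous equations in [p]. *)
Lemma cone_closed : zariski_closed cone.
Proof.
apply: zariski_closedI => [p|p p0 H]; first exact: cone_neq0.
have h1 i j : homfun 1 (fun p => tc p i j) := homfun_tc i j.
have lin f : homfun 1 f -> (forall X, special X -> f (mxvec (wedge X)) = 0) -> f p = 0.
  by move=> hf fX; apply: (H _ _ hf) => _ [X [sX _ ->]]; apply: fX.
have quad f : homfun 2 f -> (forall X, special X -> f (mxvec (wedge X)) = 0) -> f p = 0.
  by move=> hf fX; apply: (H _ _ hf) => _ [X [sX _ ->]]; apply: fX.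
have [i [j c0]] : exists i j, tc p i j != 0.
  have : vec_mx p != 0 :> 'M_7 by apply: contra_neq p0 => p0; rewrite -[p]vec_mxK p0 linear0.
  move=> P0; have /existsP[i /existsP[j w]] : [exists i, exists j, vec_mx p i j != 0 :> K].
    apply: contraNT P0 => /existsPn E; apply/eqP/matrixP => i j; rewrite [RHS]mxE.
    by have /existsPn/(_ j) := E i; rewrite negbK => /eqP.
  by exists i, j; rewrite /tc /o !inord_val.
set c := tc p i j in c0.
have plu k l : c * tc p k l = tc p i k * tc p j l - tc p i l * tc p j k.
  apply/eqP; rewrite -subr_eq0; apply/eqP.
  apply: (quad (fun p => tc p i j * tc p k l - (tc p i k * tc p j l - tc p i l * tc p j k))).
    by apply: homfunB; [|apply: homfunB]; apply: homfun_tc2.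
  by move=> X _; rewrite !tc_wedge /pp; ring.
pose X : 'M[K]_(2, 7) := \matrix_(a < 2, k < 7) if a == 0 then tc p i k else c^-1 * tc p j k.
have X0 k : (k < 7)%N -> rowc X 0 k = tc p i k by move=> k7; rewrite /rowc mxE /o inordK.
have X1 k : (k < 7)%N -> rowc X 1 k = c^-1 * tc p j k by move=> k7; rewrite /rowc mxE /o inordK.
have ppX k l : (k < 7)%N -> (l < 7)%N -> rowc X 0 k * rowc X 1 l - rowc X 0 l * rowc X 1 k = tc p k l.
  move=> k7 l7; rewrite !X0 // !X1 //; apply: (mulfI c0); rewrite plu mulrBr.
  by rewrite ![c * (_ * (_ * _))]mulrCA !mulVKf.
have wX : wedge X = vec_mx p.
  apply/matrixP; elim/ord7P => k k7; elim/ord7P => l l7.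
  by rewrite wedge_pp /pp ppX.
exists X; split; last by rewrite wX vec_mxK.
  have r0 := fun k l => quad _ (homfun_B7 k l) (fun X sX => B7_tc k l sX).
  apply: special_of_wedge.
    have dif k l m n := homfunB (h1 k l) (h1 m n); have sum k l m n := homfunD (h1 k l) (h1 m n).
    rewrite /lin7 !ppX //; split; [split|split|]; to0; rewrite ?opprK ?subr0.
    - apply: (lin (fun p => tc p 1 2 - tc p 0 6)); [exact: dif|].
      by move=> Z [/special_elim[[r1 r2 r3] [r4 r5 r6] r7] _ _ _]; rewrite !tc_wedge /pp; by_comb r1.
    - apply: (lin (fun p => tc p 2 3 - tc p 0 4)); [exact: dif|].
      by move=> Z [/special_elim[[r1 r2 r3] [r4 r5 r6] r7] _ _ _]; rewrite !tc_wedge /pp; by_comb r2.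
    - apply: (lin (fun p => tc p 3 1 - tc p 0 5)); [exact: dif|].
      by move=> Z [/special_elim[[r1 r2 r3] [r4 r5 r6] r7] _ _ _]; rewrite !tc_wedge /pp; by_comb r3.
    - apply: (lin (fun p => tc p 4 5 + tc p 0 3)); [exact: sum|].
      by move=> Z [/special_elim[[r1 r2 r3] [r4 r5 r6] r7] _ _ _]; rewrite !tc_wedge /pp; by_comb r4.
    - apply: (lin (fun p => tc p 5 6 + tc p 0 1)); [exact: sum|].
      by move=> Z [/special_elim[[r1 r2 r3] [r4 r5 r6] r7] _ _ _]; rewrite !tc_wedge /pp; by_comb r5.
    - apply: (lin (fun p => tc p 6 4 + tc p 0 2)); [exact: sum|].
      by move=> Z [/special_elim[[r1 r2 r3] [r4 r5 r6] r7] _ _ _]; rewrite !tc_wedge /pp; by_comb r6.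
    - apply: (lin (fun p => tc p 1 4 + tc p 2 5 + tc p 3 6)); [exact: homfunD|].
      by move=> Z [/special_elim[_ _ r7] _ _ _]; rewrite !tc_wedge.
  have E a : exists i' d, forall k, (k < 7)%N -> rowc X a k = d * tc p i' k.
    by move: a; elim/ord2P; [exists i, 1|exists j, c^-1] => k k7; rewrite ?X0 ?X1 ?mul1r.
  move=> a b; have [i' [d Ea]] := E a; have [j' [e Eb]] := E b.
  rewrite /B7 !Ea // !Eb //; apply: (etrans _ (lc_mul (d * e) (r0 i' j'))).
  by rewrite /B7; ring.
by rewrite wX; apply: contra_neq p0 => p0; rewrite -[p]vec_mxK p0 linear0.
Qed.

End Cone.

(** * Transitivity of G_2 on special planes *)

Section Transitivity.
Variable K : numClosedFieldType.

Lemma special_good (X : 'M[K]_(2, 7)) g : good g -> special X -> special (X *m g).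
Proof. by move=> [Pg _ _] sX; have := Pg K^o X sX; rewrite regularE. Qed.

(** The span argument over [K] with [z = 1]: if 15 vanished on all translates, every Plücker
    coordinate would be nilpotent, hence 0. *)
Lemma good_open_cell (X : 'M[K]_(2, 7)) : special X -> wedge X != 0 ->
  exists2 g, good g & pp (X *m g) 1 5 != 0.
Proof.
move=> sX /wedge_neq0[i [j]]; rewrite -(inord_val i) -(inord_val j) wedge_pp => wij.
apply: boolp.contrapT => none; case/negP: wij; apply/eqP.
have [|N] := @nilkill_pp K K^o 1 X sX _ i j (ltn_ord i) (ltn_ord j).
  move=> g gg; exists 1%N; rewrite regularE expr1 mulr1; apply/eqP; apply: boolp.contrapT => /negP ne.
  by apply: none; exists g.
by rewrite mulr1 => /eqP; rewrite expf_eq0 => /andP[_ /eqP].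
Qed.

Definition base : 'M[K]_(2, 7) := mat27 [:: [:: 0; 1; 0; 0; 0; 0; 0]; [:: 0; 0; 0; 0; 0; 1; 0]].

Definition in_cell (X : 'M[K]_(2, 7)) : Prop :=
  [/\ rowc X 0 1%N = 1, rowc X 0 5%N = 0, rowc X 1 1%N = 0 & rowc X 1 5%N = 1].

Lemma special_cell (X : 'M[K]_(2, 7)) : special X -> in_cell X ->
  [/\ rowc X 0 0%N = 0, rowc X 1 0%N = 0, rowc X 0 2%N = 0, rowc X 0 3%N = 0 & rowc X 1 6%N = 0] ->
  X = base.
Proof.
move=> sX [x1 x5 y1 y5] [x0 y0 x2 x3 y6].
have [t [t0]] := special_chart (A := K^o) sX x1 x5 y1 y5.
rewrite expr1n !scale1r => E; move: x0 y0 x2 x3 y6; rewrite E !rowc_mat27 //= t0 !mul1r.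
move=> t1 t2 t3 t4 t5; rewrite /chart t0 t1 t2 t3 t4 t5.
by rewrite /base; congr mat27; do ![congr cons]; ring.
Qed.

Lemma scaleK (t : K) : t%:A = t :> K^o.
Proof. exact: mulr1. Qed.

(** Together with [gU] and [gL], these conjugates are the five root subgroups transverse to the
    stabilizer of [base], one for each dimension of G_2 / P_2. *)
Definition gV (t : K) : 'M[K]_7 := gC *m gC *m gW *m gU t *m gW *m gC.
Definition gL13 (t : K) : 'M[K]_7 := gC *m gW *m gL t *m gW *m gC *m gC.
Definition gL56 (t : K) : 'M[K]_7 := gC *m gC *m gW *m gL t *m gW *m gC.

Ltac good_gens := repeat match goal with
  | |- good (_ *m _) => apply: goodM
  | |- good (gU _) => exact: good_gU
  | |- good (gL _) => exact: good_gL
  | |- good gC => exact: good_gC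
  | |- good gW => exact: good_gW end.

Lemma rowcU (X : 'M[K]_(2, 7)) t a :
  let x := rowc X a in let x' := rowc (X *m gU t) a in
  (x' 0%N = x 0%N + t * x 1%N) * (x' 1%N = x 1%N) * (x' 2%N = x 2%N + t * x 6%N) *
  (x' 3%N = x 3%N - t * x 5%N) * (x' 5%N = x 5%N) * (x' 6%N = x 6%N).
Proof. by rewrite -[gU t]regularE /= !(@gUE K K^o) scaleK. Qed.

Lemma rowcL (X : 'M[K]_(2, 7)) t a :
  let x := rowc X a in let x' := rowc (X *m gL t) a in
  (x' 0%N = x 0%N) * (x' 1%N = x 1%N) * (x' 2%N = x 2%N + t * x 1%N) * (x' 3%N = x 3%N) *
  (x' 4%N = x 4%N - t * x 5%N) * (x' 5%N = x 5%N) * (x' 6%N = x 6%N).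
Proof. by rewrite -[gL t]regularE /= !(@gLE K K^o) scaleK. Qed.

Lemma rowcC (X : 'M[K]_(2, 7)) a :
  let x := rowc X a in let x' := rowc (X *m gC) a in
  (x' 0%N = x 0%N) * (x' 1%N = x 3%N) * (x' 2%N = x 1%N) * (x' 3%N = x 2%N) *
  (x' 4%N = x 6%N) * (x' 5%N = x 4%N) * (x' 6%N = x 5%N).
Proof. by rewrite -[gC]regularE /= !(@gCE K K^o). Qed.

Lemma rowcW (X : 'M[K]_(2, 7)) a :
  let x := rowc X a in let x' := rowc (X *m gW) a in
  (x' 0%N = - x 0%N) * (x' 1%N = x 4%N) * (x' 2%N = x 5%N) * (x' 3%N = x 6%N) *
  (x' 4%N = x 1%N) * (x' 5%N = x 2%N) * (x' 6%N = x 3%N).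
Proof. by rewrite -[gW]regularE /= !(@gWE K K^o). Qed.

Opaque gU gL gC gW.

Lemma rowcV (X : 'M[K]_(2, 7)) t a :
  let x := rowc X a in let x' := rowc (X *m gV t) a in
  (x' 0%N = x 0%N - t * x 5%N) * (x' 1%N = x 1%N) * (x' 5%N = x 5%N).
Proof. by rewrite /gV !mulmxA /= !(rowcC, rowcW, rowcU); do ![split]; ring. Qed.

Lemma rowcL13 (X : 'M[K]_(2, 7)) t a :
  let x := rowc X a in let x' := rowc (X *m gL13 t) a in
  (x' 0%N = x 0%N) * (x' 1%N = x 1%N) * (x' 2%N = x 2%N) * (x' 3%N = x 3%N - t * x 1%N) * (x' 5%N = x 5%N).
Proof. by rewrite /gL13 !mulmxA /= !(rowcC, rowcW, rowcL); do ![split]; ring. Qed.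

Lemma rowcL56 (X : 'M[K]_(2, 7)) t a :
  let x := rowc X a in let x' := rowc (X *m gL56 t) a in
  (x' 0%N = x 0%N) * (x' 1%N = x 1%N) * (x' 2%N = x 2%N - t * x 3%N) * (x' 3%N = x 3%N) *
  (x' 5%N = x 5%N) * (x' 6%N = x 6%N + t * x 5%N).
Proof. by rewrite /gL56 !mulmxA /= !(rowcC, rowcW, rowcL); do ![split]; ring. Qed.

Lemma cell_transitive (X : 'M[K]_(2, 7)) : special X -> in_cell X ->
  exists2 g, good g & X *m g = base.
Proof.
move=> sX [x1 x5 y1 y5].
pose a := - rowc X 0 0; pose X1 := X *m gU a.
pose b := rowc X1 1 0; pose X2 := X1 *m gV b.
pose c := - rowc X2 0 2; pose X3 := X2 *m gL c.
(* The order matters: [gL56] also changes the coordinate 2 by a multiple of the coordinate 3, so the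
   latter is killed before. *)
pose d := rowc X3 0 3; pose X4 := X3 *m gL13 d.
pose e := - rowc X4 1 6; pose X5 := X4 *m gL56 e.
exists (gU a *m gV b *m gL c *m gL13 d *m gL56 e).
  by rewrite /gV /gL13 /gL56; good_gens.
have -> : X *m (gU a *m gV b *m gL c *m gL13 d *m gL56 e) = X5.
  by rewrite /X5 /X4 /X3 /X2 /X1 !mulmxA.
have s5 : special X5.
  by do 5 (apply: special_good => //; first by rewrite /gV /gL13 /gL56; good_gens).
have a0 : rowc X1 0 0 = 0 by rewrite rowcU x1 /a; ring.
have a1 : rowc X1 0 1 = 1 by rewrite rowcU.
have a5 : rowc X1 0 5 = 0 by rewrite rowcU.
have b1 : rowc X1 1 1 = 0 by rewrite rowcU.
have b5 : rowc X1 1 5 = 1 by rewrite rowcU.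
have c0 : rowc X2 0 0 = 0 by rewrite rowcV a0 a5; ring.
have c1 : rowc X2 0 1 = 1 by rewrite rowcV.
have c5 : rowc X2 0 5 = 0 by rewrite rowcV.
have d0 : rowc X2 1 0 = 0 by rewrite rowcV b5 /b; ring.
have d1 : rowc X2 1 1 = 0 by rewrite rowcV.
have d5 : rowc X2 1 5 = 1 by rewrite rowcV.
have e0 : rowc X3 0 0 = 0 by rewrite /X3 rowcL.
have e1 : rowc X3 0 1 = 1 by rewrite /X3 rowcL.
have e2 : rowc X3 0 2 = 0 by rewrite /X3 rowcL c1 /c; ring.
have e5 : rowc X3 0 5 = 0 by rewrite /X3 rowcL.
have f0 : rowc X3 1 0 = 0 by rewrite /X3 rowcL.
have f1 : rowc X3 1 1 = 0 by rewrite /X3 rowcL.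
have f5 : rowc X3 1 5 = 1 by rewrite /X3 rowcL.
have g3 : rowc X4 0 3 = 0 by rewrite /X4 rowcL13 e1 /d; ring.
have h5 : rowc X4 1 5 = 1 by rewrite /X4 rowcL13.
apply: special_cell s5 _ _; split; rewrite /X5 rowcL56 ?g3 ?h5 /e /X4 ?rowcL13 ?(e0, e1, e2, e5, f0, f1) //; ring.
Qed.

End Transitivity.

(* Row i of the product of the Gram matrix with s. *)
Definition gram_row (A : comNzRingType) (s : nat -> nat -> A) (i k : nat) : A := nth 0
  [:: -2 * s 0 k; s 4 k; s 5 k; s 6 k; s 1 k; s 2 k; s 3 k] i.
Definition unit_vec (A : comNzRingType) (i k : nat) : A := (k == i)%:R.

Section AlgebraEquations.
Variables (K : numClosedFieldType) (s : nat -> nat -> K).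

Hypothesis E : forall i j k, (i < 7)%N -> (j < 7)%N -> (k < 7)%N ->
  form3 (gram_row s i) (unit_vec K j) (unit_vec K k) + form3 (unit_vec K i) (gram_row s j) (unit_vec K k)
  + form3 (unit_vec K i) (unit_vec K j) (gram_row s k) = 0.

Let six (a : K) : 6 * a = 0 -> a = 0.
Proof. by move/eqP; rewrite mulf_eq0 pnatr_eq0 => /eqP. Qed.

Ltac solve_combo e := apply: six; apply: (etrans _ e); rewrite /form3 /vol3 /gram_row /unit_vec /=; ring.

(** Derivations of the 3-form preserve the quadratic form. The multipliers solve the linear system
    given by the 35 triples of basis vectors; these 28 relations and the 7 of [algebra_linear] are
    equivalent to it and leave 49 - 35 = 14 dimensions. *)
Lemma algebra_antisym i j : (i <= j < 7)%N -> s i j + s j i = 0.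
Proof.
move=> /andP[ij j7].
case: j j7 ij => [|[|[|[|[|[|[|//]]]]]]] _; case: i => [|[|[|[|[|[|[|//]]]]]]] // _.
- solve_combo (lc_add (lc_add (lc_add (lc_add (lc_mul (-2) (@E 0 1 4 isT isT isT)) (lc_mul (-2) (@E 0 2 5 isT isT isT))) (lc_mul (-2) (@E 0 3 6 isT isT isT))) (lc_mul (2) (@E 1 2 3 isT isT isT))) (lc_mul (2) (@E 4 5 6 isT isT isT))).
- solve_combo (lc_add (lc_add (lc_mul (-3) (@E 0 2 3 isT isT isT)) (lc_mul (-3) (@E 2 4 5 isT isT isT))) (lc_mul (-3) (@E 3 4 6 isT isT isT))).
- solve_combo (lc_mul (12) (@E 2 3 4 isT isT isT)).
- solve_combo (lc_add (lc_add (lc_mul (3) (@E 0 1 3 isT isT isT)) (lc_mul (3) (@E 1 4 5 isT isT isT))) (lc_mul (-3) (@E 3 5 6 isT isT isT))).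
- solve_combo (lc_add (lc_mul (-6) (@E 1 3 4 isT isT isT)) (lc_mul (6) (@E 2 3 5 isT isT isT))).
- solve_combo (lc_mul (-12) (@E 1 3 5 isT isT isT)).
- solve_combo (lc_add (lc_add (lc_mul (-3) (@E 0 1 2 isT isT isT)) (lc_mul (3) (@E 1 4 6 isT isT isT))) (lc_mul (3) (@E 2 5 6 isT isT isT))).
- solve_combo (lc_add (lc_mul (6) (@E 1 2 4 isT isT isT)) (lc_mul (6) (@E 2 3 6 isT isT isT))).
- solve_combo (lc_add (lc_mul (6) (@E 1 2 5 isT isT isT)) (lc_mul (-6) (@E 1 3 6 isT isT isT))).
- solve_combo (lc_mul (12) (@E 1 2 6 isT isT isT)).
- solve_combo (lc_add (lc_add (lc_mul (-3) (@E 0 5 6 isT isT isT)) (lc_mul (3) (@E 1 2 5 isT isT isT))) (lc_mul (3) (@E 1 3 6 isT isT isT))).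
- solve_combo (lc_add (lc_add (lc_add (lc_add (lc_mul (4) (@E 0 1 4 isT isT isT)) (lc_mul (-2) (@E 0 2 5 isT isT isT))) (lc_mul (-2) (@E 0 3 6 isT isT isT))) (lc_mul (2) (@E 1 2 3 isT isT isT))) (lc_mul (2) (@E 4 5 6 isT isT isT))).
- solve_combo (lc_mul (6) (@E 0 1 5 isT isT isT)).
- solve_combo (lc_mul (6) (@E 0 1 6 isT isT isT)).
- solve_combo (lc_mul (12) (@E 1 5 6 isT isT isT)).
- solve_combo (lc_add (lc_add (lc_mul (3) (@E 0 4 6 isT isT isT)) (lc_mul (-3) (@E 1 2 4 isT isT isT))) (lc_mul (3) (@E 2 3 6 isT isT isT))).
- solve_combo (lc_mul (6) (@E 0 2 4 isT isT isT)).
- solve_combo (lc_add (lc_add (lc_add (lc_add (lc_mul (-2) (@E 0 1 4 isT isT isT)) (lc_mul (4) (@E 0 2 5 isT isT isT))) (lc_mul (-2) (@E 0 3 6 isT isT isT))) (lc_mul (2) (@E 1 2 3 isT isT isT))) (lc_mul (2) (@E 4 5 6 isT isT isT))).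
- solve_combo (lc_mul (6) (@E 0 2 6 isT isT isT)).
- solve_combo (lc_add (lc_mul (-6) (@E 1 4 6 isT isT isT)) (lc_mul (6) (@E 2 5 6 isT isT isT))).
- solve_combo (lc_mul (-12) (@E 2 4 6 isT isT isT)).
- solve_combo (lc_add (lc_add (lc_mul (-3) (@E 0 4 5 isT isT isT)) (lc_mul (-3) (@E 1 3 4 isT isT isT))) (lc_mul (-3) (@E 2 3 5 isT isT isT))).
- solve_combo (lc_mul (6) (@E 0 3 4 isT isT isT)).
- solve_combo (lc_mul (6) (@E 0 3 5 isT isT isT)).
- solve_combo (lc_add (lc_add (lc_add (lc_add (lc_mul (-2) (@E 0 1 4 isT isT isT)) (lc_mul (-2) (@E 0 2 5 isT isT isT))) (lc_mul (4) (@E 0 3 6 isT isT isT))) (lc_mul (2) (@E 1 2 3 isT isT isT))) (lc_mul (2) (@E 4 5 6 isT isT isT))).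
- solve_combo (lc_add (lc_mul (6) (@E 1 4 5 isT isT isT)) (lc_mul (6) (@E 3 5 6 isT isT isT))).
- solve_combo (lc_add (lc_mul (6) (@E 2 4 5 isT isT isT)) (lc_mul (-6) (@E 3 4 6 isT isT isT))).
- solve_combo (lc_mul (12) (@E 3 4 5 isT isT isT)).
Qed.

Lemma algebra_linear :
  [/\ [/\ s 1 2 - s 0 6 = 0, s 2 3 - s 0 4 = 0 & s 3 1 - s 0 5 = 0],
      [/\ s 4 5 + s 0 3 = 0, s 5 6 + s 0 1 = 0 & s 6 4 + s 0 2 = 0]
    & s 1 4 + s 2 5 + s 3 6 = 0].
Proof.
split; [split|split|].
- solve_combo (lc_add (lc_add (lc_mul (3) (@E 0 4 5 isT isT isT)) (lc_mul (-3) (@E 1 3 4 isT isT isT))) (lc_mul (3) (@E 2 3 5 isT isT isT))).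
- solve_combo (lc_add (lc_add (lc_mul (3) (@E 0 5 6 isT isT isT)) (lc_mul (3) (@E 1 2 5 isT isT isT))) (lc_mul (-3) (@E 1 3 6 isT isT isT))).
- solve_combo (lc_add (lc_add (lc_mul (-3) (@E 0 4 6 isT isT isT)) (lc_mul (3) (@E 1 2 4 isT isT isT))) (lc_mul (3) (@E 2 3 6 isT isT isT))).
- solve_combo (lc_add (lc_add (lc_mul (-3) (@E 0 1 2 isT isT isT)) (lc_mul (-3) (@E 1 4 6 isT isT isT))) (lc_mul (3) (@E 2 5 6 isT isT isT))).
- solve_combo (lc_add (lc_add (lc_mul (-3) (@E 0 2 3 isT isT isT)) (lc_mul (3) (@E 2 4 5 isT isT isT))) (lc_mul (-3) (@E 3 4 6 isT isT isT))).
- solve_combo (lc_add (lc_add (lc_mul (3) (@E 0 1 3 isT isT isT)) (lc_mul (3) (@E 1 4 5 isT isT isT))) (lc_mul (3) (@E 3 5 6 isT isT isT))).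
- solve_combo (lc_mul (6) (@E 4 5 6 isT isT isT)).
Qed.

End AlgebraEquations.

(** * The cone as the adjoint orbit *)

Section Orbit.
Variable K : numClosedFieldType.
Let Gm : 'M[K]_7 := Gram K.

Lemma wedge_base_neq0 : wedge (base K) != 0.
Proof.
apply/eqP => /matrixP /(_ (o 1) (o 5)); rewrite wedge_pp /pp !rowc_mat27 // mxE /= => /eqP.
by rewrite mulr1 mulr0 subr0 oner_eq0.
Qed.

Lemma cone_transitive (X : 'M[K]_(2, 7)) : special X -> wedge X != 0 ->
  exists g c, [/\ good g, c != 0 & wedge (X *m g) = c *: wedge (base K)].
Proof.
move=> sX wX; have [g gg] := good_open_cell sX wX; set Y := X *m g; set s := pp Y 1 5 => s0.
pose T : 'M[K]_2 := \matrix_(i, j) nth 0 (nth [::] [:: [:: s^-1 * rowc Y 1 5; - (s^-1 * rowc Y 0 5)];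
  [:: - (s^-1 * rowc Y 1 1); s^-1 * rowc Y 0 1]] i) j.
have TE i k : rowc (T *m Y) i k = T i 0 * rowc Y 0 k + T i 1 * rowc Y 1 k by apply: mul_row2.
have sE : s^-1 * (rowc Y 0 1 * rowc Y 1 5 - rowc Y 0 5 * rowc Y 1 1) = 1 by rewrite mulVf.
have [||h gh E] := cell_transitive (X := T *m Y).
- exact: special_mul (special_good gg sX).
- by split; rewrite TE !mxE /= -?sE; ring.
exists (g *m h); exists (T 0 0 * T 1 1 - T 0 1 * T 1 0)^-1.
have E' : (T 0 0 * T 1 1 - T 0 1 * T 1 0) *: wedge (X *m (g *m h)) = wedge (base K).
  by rewrite -E -mulmxA wedge_det mulmxA.
have d0 : T 0 0 * T 1 1 - T 0 1 * T 1 0 != 0.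
  by apply: contra_neq wedge_base_neq0 => d0; rewrite -E' d0 scale0r.
split; [exact: goodM|by rewrite invr_eq0|].
by rewrite -E' scalerA mulVf ?scale1r.
Qed.

Definition X0 : 'M[K]_7 := Gm *m wedge (base K).

Definition Yset : 'rV[K]_(7 * 7) -> Prop := image (@cone K) (lin_mx (mulmx Gm)).

Lemma rowc_Gram m (X : 'M[K]_(m, 7)) a :
  let x := rowc X a in let x' := rowc (X *m Gm) a in
  (x' 0%N = -2 * x 0%N) * (x' 1%N = x 4%N) * (x' 2%N = x 5%N) * (x' 3%N = x 6%N) *
  (x' 4%N = x 1%N) * (x' 5%N = x 2%N) * (x' 6%N = x 3%N).
Proof. by rewrite /= !rowc_mul_mat7 // !big_cons !big_nil /=; do ![split]; ring. Qed.

Lemma Gram_unit : exists Gi, Gi *m Gm = 1%:M.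
Proof.
pose D := diag7 [:: 2^-1 : K; 1; 1; 1; 1; 1; 1]; exists (D *m Gm *m D).
have h : 2^-1 * 2 = 1 :> K by rewrite mulVf ?pnatr_eq0.
apply: mat7_ext => x k k7; rewrite !mulmxA mulmx1.
have E : rowc x 0 0 = 2^-1 * 2 * (2^-1 * 2) * rowc x 0 0 by rewrite h !mul1r.
by case: k k7 => [|[|[|[|[|[|[|//]]]]]]] _;
  rewrite !(rowc_Gram, rowc_diag7) //=; first [ring | rewrite [RHS]E; ring].
Qed.

Lemma form_Z c (X : 'M[K]_7) : g2_algebra X -> g2_algebra (c *: X).
Proof.
have E (w : 'rV[K]_7) k : rowc (c *: w) 0 k = c * rowc w 0 k by rewrite /rowc mxE.
move=> aX x y z; rewrite -(mulr0 c) -(aX x y z) -!scalemxAr !g2_formE.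
by rewrite /form3 /vol3 !E; ring.
Qed.

Lemma g2_algebra_conj (g X : 'M[K]_7) : G2_group g -> g2_algebra X ->
  g2_algebra (g *m X *m invmx g).
Proof.
move=> [dg fg] aX x y z; have gU : g \in unitmx by rewrite unitmxE dg unitr1.
rewrite -!(fg (_ *m (g *m X *m invmx g))) -!(fg _ (_ *m (g *m X *m invmx g))) -(fg _ _ (_ *m (g *m X *m invmx g))).
by rewrite !mulmxA !mulmxKV // aX.
Qed.

Lemma rowc_base k : (k < 7)%N -> (rowc (base K) 0 k = (k == 1)%:R) * (rowc (base K) 1 k = (k == 5)%:R).
Proof. by move=> k7; rewrite !rowc_mat27 //; case: k k7 => [|[|[|[|[|[|[|//]]]]]]]. Qed.

Lemma mul_wedge m n (M : 'M[K]_(m, n)) (X : 'M[K]_(2, n)) i k : (M *m wedge X) i k =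
  (M *m X^T) i 0 * X 1 k - (M *m X^T) i 1 * X 0 k.
Proof.
rewrite mxE [(M *m X^T) i 0]mxE [(M *m X^T) i 1]mxE !mulr_suml -sumrB; apply: eq_bigr => j _.
by rewrite wedgeE ![X^T _ _]mxE; ring.
Qed.

Lemma rowc_X0 (x : 'rV[K]_7) k : (k < 7)%N ->
  rowc (x *m X0) 0 k = rowc x 0 4 * (k == 5)%:R - rowc x 0 2 * (k == 1)%:R.
Proof.
move=> k7; rewrite /X0 mulmxA /rowc mul_wedge -/(rowc (base K) _ _) -/(rowc (base K) _ _) !rowc_base //.
have E i : (x *m Gm *m (base K)^T) 0 i = \sum_(j <- iota 0 7) rowc (x *m Gm) 0 j * rowc (base K) i j.
  by rewrite mxE sum_ord7; apply: eq_bigr => j _; rewrite [_^T _ _]mxE.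
by rewrite !E !big_cons !big_nil !rowc_base //= !rowc_Gram /rowc; ring.
Qed.

Lemma g2_algebra_X0 : g2_algebra X0.
Proof.
by move=> x y z; rewrite !g2_formE /form3 /vol3 !rowc_X0 //=; ring.
Qed.

(** On tensors [g] acts by g^T w g; invariance of the Gram matrix turns this into conjugation of
    [Gm *m w] by the inverse of [g]. *)
Lemma orbit_of_cone p : Yset p -> adjoint_orbit X0 p.
Proof.
move=> [_ [X [sX wX ->]] ->]; rewrite mul_vec_lin /=.
have [g [c [gg c0 E]]] := cone_transitive sX wX.
have [Pg _ [[dg fg] bg]] := gg; have gU : g \in unitmx by rewrite unitmxE dg unitr1.
exists g, c; split=> //; congr mxvec.
apply: (can_inj (mulmxK gU)); rewrite -scalemxAl mulmxKV // /X0.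
have -> : wedge (base K) = c^-1 *: (g^T *m wedge X *m g).
  by rewrite -wedge_mulmx E scalerA mulVf ?scale1r.
by rewrite -!scalemxAr scalerA divff // scale1r !mulmxA bg.
Qed.

Definition J2 : 'M[K]_2 := \matrix_(i, j) ((j == 1)%:R * (i == 0)%:R - (j == 0)%:R * (i == 1)%:R).

Lemma wedgeJ n (X : 'M[K]_(2, n)) : wedge X = X^T *m J2 *m X.
Proof.
apply/matrixP => i j; rewrite wedgeE mxE !big_ord_recl big_ord0 !mxE !big_ord_recl !big_ord0 !mxE /=.
have -> : lift ord0 ord0 = 1 :> 'I_2 by apply/val_inj.
by rewrite /=; ring.
Qed.

Lemma J2_square : J2 *m J2 = - 1%:M.
Proof.
apply/matrixP; elim/ord2P; elim/ord2P; rewrite !mxE !big_ord_recl big_ord0 !mxE /=; ring.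
Qed.

Lemma antisym2 (q : 'M[K]_2) : q^T = - q -> q = q 0 1 *: J2.
Proof.
move=> /matrixP H.
have h i j : q j i = - q i j by have := H i j; rewrite !mxE.
have d i : q i i = 0.
  by have /eqP := h i i; rewrite -subr_eq0 opprK -mulr2n mulrn_eq0 => /eqP.
apply/matrixP; elim/ord2P; elim/ord2P; rewrite [RHS]mxE /J2 mxE /= ?d ?[q 1 0](h 0 1); ring.
Qed.

Section Alg.
Variable S : 'M[K]_7.
Hypothesis aS : g2_algebra (Gm *m S).
Let s i j := S (o i) (o j).

Lemma form3_ext (x y z x' y' z' : nat -> K) : (forall k, (k < 7)%N -> x k = x' k) ->
  (forall k, (k < 7)%N -> y k = y' k) -> (forall k, (k < 7)%N -> z k = z' k) ->
  form3 x y z = form3 x' y' z'.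
Proof. by move=> Ex Ey Ez; rewrite /form3 /vol3 !Ex // !Ey // !Ez. Qed.

Lemma algebra_eqs i j k : (i < 7)%N -> (j < 7)%N -> (k < 7)%N ->
  form3 (gram_row s i) (unit_vec K j) (unit_vec K k) + form3 (unit_vec K i) (gram_row s j) (unit_vec K k)
  + form3 (unit_vec K i) (unit_vec K j) (gram_row s k) = 0.
Proof.
move=> i7 j7 k7; pose e n : 'rV[K]_7 := delta_mx 0 (o n).
have eE n l : (n < 7)%N -> (l < 7)%N -> rowc (e n) 0 l = unit_vec K n l.
  by move=> n7 l7; rewrite /rowc mxE o_eq.
have eS n l : (n < 7)%N -> (l < 7)%N -> rowc (e n *m (Gm *m S)) 0 l = gram_row s n l.
  move=> n7 l7; rewrite mulmxA /rowc mxE sum_ord7.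
  have -> : \sum_(j <- iota 0 7) (e n *m Gm) 0 (o j) * S (o j) (o l) = \sum_(j <- iota 0 7) rowc (e n *m Gm) 0 j * s j l.
    by [].
  rewrite !big_cons big_nil !rowc_Gram !eE //.
  by case: n n7 => [|[|[|[|[|[|[|//]]]]]]] _; rewrite /unit_vec /gram_row /=; ring.
have := aS (e i) (e j) (e k); rewrite !g2_formE => H; apply: (etrans _ H).
congr (_ + _ + _); apply: form3_ext => l l7; by rewrite ?eE ?eS.
Qed.

Lemma algebra_tr : S^T = - S.
Proof.
apply/matrixP; elim/ord7P => i i7; elim/ord7P => j j7; rewrite !mxE.
apply/eqP; rewrite -subr_eq0 opprK; apply/eqP.
by case: (leqP i j) => ij; [rewrite addrC|]; apply: (algebra_antisym algebra_eqs); rewrite ?ij ?(ltnW ij).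
Qed.

Lemma algebra_lin7 (X : 'M[K]_(2, 7)) : wedge X = S -> lin7 (rowc X 0) (rowc X 1).
Proof.
move=> E; have pS i j : rowc X 0 i * rowc X 1 j - rowc X 0 j * rowc X 1 i = s i j by rewrite /s -E wedge_pp.
have [[r1 r2 r3] [r4 r5 r6] r7] := algebra_linear algebra_eqs.
by rewrite /lin7 !pS; split; [split|split|] => //; to0; rewrite ?opprK.
Qed.

End Alg.

End Orbit.

Section Adjoint.
Variable K : numClosedFieldType.
Let Gm : 'M[K]_7 := Gram K.
Let J := J2 K.

Lemma mul_J_cancel (M : 'M[K]_2) : J *m M *m J = 0 -> M = 0.
Proof.
move=> E; have : J *m (J *m M *m J) *m J = 0 by rewrite E mulmx0 mul0mx.
rewrite !mulmxA J2_square mulNmx mul1mx -mulmxA J2_square mulNmx mulmxN opprK mulmx1.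
by [].
Qed.

Lemma base_right_inv : base K *m (base K)^T = 1%:M.
Proof.
apply/matrixP => i j; rewrite !mxE.
transitivity (\sum_(k <- iota 0 7) rowc (base K) i k * rowc (base K) j k).
  by rewrite sum_ord7; apply: eq_bigr => k _; rewrite [_^T _ _]mxE.
rewrite !big_cons big_nil !rowc_mat27 //; move: i j; elim/ord2P; elim/ord2P => /=; ring.
Qed.

Lemma base_isotropic : base K *m Gm *m (base K)^T = 0.
Proof.
apply/matrixP => i j; rewrite !mxE.
transitivity (\sum_(k <- iota 0 7) rowc (base K *m Gm) i k * rowc (base K) j k).
  by rewrite sum_ord7; apply: eq_bigr => k _; rewrite [_^T _ _]mxE.
rewrite !big_cons big_nil !rowc_Gram !rowc_mat27 //; move: i j; elim/ord2P; elim/ord2P => /=; ring.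
Qed.

Lemma isotropic_B7 (X : 'M[K]_(2, 7)) i j : X *m Gm *m X^T = 0 -> B7 (rowc X i) (rowc X j) = 0.
Proof.
move=> /matrixP/(_ i j); rewrite [RHS]mxE => E.
have rE k l : rowc (row k X) 0 l = rowc X k l by rewrite /rowc mxE.
transitivity (B7 (rowc (row i X) 0) (rowc (row j X) 0)); first by rewrite /B7 !rE.
rewrite -GramE -[RHS]E -row_mul.
by rewrite [LHS]mxE [RHS]mxE; apply: eq_bigr => k _; rewrite !mxE.
Qed.

Lemma X0_square : X0 K *m X0 K = 0.
Proof.
rewrite /X0 wedgeJ !mulmxA; have := base_isotropic; rewrite /Gm => E.
by rewrite -(mulmxA _ (base K) (Gram K)) -(mulmxA _ (base K *m _)) E mulmx0 !mul0mx.
Qed.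

Lemma conj_mul n (g X Y : 'M[K]_n) : g \in unitmx ->
  g *m X *m invmx g *m (g *m Y *m invmx g) = g *m (X *m Y) *m invmx g.
Proof. by move=> gU; rewrite !mulmxA mulmxKV. Qed.

Lemma conj_unconj n (g X : 'M[K]_n) : g \in unitmx -> invmx g *m (g *m X *m invmx g) *m g = X.
Proof. by move=> gU; rewrite !mulmxA mulVmx // mul1mx mulmxKV. Qed.

(** [G2_group] provides invariance of the 3-form, not directly of the special pairs, so the plane is
    rebuilt from the matrix: membership in g_2 gives antisymmetry and the linear relations, rank 2
    gives the two rows, and square zero gives isotropy. *)
Lemma cone_of_orbit p : adjoint_orbit (X0 K) p -> Yset p.
Proof.
move=> [g [c [Gg c0 ->]]]; have [dg _] := Gg.
have gU : g \in unitmx by rewrite unitmxE dg unitr1.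
set Z := c *: _; have [Gi GiG] := Gram_unit K; have GGi := mulmx1C GiG.
have aZ : g2_algebra Z := form_Z c (g2_algebra_conj Gg (@g2_algebra_X0 K)).
have Z2 : Z *m Z = 0.
  by rewrite /Z -scalemxAl -scalemxAr conj_mul // X0_square mulmx0 mul0mx !scaler0.
have Z0 : Z != 0.
  apply: contra_neq (wedge_base_neq0 K) => Z0.
  have : c^-1 *: (Gi *m (invmx g *m Z *m g)) = wedge (base K).
    rewrite /Z -scalemxAr -scalemxAl -scalemxAr scalerA mulVf // scale1r conj_unconj //.
    by rewrite /X0 mulmxA GiG mul1mx.
  by rewrite Z0 mulmx0 mul0mx mulmx0 scaler0.
pose S := Gi *m Z; have ZE : Z = Gm *m S by rewrite /S mulmxA GGi mul1mx.
have aS : g2_algebra (Gm *m S) by rewrite -ZE.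
have trS := algebra_tr aS.
pose R := base K *m invmx g; pose N := g *m (base K)^T.
have RN : R *m N = 1%:M by rewrite /R /N mulmxA mulmxKV // base_right_inv.
(* The row space of [S] lies in that of [R]; antisymmetry gives the same for its columns, whence the
   form R^T q R. *)
have SQ : S = S *m N *m R.
  have -> : S = c *: (Gi *m g *m Gm *m (base K)^T *m J) *m R.
    by rewrite /S /Z /X0 wedgeJ -scalemxAr -scalemxAl !mulmxA.
  by move: (c *: _) => Q0; rewrite -(mulmxA Q0) RN mulmx1.
clearbody S R N; pose q := N^T *m S *m N.
have SQ' : R^T *m N^T *m S = S by apply: oppr_inj; rewrite -mulmxN -trS -!trmx_mul mulmxA -SQ.
have SR : S = R^T *m q *m R by rewrite /q !mulmxA SQ' -SQ.
have qJ : q = q 0 1 *: J.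
  by apply: antisym2; rewrite /q !trmx_mul trmxK trS mulNmx mulmxN mulmxA.
(* Scaling the first row of [R] by [a] absorbs the coefficient of [J]. *)
set a := q 0 1 in qJ; pose T : 'M[K]_2 := \matrix_(i, j) ((i == j)%:R * (if i == 0 then a else 1)).
have wX : wedge (T *m R) = S.
  rewrite wedge_det !mxE /= SR qJ -scalemxAr -scalemxAl -wedgeJ; congr (_ *: _); ring.
have wX0 : wedge (T *m R) != 0.
  by rewrite wX; apply: contra_neq Z0 => S0; rewrite ZE S0 mulmx0.
move: (T *m R) wX wX0 => X wX wX0.
exists (mxvec (wedge X)); last by rewrite mul_vec_lin /= wX -ZE.
exists X; split=> //; apply: special_of_wedge; first exact: (@algebra_lin7 K S aS X wX).
move=> i j; apply: isotropic_B7; have [M XM] := wedge_frame wX0.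
have MX : M^T *m X^T = 1%:M by rewrite -trmx_mul XM trmx1.
apply: mul_J_cancel.
have : M^T *m (S *m Gm *m S) *m M = 0.
  have -> : S *m Gm *m S = Gi *m (Z *m Z).
    by rewrite {1}ZE !mulmxA GiG mul1mx -mulmxA -ZE.
  by rewrite Z2 !mulmx0 mul0mx.
by rewrite -wX wedgeJ !mulmxA MX mul1mx -!mulmxA XM mulmx1 !mulmxA.
Qed.

Lemma lin_mx_cancel m n p q (f : {linear 'M[K]_(m, n) -> 'M[K]_(p, q)})
    (g : {linear 'M[K]_(p, q) -> 'M[K]_(m, n)}) :
  (forall M, g (f M) = M) -> lin_mx f *m lin_mx g = 1%:M.
Proof.
move=> gf; apply/row_matrixP => i; rewrite !rowE mulmxA mulmx1.
by rewrite -[delta_mx 0 i]vec_mxK !mul_vec_lin gf.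
Qed.

Lemma Yset_adjoint : G2_adjoint_variety (@Yset K).
Proof.
have [Gi GiG] := Gram_unit K.
exists (X0 K); split.
- apply: contra_neq (wedge_base_neq0 K) => E.
  by rewrite -[wedge _]mul1mx -GiG -mulmxA -/(X0 K) E mulmx0.
- exact: g2_algebra_X0.
- by move=> p; split; [apply: orbit_of_cone|apply: cone_of_orbit].
- apply: (zariski_closed_image (L' := lin_mx (mulmx Gi))); last exact: cone_closed.
  by apply: lin_mx_cancel => M; rewrite /= mulmxA GiG mul1mx.
Qed.

Lemma conjm_mul n p q (D : 'M[K]_(n, p)) (E : 'M[K]_(p, q)) :
  conjm D *m conjm E = conjm (D *m E).
Proof.
apply/row_matrixP => i; rewrite !rowE mulmxA -[delta_mx 0 i]vec_mxK !mul_conjm.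
by rewrite trmx_mul !mulmxA.
Qed.

Lemma conjm1 n : conjm (1%:M : 'M[K]_n) = 1%:M.
Proof.
apply/row_matrixP => i; rewrite !rowE -[delta_mx 0 i]vec_mxK mul_conjm.
by rewrite trmx1 mul1mx !mulmx1.
Qed.

Lemma conjm0 n p : conjm (0 : 'M[K]_(n, p)) = 0.
Proof.
apply/row_matrixP => i; rewrite !rowE -[delta_mx 0 i]vec_mxK mul_conjm.
by rewrite !mulmx0 linear0.
Qed.

Lemma component_image D (p : 'rV[K]_((7 + 7) * (7 + 7))) : component D p <-> image (@cone K) (conjm D) p.
Proof.
split=> [[X [sX wX ->]]|[_ [X [sX wX ->]] ->]].
  by exists (mxvec (wedge X)); [exists X|rewrite mul_conjm wedge_mulmx].
by exists X; split=> //; rewrite mul_conjm wedge_mulmx.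
Qed.

Lemma two_copies psi D1 D2 E1 E2 : decomposes psi D1 D2 E1 E2 ->
  disjoint_union_of_two_copies (zero_locus psi) (@Yset K).
Proof.
move=> dec; have [[h11 h22 h12 h21] _ _] := dec.
have c1 : conjm D1 *m conjm E1 = 1%:M by rewrite conjm_mul h11 conjm1.
have c2 : conjm D2 *m conjm E2 = 1%:M by rewrite conjm_mul h22 conjm1.
have [Gi GiG] := Gram_unit K.
have cG : lin_mx (mulmx Gm : _ -> 'M_(7, 7)) *m lin_mx (mulmx Gi : _ -> 'M_(7, 7)) = 1%:M.
  by apply: lin_mx_cancel => M; rewrite /= mulmxA GiG mul1mx.
exists (image (@cone K) (conjm D1)), (image (@cone K) (conjm D2)); split.
- by split; [apply: zariski_closed_image c1 _|apply: zariski_closed_image c2 _]; apply: cone_closed.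
- by move=> p; rewrite (zero_locus_iff dec) !component_image.
(* [conjm E1] kills the second component and is injective on the first, which avoids 0. *)
- move=> p [[x1 /cone_neq0/eqP x1n E] [x2 _ F]]; apply: x1n.
  by rewrite -[x1]mulmx1 -c1 mulmxA -E F -mulmxA conjm_mul h21 conjm0 mulmx0.
- by split; [apply: isomorphic_images c1 cG _|apply: isomorphic_images c2 cG _]; apply: cone_neq0.
Qed.

End Adjoint.

Local Open Scope complex_scope.

Theorem proposition29 (R : realType) :
  exists Y : 'rV[R[i]]_(7 * 7) -> Prop,
    G2_adjoint_variety Y /\
    for_general_even_spinor (fun psi : spinor R[i] =>
      zero_scheme_reduced psi /\
      disjoint_union_of_two_copies (zero_locus psi) Y).
Proof.
exists (@Yset R[i]); split; first exact: Yset_adjoint.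
have [P [P0 HP]] := generic_equiv R[i]; exists P; split=> // psi ev nz.
have [D1 [D2 [E1 [E2 dec]]]] := decomposes_equiv (HP psi ev nz) (decomposes_psi0 _).
by split; [apply: reduced dec|apply: two_copies dec].
Qed.
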